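(* Let $\Omega_1\subset\mathbb{C}^n$ and $\Omega_2\subset\mathbb{C}^m$ be bounded domains with Bergman metrics $g_{B_1}$ and $g_{B_2}$, respectively. Suppose that there exists a constant $C>0$ such that $$\sup_{w,\zeta\in\Omega_2}\left|\partial_w\log P_2(w,\zeta)\right|^2_{g_{B_2}}\le C,$$ where $P_2$ is the Berezin kernel of $\Omega_2$ and the supremum is over pairs $(w,\zeta)$ with $P_2(w,\zeta)\neq 0$. Then for any holomorphic map $f:\Omega_1\to\Omega_2$, $$f^*g_{B_2}\le C\,g_{B_1},$$ i.e. $f^*g_{B_2}(X,X)\le C\,g_{B_1}(X,X)$ for all $z\in\Omega_1$ and $X\in T^{1,0}_z\Omega_1$.
   Context: For a bounded domain $\Omega\subset\mathbb{C}^n$, $A^2(\Omega)$ is the Hilbert space of holomorphic functions on $\Omega$ that are square integrable for Lebesgue measure $dV$, with $\langle f,g\rangle=\int_\Omega f\bar g\,dV$. The Bergman kernel is $\mathcal{B}(z,\xi)=\sum_j\phi_j(z)\overline{\phi_j(\xi)}$ for any orthonormal basis $\{\phi_j\}$ of $A^2(\Omega)$; it is holomorphic in $z$, anti-holomorphic in $\xi$, and $\mathcal{B}(z,z)>0$. The Bergman metric is $g_B(X,Y)=\sum_{j,k}\frac{\partial^2\log\mathcal{B}(z,z)}{\partial z_j\partial\bar z_k}X_j\overline{Y_k}$ for $X,Y\in T^{1,0}_z\Omega\cong\mathbb{C}^n$; it is positive definite. The Berezin kernel (density function of the Bergman statistical model) is $$P(z,\xi)=\frac{|\mathcal{B}(z,\xi)|^2}{\mathcal{B}(z,z)}.$$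 $P_2$ denotes the Berezin kernel of $\Omega_2$. For fixed $\zeta$, $\partial_w\log P_2(w,\zeta)$ is the $(1,0)$-form $\sum_j\frac{\partial\log P_2(w,\zeta)}{\partial w_j}dw_j$ in the variable $w$, defined where $P_2(w,\zeta)\ne0$, and its norm is $$|\partial_w\log P_2(w,\zeta)|^2_{g_{B_2}}=\sup_{0\ne Y\in T^{1,0}_w\Omega_2}\frac{|\partial_Y\log P_2(w,\zeta)|^2}{g_{B_2}(Y,Y)},\qquad \partial_Y=\sum_jY_j\frac{\partial}{\partial w_j}.$$ The pullback is $f^*g_{B_2}(X,X)=g_{B_2}(df(X),df(X))$, evaluated at $f(z)$. *)

(* Defs.v *)
From HB Require Import structures.
From mathcomp Require Import all_boot all_order all_algebra.
From mathcomp Require Import complex.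
From mathcomp Require Import all_classical all_reals all_analysis.
Set Implicit Arguments.
Unset Strict Implicit.
Unset Printing Implicit Defensive.
Import Order.TTheory GRing.Theory Num.Theory.
Import numFieldNormedType.Exports.
Local Open Scope classical_set_scope.
Local Open Scope ring_scope.
Local Open Scope complex_scope.

(* The topology and norm that the library puts on every [numFieldType], made
   available on the type [R[i]] itself. *)
HB.instance Definition _ (R : realType) := NormedModule.copy R[i] R[i]^o.

(* [m1 \x m2] with its sigma-finite structure, which the library does not infer. *)
Section sigma_finite_product.
Context d1 d2 (T1 : measurableType d1) (T2 : measurableType d2) (R : realType).
Variables (m1 : {sigma_finite_measure set T1 -> \bar R})
  (m2 : {sigma_finite_measure set T2 -> \bar R}).

Definition sigma_finite_product : set (T1 * T2) -> \bar R := (m1 \x m2)%E.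

HB.instance Definition _ := Measure.on sigma_finite_product.

Let sigma_finite_product_sigma_finite : sigma_finite setT sigma_finite_product.
Proof.
have /sigma_finiteP[F [TF ndF Foo]] := sigma_finiteT m1.
have /sigma_finiteP[G [TG ndG Goo]] := sigma_finiteT m2.
exists (fun n => F n `*` G n).
  rewrite -setXTT TF TG predeqE => -[x y]; split.
    move=> [/= [n _ Fnx] [k _ Gky]]; exists (maxn n k) => //; split.
    - by move: x Fnx; exact/subsetPset/ndF/leq_maxl.
    - by move: y Gky; exact/subsetPset/ndG/leq_maxr.
  by move=> [n _ []/= ? ?]; split; exists n.
move=> k; have [? ?] := Foo k; have [? ?] := Goo k.
split; first exact: measurableX.
by rewrite /sigma_finite_product product_measure1E// lte_mul_pinfty// ge0_fin_numE.
Qed.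

HB.instance Definition _ := Measure_isSigmaFinite.Build _ _ _
  sigma_finite_product sigma_finite_product_sigma_finite.

End sigma_finite_product.

Section tuple_measure.
Context d (T : measurableType d) (R : realType).

Definition tuple_cons n (p : T * n.-tuple T) : n.+1.-tuple T :=
  [the n.+1.-tuple T of p.1 :: p.2].

Lemma measurable_tuple_cons n : measurable_fun setT (@tuple_cons n).
Proof. exact: measurable_cons measurable_fst measurable_snd. Qed.

Section measure_cons.
Variables (n : nat) (mu : {sigma_finite_measure set T -> \bar R})
  (nu : {sigma_finite_measure set (n.-tuple T) -> \bar R}).

Definition measure_cons := pushforward (sigma_finite_product mu nu) (@tuple_cons n).

Let mpre A : measurable A -> measurable (@tuple_cons n @^-1` A).
Proof.
by move=> mA; rewrite -[X in measurable X]setTI; exact: measurable_tuple_cons.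
Qed.

Let measure_cons0 : measure_cons set0 = 0%E.
Proof. by rewrite /measure_cons /pushforward preimage_set0 measure0. Qed.

Let measure_cons_ge0 A : (0 <= measure_cons A)%E.
Proof. by rewrite /measure_cons /pushforward measure_ge0. Qed.

Let measure_cons_sigma_additive : semi_sigma_additive measure_cons.
Proof.
move=> F mF tF mUF; rewrite /measure_cons /pushforward preimage_bigcup.
apply: measure_semi_sigma_additive.
- by move=> k; exact: mpre.
- apply/trivIsetP => /= i j _ _ ij; rewrite -preimage_setI.
  by move/trivIsetP : tF => /(_ _ _ _ _ ij) ->//; rewrite preimage_set0.
- by rewrite -preimage_bigcup; exact: mpre.
Qed.

HB.instance Definition _ := isMeasure.Build _ _ _ measure_cons
  measure_cons0 measure_cons_ge0 measure_cons_sigma_additive.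

Let measure_cons_sigma_finite : sigma_finite setT measure_cons.
Proof.
have [F FT Ffin] := sigma_finiteT (sigma_finite_product mu nu).
pose u (t : n.+1.-tuple T) : T * n.-tuple T := (thead t, [tuple of behead t]).
have mu_ : measurable_fun setT u.
  apply/measurable_fun_pairP; split; last exact: measurable_behead.
  exact: measurable_tnth.
have uK p : u (tuple_cons p) = p.
  by case: p => x t; congr pair; apply/val_inj.
exists (fun k => u @^-1` F k); first by rewrite -preimage_bigcup -FT.
move=> k; have [mF finF] := Ffin k; split.
  by rewrite -[X in measurable X]setTI; exact: mu_.
rewrite /measure_cons /pushforward [X in sigma_finite_product _ _ X](_ : _ = F k)//.
by apply/seteqP; split=> p; rewrite /preimage/= uK.
Qed.

HB.instance Definition _ :=
  Measure_isSigmaFinite.Build _ _ _ measure_cons measure_cons_sigma_finite.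

End measure_cons.

Fixpoint tuple_measure (mu : {sigma_finite_measure set T -> \bar R}) n :
    {sigma_finite_measure set (n.-tuple T) -> \bar R} :=
  match n with
  | 0 => [the {sigma_finite_measure set _ -> \bar R} of \d_[tuple]]
  | n.+1 => [the {sigma_finite_measure set _ -> \bar R} of
             measure_cons mu (tuple_measure mu n)]
  end.

End tuple_measure.

Section bergman.
Context (R : realType) (n : nat).
Local Notation Cn := 'rV[R[i]]_n.
Implicit Types (Om : set Cn) (z w zeta X Y : Cn).

Definition bounded_domain Om :=
  [/\ Om !=set0, open Om, connected Om & bounded_set Om].

Definition holomorphic_on m Om (f : Cn -> 'rV[R[i]]_m) :=
  forall z, Om z -> differentiable f z.

Definition holomorphic_fun_on Om (f : Cn -> R[i]) :=
  forall z, Om z -> differentiable f z.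

(* Lebesgue measure dV on C^n = (R x R)^n; [xyC] sends ((x_j, y_j))_j to the
   point with coordinates x_j + i y_j. *)
Definition xyC (t : n.-tuple (measurableTypeR R * measurableTypeR R)) : Cn :=
  \row_j ((tnth t j).1 +i* (tnth t j).2).

Definition dV : {sigma_finite_measure
    set (n.-tuple (measurableTypeR R * measurableTypeR R)) -> \bar R} :=
  tuple_measure
    (sigma_finite_product (@lebesgue_measure R) (@lebesgue_measure R)) n.

Definition L2normsq Om (f : Cn -> R[i]) : \bar R :=
  (\int[dV]_(t in xyC @^-1` Om) (Normc.normc (f (xyC t)) ^+ 2)%:E)%E.

Definition inner Om (f g : Cn -> R[i]) : R[i] :=
  (\int[dV]_(t in xyC @^-1` Om) complex.Re (f (xyC t) * (g (xyC t))^*%C)) +i*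
  (\int[dV]_(t in xyC @^-1` Om) complex.Im (f (xyC t) * (g (xyC t))^*%C)).

Definition bergman_space Om (f : Cn -> R[i]) :=
  holomorphic_fun_on Om f /\ (L2normsq Om f < +oo)%E.

(* A Hilbert basis: the expansion of every f in A^2(Om) converges to f in norm.
   Indexing by nat is no restriction when 0 < n: A^2 of a bounded domain is then
   separable and infinite-dimensional. *)
Definition bergman_orthonormal_basis Om (phi : nat -> Cn -> R[i]) :=
  [/\ forall j, bergman_space Om (phi j),
      forall j k, inner Om (phi j) (phi k) = (j == k)%:R &
      forall f, bergman_space Om f ->
        L2normsq Om (fun z =>
          f z - \sum_(j < N) inner Om f (phi j) * phi j z) @[N --> \oo]
        --> 0%E].

(* An arbitrary orthonormal basis; on Om x Om the kernel below does not depend on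
   which one is selected. *)
Definition bergman_basis Om : nat -> Cn -> R[i] :=
  xget (fun _ _ => 0) (bergman_orthonormal_basis Om).

Definition bergman_kernel Om z zeta : R[i] :=
  limn (fun N => \sum_(j < N)
    bergman_basis Om j z * (bergman_basis Om j zeta)^*%C).

Definition real_derive X (g : Cn -> R[i]) z : R[i] :=
  derive1 (fun t : R => complex.Re (g (z + t%:C *: X))) 0 +i*
  derive1 (fun t : R => complex.Im (g (z + t%:C *: X))) 0.

(* Wirtinger derivatives d/dz_j = (d/dx_j - i d/dy_j)/2 and
   d/dzbar_j = (d/dx_j + i d/dy_j)/2. *)
Definition dz (j : 'I_n) (g : Cn -> R[i]) z : R[i] :=
  (real_derive (delta_mx 0 j) g z
   - 'i%C * real_derive ('i%C *: delta_mx 0 j) g z) / 2%:R.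

Definition dzbar (j : 'I_n) (g : Cn -> R[i]) z : R[i] :=
  (real_derive (delta_mx 0 j) g z
   + 'i%C * real_derive ('i%C *: delta_mx 0 j) g z) / 2%:R.

Definition log_bergman_diag Om z : R[i] :=
  (ln (complex.Re (bergman_kernel Om z z)))%:C.

Definition bergman_metric Om z X Y : R[i] :=
  \sum_j \sum_k dz j (dzbar k (log_bergman_diag Om)) z * X 0 j * (Y 0 k)^*%C.

Definition berezin_kernel Om z zeta : R :=
  Normc.normc (bergman_kernel Om z zeta) ^+ 2
  / complex.Re (bergman_kernel Om z z).

(* \partial_Y log P(w, zeta), in the variable w. *)
Definition d_log_berezin Om zeta Y w : R[i] :=
  \sum_j Y 0 j * dz j (fun w => (ln (berezin_kernel Om w zeta))%:C) w.

Definition d_log_berezin_normsq Om w zeta : \bar R :=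
  ereal_sup [set (Normc.normc (d_log_berezin Om zeta Y w) ^+ 2
                  / complex.Re (bergman_metric Om w Y Y))%:E |
             Y in [set Y | Y != 0]].

End bergman.

(* f is used only where it is complex differentiable, so that ['d f z] is the
   map df : T^{1,0}_z -> T^{1,0}_{f z}. *)
Definition pullback_metric (R : realType) n m (Om2 : set 'rV[R[i]]_m)
    (f : 'rV[R[i]]_n -> 'rV[R[i]]_m) (z X Y : 'rV[R[i]]_n) : R[i] :=
  bergman_metric Om2 (f z) ('d f z X) ('d f z Y).

(* Main.v *)
From HB Require Import structures.
Require Import Defs.
From mathcomp Require Import all_boot all_order all_algebra.
From mathcomp Require Import complex ring lra.
From mathcomp Require Import all_classical all_reals all_analysis.
From mathcomp Require Import measurable_realfun.
Import Order.TTheory GRing.Theory Num.Theory.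
Import numFieldNormedType.Exports.
Local Open Scope classical_set_scope.
Local Open Scope ring_scope.
Set Implicit Arguments.
Unset Strict Implicit.
Unset Printing Implicit Defensive.

(* Fix an orthonormal basis [phi] of [A^2(Om)] and put [E z = (phi_j z)_j] and
   [D z X = (d(phi_j)_z X)_j] in l2, so that [B(z, w) = <E z, E w>].  With [M z X]
   the component of [D z X] orthogonal to [E z], one finds
   [g_B(X, X) = |M z X|^2 / B(z, z)] and
   [d_Y log P(w, zeta) = <M w Y, E zeta> / <E w, E zeta>].  The hypothesis bounds
   [|d log |B2(., zeta)||] locally, hence the kernel [B2] has no zeros.  For
   [w = f z], [Y = df X] and [G = g_B2(Y, Y)], the function
   [h(zeta) = conj (d_Y log P2(w, zeta))] is then holomorphic on [Om2], with
   [|h|^2 <= C G], [h w = 0] and [dh_w Y = G].  The function [u = (h o f) B1(., z)]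
   satisfies [|u|^2 <= C G B1(z, z)] in [A^2(Om1)], [u z = 0] and
   [du_z X = G B1(z, z)]; testing the functional [d(.)_z X] on it gives
   [G^2 B1(z, z)^2 <= g_B1(X, X) B1(z, z) C G B1(z, z)]. *)

(** The hypothesis is silent at pairs where [P2] vanishes, while the test function has [B2(., w)] in
    its denominator: this is why connectedness and a Gronwall argument enter. The factor [B1(., z)]
    keeps the constant equal to [C]: it maximises the ratio of [|value at z|^2] to the squared norm.
    The kernel is a series over a basis obtained by choice, so a basis must be constructed, and the
    series must be differentiated twice. Duality replaces termwise differentiation: a bound
    [|L f| <= K |f|] valid for all [f] in [A^2] is, by Bessel's inequality, an l2 bound for the
    values of [L] on the basis. Evaluation, differential and Taylor remainder are such functionals,
    so [E] and [D] are curves in l2 with quadratic remainders, and the formulas for the metric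
    become algebra with scalar products. The bounds, uniform in [f], come from Cauchy's formula on
    rectangles; their coarse constants do not reach the conclusion. Dimensions are written [n.+1]
    because a basis indexed by [nat] forces [A^2] to be infinite-dimensional. *)

Section complex_norm.
Context {R : realType}.
Local Open Scope complex_scope.
Implicit Types (x y z : R[i]) (r : R).
Local Notation normc := (@Normc.normc R).

Lemma normcE_def z : `|z| = (normc z)%:C.
Proof. by case: z. Qed.

Lemma normc_ge0 z : 0 <= normc z.
Proof. by case: z => a b; exact: sqrtr_ge0. Qed.

Lemma normcD x y : normc (x + y) <= normc x + normc y.
Proof. exact: le_normcD. Qed.

Lemma normcM x y : normc (x * y) = normc x * normc y.
Proof. exact: Normc.normcM. Qed.

Lemma normcX x n : normc (x ^+ n) = normc x ^+ n.
Proof.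
elim: n => [|n IH]; first by rewrite !expr0 Normc.normc1.
by rewrite !exprS normcM IH.
Qed.

Lemma normc_opp x : normc (- x) = normc x.
Proof. exact: normcN. Qed.

Lemma normcBC x y : normc (x - y) = normc (y - x).
Proof. by rewrite -normc_opp opprB. Qed.

Lemma normcB x y : normc (x - y) <= normc x + normc y.
Proof. by rewrite -(normc_opp y) normcD. Qed.

Lemma normc_trians x y z : normc (x - z) <= normc (x - y) + normc (y - z).
Proof. by have := normcD (x - y) (y - z); rewrite addrA subrK. Qed.

Lemma normc_lower x y : normc x - normc y <= normc (x - y).
Proof. by rewrite lerBlDr; have := normcD (x - y) y; rewrite subrK. Qed.

Lemma normc0 : normc 0 = 0.
Proof. exact: Normc.normc0. Qed.

Lemma normc1 : normc 1 = 1.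
Proof. exact: Normc.normc1. Qed.

Lemma normc_eq0 x : (normc x == 0) = (x == 0).
Proof. by apply/eqP/eqP => [/Normc.eq0_normc //|->]; rewrite normc0. Qed.

Lemma normc_gt0 x : (0 < normc x) = (x != 0).
Proof. by rewrite lt_neqAle normc_ge0 andbT eq_sym normc_eq0. Qed.

Lemma normcV x : normc x^-1 = (normc x)^-1.
Proof. exact: Normc.normcV. Qed.

Lemma normcR r : normc r%:C = `|r|.
Proof. by rewrite /Normc.normc /= expr0n addr0 sqrtr_sqr. Qed.

Lemma normci : normc 'i = 1.
Proof. by rewrite /Normc.normc expr0n add0r expr1n sqrtr1. Qed.

Lemma normcJ x : normc x^* = normc x.
Proof. by case: x => a b; rewrite /= sqrrN. Qed.

Lemma sqr_normcE x : normc x ^+ 2 = complex.Re x ^+ 2 + complex.Im x ^+ 2.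
Proof. by case: x => a b /=; rewrite sqr_sqrtr ?addr_ge0 ?sqr_ge0. Qed.

Lemma mulcJ x : x * x^* = (normc x ^+ 2)%:C.
Proof.
rewrite sqr_normcE; case: x => a b; apply/eqP; rewrite eq_complex /=.
by apply/andP; split; apply/eqP; ring.
Qed.

Lemma normc_Re x : `|complex.Re x| <= normc x.
Proof.
rewrite -(ler_pXn2r (ltn0Sn 1)) ?nnegrE ?normc_ge0// sqr_normcE.
by rewrite real_normK ?num_real// lerDl sqr_ge0.
Qed.

Lemma normc_Im x : `|complex.Im x| <= normc x.
Proof.
rewrite -(ler_pXn2r (ltn0Sn 1)) ?nnegrE ?normc_ge0// sqr_normcE.
by rewrite real_normK ?num_real// lerDr sqr_ge0.
Qed.

Lemma normc_leReIm x : normc x <= `|complex.Re x| + `|complex.Im x|.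
Proof.
rewrite -(ler_pXn2r (ltn0Sn 1)) ?nnegrE ?normc_ge0// ?addr_ge0// sqr_normcE.
rewrite sqrrD !real_normK ?num_real// -addrA lerD2l lerDr.
by rewrite mulrn_wge0// mulr_ge0.
Qed.

Lemma normc_sum (I : Type) (s : seq I) (F : I -> R[i]) :
  normc (\sum_(i <- s) F i) <= \sum_(i <- s) normc (F i).
Proof.
elim: s => [|a s IH]; first by rewrite !big_nil normc0.
by rewrite !big_cons (le_trans (normcD _ _))// lerD2l.
Qed.

Lemma ReD x y : complex.Re (x + y) = complex.Re x + complex.Re y.
Proof. by case: x => ? ?; case: y. Qed.
Lemma ImD x y : complex.Im (x + y) = complex.Im x + complex.Im y.
Proof. by case: x => ? ?; case: y. Qed.
Lemma ReN x : complex.Re (- x) = - complex.Re x. Proof. by case: x. Qed.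
Lemma ImN x : complex.Im (- x) = - complex.Im x. Proof. by case: x. Qed.
Lemma ReM x y : complex.Re (x * y) =
  complex.Re x * complex.Re y - complex.Im x * complex.Im y.
Proof. by case: x => ? ?; case: y. Qed.
Lemma ImM x y : complex.Im (x * y) =
  complex.Re x * complex.Im y + complex.Im x * complex.Re y.
Proof. by case: x => ? ?; case: y. Qed.

Definition rcE := (ReD, ImD, ReN, ImN, ReM, ImM).

Lemma complex_ext x y :
  complex.Re x = complex.Re y -> complex.Im x = complex.Im y -> x = y.
Proof. by case: x => ? ?; case: y => ? ? /= -> ->. Qed.

End complex_norm.

(** * One complex variable *)

Section interval_integral.
Context {R : realType}.
Local Open Scope complex_scope.
Local Notation normc := (@Normc.normc R).
Local Notation leb := (@lebesgue_measure R).
Implicit Types (a b : R) (phi psi : R -> R[i]).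

Definition cint a b phi : R[i] :=
  (\int[leb]_(t in `[a, b]) complex.Re (phi t)) +i*
  (\int[leb]_(t in `[a, b]) complex.Im (phi t)).

(** The point [s] ranges over the whole line, not only over the segment. Restrictions of functions
    continuous at each point of a side satisfy this, and it is stronger than subspace continuity. *)
Definition ccont_on a b phi := forall t, a <= t <= b -> forall e, 0 < e ->
  exists2 d, 0 < d & forall s, `|s - t| < d -> normc (phi s - phi t) < e.

Lemma cont_integrable a b (f : R -> R) :
  (forall t, a <= t <= b -> forall e, 0 < e ->
     exists2 d, 0 < d & forall s, `|s - t| < d -> `|f s - f t| < e) ->
  leb.-integrable `[a, b] (EFin \o f).
Proof.
move=> h; apply: continuous_compact_integrable; first exact: segment_compact.
apply: continuous_in_subspaceT => t; rewrite inE/= in_itv/= => /h{}h.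
apply/cvgrPdist_lt => e /h[d d0 hd].
near=> s; rewrite distrC; apply: hd; near: s.
by exists d => //= s /=; rewrite distrC.
Unshelve. all: by end_near. Qed.

Lemma ccont_Re a b phi : ccont_on a b phi ->
  leb.-integrable `[a, b] (EFin \o (fun t => complex.Re (phi t))).
Proof.
move=> h; apply: cont_integrable => t /h{}h e /h[d d0 hd]; exists d => // s /hd.
by apply: le_lt_trans; rewrite -ReN -ReD normc_Re.
Qed.

Lemma ccont_Im a b phi : ccont_on a b phi ->
  leb.-integrable `[a, b] (EFin \o (fun t => complex.Im (phi t))).
Proof.
move=> h; apply: cont_integrable => t /h{}h e /h[d d0 hd]; exists d => // s /hd.
by apply: le_lt_trans; rewrite -ImN -ImD normc_Im.
Qed.

Lemma ccont_normc a b phi : ccont_on a b phi ->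
  leb.-integrable `[a, b] (EFin \o (fun t => normc (phi t))).
Proof.
move=> h; apply: cont_integrable => t /h{}h e /h[d d0 hd]; exists d => // s /hd.
apply: le_lt_trans; have := normc_lower (phi s) (phi t).
have := normc_lower (phi t) (phi s); rewrite (normcBC (phi t)) => h1 h2.
by rewrite ler_norml; lra.
Qed.

Lemma ccont_onD a b phi psi : ccont_on a b phi -> ccont_on a b psi ->
  ccont_on a b (fun t => phi t + psi t).
Proof.
move=> h k t tab e e0; have [d d0 hd] := h t tab (e / 2) ltac:(lra).
have [d' d'0 hd'] := k t tab (e / 2) ltac:(lra).
exists (Num.min d d') => [|s]; first by rewrite lt_min d0.
rewrite lt_min => /andP[/hd h1 /hd' h2].
have := normcD (phi s - phi t) (psi s - psi t).
rewrite (_ : _ + _ = phi s + psi s - (phi t + psi t)); last by ring.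
by move/le_lt_trans; apply; lra.
Qed.

Lemma ccont_onZ a b c phi : ccont_on a b phi -> ccont_on a b (fun t => c * phi t).
Proof.
move=> h t tab e e0.
have c0 : 0 < normc c + 1 by have := normc_ge0 c; lra.
have [d d0 hd] := h t tab (e / (normc c + 1)) (divr_gt0 e0 c0).
exists d => // s /hd; rewrite ltr_pdivlMr// => h1.
rewrite -mulrBr normcM; apply: le_lt_trans h1; rewrite mulrC ler_wpM2l ?normc_ge0//.
by rewrite lerDl.
Qed.

Lemma ccont_onB a b phi psi : ccont_on a b phi -> ccont_on a b psi ->
  ccont_on a b (fun t => phi t - psi t).
Proof.
move=> h k; have := ccont_onD h (ccont_onZ (-1) k).
by under [X in ccont_on _ _ X]eq_fun do rewrite mulN1r.
Qed.

Lemma eq_cint a b phi psi : (forall t, a <= t <= b -> phi t = psi t) ->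
  cint a b phi = cint a b psi.
Proof.
move=> h; apply: complex_ext; apply: eq_Rintegral => t;
  by rewrite inE/= in_itv/= => /h ->.
Qed.

Lemma cintD a b phi psi : ccont_on a b phi -> ccont_on a b psi ->
  cint a b (fun t => phi t + psi t) = cint a b phi + cint a b psi.
Proof.
move=> h k; apply: complex_ext; rewrite rcE /cint /= -RintegralD//; 
  do ?[exact: ccont_Re|exact: ccont_Im];
  by apply: eq_Rintegral => t _; rewrite rcE.
Qed.

Lemma cintZ a b c phi : ccont_on a b phi ->
  cint a b (fun t => c * phi t) = c * cint a b phi.
Proof.
move=> h; have hR := ccont_Re h; have hI := ccont_Im h.
have zR r : leb.-integrable `[a, b] (EFin \o (fun t => r * complex.Re (phi t))).
  exact: (integrableZl _ r hR).
have zI r : leb.-integrable `[a, b] (EFin \o (fun t => r * complex.Im (phi t))).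
  exact: (integrableZl _ r hI).
apply: complex_ext; rewrite rcE /cint /= -!RintegralZl//.
- by rewrite -RintegralB//; apply: eq_Rintegral => t _; rewrite rcE.
- by rewrite -RintegralD//; apply: eq_Rintegral => t _; rewrite rcE.
Qed.

Lemma cintB a b phi psi : ccont_on a b phi -> ccont_on a b psi ->
  cint a b (fun t => phi t - psi t) = cint a b phi - cint a b psi.
Proof.
move=> h k; rewrite -mulN1r -cintZ// -cintD//; last exact: ccont_onZ.
by apply: eq_cint => t _; rewrite mulN1r.
Qed.

Lemma leb_itv a b : a <= b -> fine (leb `[a, b]) = b - a.
Proof.
move=> ab; rewrite lebesgue_measure_itv/= lte_fin; case: ltP => //= ba.
by apply/esym/eqP; rewrite subr_eq0 eq_le ba.
Qed.

Lemma cint_cst a b c : a <= b -> cint a b (fun=> c) = (b - a)%:C * c.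
Proof.
move=> ab; apply: complex_ext; rewrite /cint /= Rintegral_cst// leb_itv//;
  by rewrite rcE /=; ring.
Qed.

Lemma Rint_split a m b (f : R -> R) : a <= m <= b ->
  leb.-integrable `[a, b] (EFin \o f) ->
  \int[leb]_(t in `[a, b]) f t =
  \int[leb]_(t in `[a, m]) f t + \int[leb]_(t in `[m, b]) f t.
Proof.
move=> /andP[am mb] intf.
have := @Rintegral_itvB R f (BLeft a) (BRight b) m intf.
rewrite !bnd_simp => /(_ am mb) /eqP; rewrite subr_eq addrC => /eqP ->.
rewrite Rintegral_itv_obnd_cbnd//; apply: integrableS intf => //.
by apply: subset_itv; rewrite bnd_simp.
Qed.

Lemma cint_split m a b phi : a <= m <= b -> ccont_on a b phi ->
  cint a b phi = cint a m phi + cint m b phi.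
Proof.
move=> amb h; apply: complex_ext; rewrite rcE /cint /= -Rint_split//;
  [exact: ccont_Re|exact: ccont_Im].
Qed.

(** Real and imaginary parts are bounded separately, whence the factor 2, which is inherited by the
    later constants 4, 32 and 128. *)
Lemma normc_cint a b phi : ccont_on a b phi ->
  normc (cint a b phi) <= 2 * \int[leb]_(t in `[a, b]) normc (phi t).
Proof.
move=> h; apply: le_trans (normc_leReIm _) _; rewrite mulr_natl mulr2n /cint /=.
have hn := ccont_normc h.
by apply: lerD; (apply: le_trans (le_normr_Rintegral _ _) _ => //;
  [by [exact: ccont_Re|exact: ccont_Im]|]; apply: le_Rintegral => //;
  [by first [exact: (integrable_abse (ccont_Re h))|
             exact: (integrable_abse (ccont_Im h))]|
   move=> t _; first [exact: normc_Re|exact: normc_Im]]).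
Qed.

Lemma Rint_normc_le a b phi M : a <= b -> ccont_on a b phi ->
  (forall t, a <= t <= b -> normc (phi t) <= M) ->
  \int[leb]_(t in `[a, b]) normc (phi t) <= M * (b - a).
Proof.
move=> ab h k; rewrite -leb_itv// -Rintegral_cst//.
apply: le_Rintegral; [by []|exact: ccont_normc| |].
  apply: (@cont_integrable _ _ (fun=> M)) => t _ e e0; exists 1 => // s _.
  by rewrite subrr normr0.
by move=> t; rewrite /= in_itv/= => /k.
Qed.

End interval_integral.
Arguments cint : simpl never.

(** * Complex derivatives in one variable *)

Section complex_derivative.
Context {R : realType}.
Local Open Scope complex_scope.
Local Notation normc := (@Normc.normc R).
Implicit Types (F G : R[i] -> R[i]) (z w d : R[i]).

Definition ccont F z := forall e, 0 < e ->
  exists2 r, 0 < r & forall w, normc (w - z) < r -> normc (F w - F z) < e.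

Definition cder F z d := forall e, 0 < e ->
  exists2 r, 0 < r & forall w, normc (w - z) < r ->
    normc (F w - F z - d * (w - z)) <= e * normc (w - z).

Definition cdiff F z := exists d, cder F z d.

Lemma ccont_cst c z : ccont (fun=> c) z.
Proof. by move=> e e0; exists 1 => // w _; rewrite subrr normc0. Qed.

Lemma ccont_id z : ccont id z.
Proof. by move=> e e0; exists e. Qed.

Lemma ccont_near F G z : (exists2 r, 0 < r & forall w, normc (w - z) < r -> F w = G w) ->
  ccont F z -> ccont G z.
Proof.
move=> [r r0 FG] h e /h[s s0 hs]; exists (Num.min r s) => [|w].
  by rewrite lt_min r0.
rewrite lt_min => /andP[/FG <- /hs].
by rewrite -FG// subrr normc0.
Qed.

Lemma ccontD F G z : ccont F z -> ccont G z -> ccont (fun w => F w + G w) z.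
Proof.
move=> h k e e0; have [d d0 hd] := h (e / 2) ltac:(lra).
have [d' d'0 hd'] := k (e / 2) ltac:(lra).
exists (Num.min d d') => [|s]; first by rewrite lt_min d0.
rewrite lt_min => /andP[/hd h1 /hd' h2].
have := normcD (F s - F z) (G s - G z).
rewrite (_ : _ + _ = F s + G s - (F z + G z)); last by ring.
by move/le_lt_trans; apply; lra.
Qed.

Lemma ccontM F G z : ccont F z -> ccont G z -> ccont (fun w => F w * G w) z.
Proof.
move=> h k e e0.
have F0 := normc_ge0 (F z); have G0 := normc_ge0 (G z).
have [d d0 hd] := h (e / (2 * (normc (G z) + 1))) ltac:(apply: divr_gt0; lra).
have [d' d'0 hd'] := k (e / (2 * (normc (F z) + 1))) ltac:(apply: divr_gt0; lra).
have [d2 d20 hd2] := k 1 ltac:(lra).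
exists (Num.min d (Num.min d' d2)) => [|s]; first by rewrite !lt_min d0 d'0.
rewrite !lt_min => /and3P[/hd h1 /hd' h2 /hd2 h3].
rewrite (_ : _ - _ = (F s - F z) * G s + F z * (G s - G z)); last by ring.
apply: le_lt_trans (normcD _ _) _; rewrite !normcM.
have h4 : normc (G s) <= normc (G z) + 1.
  by have := normc_lower (G s) (G z); lra.
have h5 : normc (F s - F z) * normc (G s) <= normc (F s - F z) * (normc (G z) + 1).
  by rewrite ler_wpM2l ?normc_ge0.
have h6 : normc (F s - F z) * (normc (G z) + 1) < e / 2.
  rewrite -ltr_pdivlMr; last by lra.
  by apply: lt_le_trans h1 _; rewrite invfM mulrA.
have h7 : normc (F z) * normc (G s - G z) <= (normc (F z) + 1) * normc (G s - G z).
  by rewrite ler_wpM2r ?normc_ge0//; lra.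
have h8 : (normc (F z) + 1) * normc (G s - G z) < e / 2.
  rewrite mulrC -ltr_pdivlMr; last by lra.
  by apply: lt_le_trans h2 _; rewrite invfM mulrA.
by lra.
Qed.

Lemma ccontV F z : F z != 0 -> ccont F z -> ccont (fun w => (F w)^-1) z.
Proof.
rewrite -normc_gt0 => F0 h e e0.
have [d d0 hd] := h (normc (F z) / 2) ltac:(lra).
have [d' d'0 hd'] := h (e * (normc (F z) ^+ 2 / 2))
  ltac:(by rewrite mulr_gt0// divr_gt0// exprn_gt0).
exists (Num.min d d') => [|s]; first by rewrite lt_min d0.
rewrite lt_min => /andP[/hd h1 /hd' h2].
have h3 : normc (F z) / 2 < normc (F s).
  by have := normc_lower (F z) (F s); rewrite normcBC; lra.
have Fs0 : 0 < normc (F s) by lra.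
rewrite (_ : _ - _ = (F z - F s) / (F s * F z)); last first.
  by field; rewrite -!normc_gt0 Fs0 F0.
rewrite normcM normcV normcM normcBC ltr_pdivrMr ?mulr_gt0//.
apply: lt_le_trans h2 _; rewrite ler_pM2l// expr2 -mulrA [X in _ * X]mulrC mulrA.
by rewrite ler_pM2r// ltW.
Qed.

(** Carathéodory's form of the derivative: [phi] is the difference quotient, continued by [d] at
    [z]. The sum, product and inverse rules then reduce to the continuity of an explicit [phi]. *)
Lemma cderP F z d : cder F z d <->
  exists phi, [/\ ccont phi z, phi z = d & forall w, F w - F z = phi w * (w - z)].
Proof.
split=> [h|[phi [cphi <- hphi]]].
  exists (fun w => if w == z then d else (F w - F z) / (w - z)); split.
  - move=> e e0; have [r r0 hr] := h (e / 2) ltac:(lra).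
    exists r => // w wr; rewrite eqxx; case: eqVneq => [_|wz].
      by rewrite subrr normc0.
    have wz0 : w - z != 0 by rewrite subr_eq0.
    rewrite (_ : _ - d = (F w - F z - d * (w - z)) / (w - z)); last by field.
    rewrite normcM normcV; have nwz : 0 < normc (w - z) by rewrite normc_gt0.
    rewrite ltr_pdivrMr//; apply: le_lt_trans (hr _ wr) _.
    by rewrite ltr_pM2r//; lra.
  - by rewrite eqxx.
  - move=> w; case: eqVneq => [->|wz]; first by rewrite !subrr mulr0.
    by rewrite mulfVK// subr_eq0.
move=> e /cphi[r r0 hr]; exists r => // w /hr h.
by rewrite hphi -mulrBl normcM ler_wpM2r ?normc_ge0// ltW.
Qed.

Lemma cder_ccont F z d : cder F z d -> ccont F z.
Proof.
move=> /cderP[phi [cphi _ h]].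
apply: (@ccont_near (fun w => phi w * (w - z) + F z)).
  by exists 1 => // w _; rewrite -h subrK.
apply: ccontD; last exact: ccont_cst.
by apply: ccontM => //; apply: ccontD; [exact: ccont_id|exact: ccont_cst].
Qed.

Lemma cdiff_ccont F z : cdiff F z -> ccont F z.
Proof. by move=> [d /cder_ccont]. Qed.

Lemma cder_uniq F z d d' : cder F z d -> cder F z d' -> d = d'.
Proof.
move=> h h'; apply/eqP; rewrite -subr_eq0 -normc_eq0 eq_le normc_ge0 andbT.
apply/ler_addgt0Pl => e e0; rewrite addr0.
have [r r0 hr] := h (e / 2) ltac:(lra); have [s s0 hs] := h' (e / 2) ltac:(lra).
pose t := Num.min r s / 2.
have t0 : 0 < t by rewrite divr_gt0// lt_min r0.
have tr : t < Num.min r s by rewrite ltr_pdivrMr// ltr_pMr ?lt_min ?r0 ?ltr1n.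
have nt : normc (z + t%:C - z) = t by rewrite addrC addKr normcR gtr0_norm.
move: tr; rewrite lt_min -{1 2}nt => /andP[/hr h1 /hs h2].
have := normcB (F (z + t%:C) - F z - d' * (z + t%:C - z))
  (F (z + t%:C) - F z - d * (z + t%:C - z)).
rewrite (_ : _ - _ = (d - d') * (z + t%:C - z)); last by ring.
rewrite normcM nt in h1 h2 * => h3.
by rewrite -(ler_pM2r t0); lra.
Qed.

Lemma cder_cst c z : cder (fun=> c) z 0.
Proof.
by move=> e e0; exists 1 => // w _; rewrite subrr mul0r subrr normc0 mulr_ge0 ?normc_ge0 ?ltW.
Qed.

Lemma cder_id z : cder id z 1.
Proof.
by move=> e e0; exists 1 => // w _; rewrite mul1r subrr normc0 mulr_ge0 ?normc_ge0 ?ltW.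
Qed.

Lemma cder_near F G z d : (exists2 r, 0 < r & forall w, normc (w - z) < r -> F w = G w) ->
  cder F z d -> cder G z d.
Proof.
move=> [r r0 FG] h e /h[s s0 hs]; exists (Num.min r s) => [|w].
  by rewrite lt_min r0.
rewrite lt_min => /andP[/FG <- /hs].
by rewrite -FG// subrr normc0.
Qed.

Lemma cderD F G z d d' : cder F z d -> cder G z d' ->
  cder (fun w => F w + G w) z (d + d').
Proof.
move=> /cderP[p [cp <- hp]] /cderP[q [cq <- hq]]; apply/cderP.
exists (fun w => p w + q w); split => //; first exact: ccontD.
by move=> w; rewrite mulrDl -hp -hq; ring.
Qed.

Lemma cderM F G z d d' : cder F z d -> cder G z d' ->
  cder (fun w => F w * G w) z (d * G z + F z * d').
Proof.
move=> h h'; have cG := cder_ccont h'.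
move: h h' => /cderP[p [cp <- hp]] /cderP[q [cq <- hq]]; apply/cderP.
exists (fun w => p w * G w + F z * q w); split => //.
  by apply: ccontD; apply: ccontM => //; exact: ccont_cst.
move=> w; rewrite mulrDl mulrAC -hp -mulrA -hq; ring.
Qed.

Lemma cderV F z d : F z != 0 -> cder F z d ->
  cder (fun w => (F w)^-1) z (- d / F z ^+ 2).
Proof.
move=> F0 h; have cF := cder_ccont h.
move: h => /cderP[p [cp <- hp]]; apply/cderP.
(* At zeros of [F] the inverse is 0 by convention and the raw quotient is kept; since [F z] is
   nonzero, such points stay away from [z] and do not affect continuity there. *)
exists (fun w => if F w == 0 then ((F w)^-1 - (F z)^-1) / (w - z)
                 else - p w / (F w * F z)); split.
- have F0' : 0 < normc (F z) by rewrite normc_gt0.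
  have [r r0 hr] := cF _ F0'.
  apply: (@ccont_near (fun w => - p w * (F w * F z)^-1)).
    exists r => // w /hr h1; case: eqP => // Fw0.
    by move: h1; rewrite Fw0 sub0r normc_opp ltxx.
  apply: ccontM.
    apply: (@ccont_near (fun w => -1 * p w)); first by exists 1 => // w _; rewrite mulN1r.
    by apply: ccontM => //; exact: ccont_cst.
  apply: ccontV; first by rewrite mulf_neq0.
  by apply: ccontM => //; exact: ccont_cst.
- by rewrite (negPf F0) expr2.
- move=> w; case: eqVneq => [Fw0|Fw0].
    have wz : w - z != 0.
      by apply: contraNneq F0 => wz; move: (hp w); rewrite wz mulr0 Fw0 sub0r => /eqP; rewrite oppr_eq0.
    by rewrite mulfVK.
  rewrite mulrAC mulNr -hp; field.
  by rewrite F0 Fw0.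
Qed.

Lemma cdiff_cst c z : cdiff (fun=> c) z. Proof. by exists 0; exact: cder_cst. Qed.
Lemma cdiff_id z : cdiff id z. Proof. by exists 1; exact: cder_id. Qed.
Lemma cdiffD F G z : cdiff F z -> cdiff G z -> cdiff (fun w => F w + G w) z.
Proof. by move=> [d h] [e k]; exists (d + e); exact: cderD. Qed.
Lemma cdiffM F G z : cdiff F z -> cdiff G z -> cdiff (fun w => F w * G w) z.
Proof. by move=> [d h] [e k]; eexists; exact: (cderM h k). Qed.
Lemma cdiffV F z : F z != 0 -> cdiff F z -> cdiff (fun w => (F w)^-1) z.
Proof. by move=> F0 [d h]; eexists; exact: (cderV F0 h). Qed.
Lemma cdiffB F G z : cdiff F z -> cdiff G z -> cdiff (fun w => F w - G w) z.
Proof.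
move=> h k; have [d hd] := cdiffD h (cdiffM (cdiff_cst (-1) z) k).
by exists d; apply: cder_near hd; exists 1 => // w _; rewrite mulN1r.
Qed.
Lemma cdiff_subc c z : cdiff (fun w => w - c) z.
Proof. exact: cdiffB (cdiff_id z) (cdiff_cst c z). Qed.

End complex_derivative.

(** * Boundary integrals over rectangles and Goursat's theorem *)

Section rectangles.
Context {R : realType}.
Local Open Scope complex_scope.
Local Notation normc := (@Normc.normc R).
Implicit Types (F G : R[i] -> R[i]) (z w d : R[i]) (x y : R).

Definition in_rect x0 x1 y0 y1 z :=
  (x0 <= complex.Re z <= x1) /\ (y0 <= complex.Im z <= y1).

Definition on_bd x0 x1 y0 y1 z := in_rect x0 x1 y0 y1 z /\
  [\/ complex.Re z = x0, complex.Re z = x1, complex.Im z = y0 | complex.Im z = y1].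

(** The counterclockwise integral of [F dz] along the boundary, with opposite sides paired; on the
    vertical sides [dz] is ['i dt]. *)
Definition rint x0 x1 y0 y1 F : R[i] :=
  cint x0 x1 (fun t => F (t +i* y0) - F (t +i* y1)) +
  'i * cint y0 y1 (fun t => F (x1 +i* t) - F (x0 +i* t)).

Lemma ccont_hline F a b y : (forall t, a <= t <= b -> ccont F (t +i* y)) ->
  ccont_on a b (fun t => F (t +i* y)).
Proof.
move=> h t /h{}h e /h[r r0 hr]; exists r => // s hs; apply: hr.
by rewrite /= subrr expr0n addr0 sqrtr_sqr.
Qed.

Lemma ccont_vline F a b x : (forall t, a <= t <= b -> ccont F (x +i* t)) ->
  ccont_on a b (fun t => F (x +i* t)).
Proof.
move=> h t /h{}h e /h[r r0 hr]; exists r => // s hs; apply: hr.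
by rewrite /= subrr expr0n add0r sqrtr_sqr.
Qed.

Arguments rint : simpl never.

Section rint.
Variables (x0 x1 y0 y1 : R).
Hypotheses (x01 : x0 <= x1) (y01 : y0 <= y1).

Definition bcont F := forall z, on_bd x0 x1 y0 y1 z -> ccont F z.

Lemma bcont_sides F : bcont F ->
  [/\ ccont_on x0 x1 (fun t => F (t +i* y0)), ccont_on x0 x1 (fun t => F (t +i* y1)),
      ccont_on y0 y1 (fun t => F (x0 +i* t)) & ccont_on y0 y1 (fun t => F (x1 +i* t))].
Proof.
move=> h; split;
  [apply: ccont_hline|apply: ccont_hline|apply: ccont_vline|apply: ccont_vline];
  move=> t tab; apply: h;
  (split; first by split; rewrite /= ?lexx ?tab ?x01 ?y01);
  [constructor 3|constructor 4|constructor 1|constructor 2]; by [].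
Qed.

Lemma rintD F G : bcont F -> bcont G ->
  rint x0 x1 y0 y1 (fun z => F z + G z) = rint x0 x1 y0 y1 F + rint x0 x1 y0 y1 G.
Proof.
move=> /bcont_sides[a b c d] /bcont_sides[a' b' c' d']; rewrite /rint.
rewrite (@eq_cint _ _ _ _ (fun t => (F (t +i* y0) - F (t +i* y1)) + (G (t +i* y0) - G (t +i* y1))));
  last by move=> t _ /=; ring.
rewrite cintD; [|exact: ccont_onB..].
rewrite (@eq_cint _ y0 y1 _ (fun t => (F (x1 +i* t) - F (x0 +i* t)) + (G (x1 +i* t) - G (x0 +i* t))));
  last by move=> t _ /=; ring.
rewrite (@cintD _ y0 y1); [|exact: ccont_onB..].
by ring.
Qed.

Lemma rintZ c F : bcont F ->
  rint x0 x1 y0 y1 (fun z => c * F z) = c * rint x0 x1 y0 y1 F.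
Proof.
move=> /bcont_sides[a b c' d]; rewrite /rint.
rewrite (@eq_cint _ _ _ _ (fun t => c * (F (t +i* y0) - F (t +i* y1))));
  last by move=> t _ /=; rewrite mulrBr.
rewrite cintZ; last exact: ccont_onB.
rewrite (@eq_cint _ y0 y1 _ (fun t => c * (F (x1 +i* t) - F (x0 +i* t))));
  last by move=> t _ /=; rewrite mulrBr.
rewrite cintZ; last exact: ccont_onB.
by ring.
Qed.

Lemma bcontZ c F : bcont F -> bcont (fun z => c * F z).
Proof. by move=> h z /h; apply: ccontM; exact: ccont_cst. Qed.

Lemma eq_rint F G : (forall z, on_bd x0 x1 y0 y1 z -> F z = G z) ->
  rint x0 x1 y0 y1 F = rint x0 x1 y0 y1 G.
Proof.
move=> h; rewrite /rint; congr (_ + _ * _); apply: eq_cint => t tab; rewrite !h//;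
  split; do ?split => /=; rewrite ?lexx ?tab ?x01 ?y01 //;
  by [constructor 1|constructor 2|constructor 3|constructor 4].
Qed.

Lemma rintB F G : bcont F -> bcont G ->
  rint x0 x1 y0 y1 (fun z => F z - G z) = rint x0 x1 y0 y1 F - rint x0 x1 y0 y1 G.
Proof.
move=> h k; rewrite -mulN1r -rintZ// -rintD//; last exact: bcontZ.
by apply: eq_rint => z _; rewrite mulN1r.
Qed.

(** An affine function has a constant difference between opposite sides, so the two integrals are
    explicit and opposite. In Goursat's argument this removes the first-order part of [F]. *)
Lemma rint_affine a b : rint x0 x1 y0 y1 (fun z => a + b * z) = 0.
Proof.
rewrite /rint (@eq_cint _ _ _ _ (fun=> b * 'i * (y0 - y1)%:C)); last first.
  move=> t _; apply: complex_ext; rewrite !rcE /=; ring.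
rewrite (@eq_cint _ y0 _ _ (fun=> b * (x1 - x0)%:C)); last first.
  move=> t _; apply: complex_ext; rewrite !rcE /=; ring.
rewrite !cint_cst// !rmorphB /=; ring.
Qed.

Lemma rint_norm F : bcont F -> normc (rint x0 x1 y0 y1 F) <=
  2 * (\int[lebesgue_measure]_(t in `[x0, x1]) normc (F (t +i* y0)) +
       \int[lebesgue_measure]_(t in `[x0, x1]) normc (F (t +i* y1)) +
       \int[lebesgue_measure]_(t in `[y0, y1]) normc (F (x0 +i* t)) +
       \int[lebesgue_measure]_(t in `[y0, y1]) normc (F (x1 +i* t))).
Proof.
move=> /bcont_sides[a b c d]; rewrite /rint !cintB//.
apply: le_trans (normcD _ _) _; rewrite normcM normci mul1r.
have := normc_cint a; have := normc_cint b; have := normc_cint c; have := normc_cint d.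
have := normcB (cint x0 x1 (fun t => F (t +i* y0))) (cint x0 x1 (fun t => F (t +i* y1))).
have := normcB (cint y0 y1 (fun t => F (x1 +i* t))) (cint y0 y1 (fun t => F (x0 +i* t))).
by lra.
Qed.

Lemma rint_norm_le F M : bcont F -> (forall z, on_bd x0 x1 y0 y1 z -> normc (F z) <= M) ->
  normc (rint x0 x1 y0 y1 F) <= 4 * M * ((x1 - x0) + (y1 - y0)).
Proof.
move=> bF hM; apply: le_trans (rint_norm bF) _.
have [a b c d] := bcont_sides bF.
have k t y : x0 <= t <= x1 -> y = y0 \/ y = y1 -> normc (F (t +i* y)) <= M.
  move=> tx yy; apply: hM; split; last by case: yy => /= ->; [constructor 3|constructor 4].
  by split=> //=; case: yy => ->; rewrite lexx y01.
have k' t x : y0 <= t <= y1 -> x = x0 \/ x = x1 -> normc (F (x +i* t)) <= M.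
  move=> tx xx; apply: hM; split; last by case: xx => /= ->; [constructor 1|constructor 2].
  by split=> //=; case: xx => ->; rewrite lexx x01.
have := Rint_normc_le x01 a (fun t h => k t y0 h (or_introl erefl)).
have := Rint_normc_le x01 b (fun t h => k t y1 h (or_intror erefl)).
have := Rint_normc_le y01 c (fun t h => k' t x0 h (or_introl erefl)).
have := Rint_normc_le y01 d (fun t h => k' t x1 h (or_intror erefl)).
by lra.
Qed.

End rint.

Definition rcont x0 x1 y0 y1 F := forall z, in_rect x0 x1 y0 y1 z -> ccont F z.

Lemma rcont_bcont x0 x1 y0 y1 F : rcont x0 x1 y0 y1 F -> bcont x0 x1 y0 y1 F.
Proof. by move=> h z [/h]. Qed.

Lemma rcontS x0 x1 y0 y1 x0' x1' y0' y1' F :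
  x0 <= x0' -> x1' <= x1 -> y0 <= y0' -> y1' <= y1 ->
  rcont x0 x1 y0 y1 F -> rcont x0' x1' y0' y1' F.
Proof. by move=> ? ? ? ? h z [? ?]; apply: h; split; lra. Qed.

Lemma rint_vsplit x x0 x1 y0 y1 F : x0 <= x <= x1 -> y0 <= y1 ->
  rcont x0 x1 y0 y1 F ->
  rint x0 x1 y0 y1 F = rint x0 x y0 y1 F + rint x x1 y0 y1 F.
Proof.
move=> /andP[h1 h2] y01 h.
have [a b c d] := bcont_sides (le_trans h1 h2) y01 (rcont_bcont h).
have [_ _ _ e] := bcont_sides h1 y01 (rcont_bcont (rcontS (lexx _) h2 (lexx _) (lexx _) h)).
rewrite /rint (@cint_split _ x); [|by rewrite h1|exact: ccont_onB].
by rewrite (cintB d c) (cintB e c) (cintB d e); ring.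
Qed.

Lemma rint_hsplit y x0 x1 y0 y1 F : x0 <= x1 -> y0 <= y <= y1 ->
  rcont x0 x1 y0 y1 F ->
  rint x0 x1 y0 y1 F = rint x0 x1 y0 y F + rint x0 x1 y y1 F.
Proof.
move=> x01 /andP[h1 h2] h.
have [a b c d] := bcont_sides x01 (le_trans h1 h2) (rcont_bcont h).
have [_ e _ _] := bcont_sides x01 h1 (rcont_bcont (rcontS (lexx _) (lexx _) (lexx _) h2 h)).
rewrite /rint (@cint_split _ y y0 y1); [|by rewrite h1|exact: ccont_onB].
by rewrite (cintB a b) (cintB a e) (cintB e b); ring.
Qed.

(* The nested-rectangle argument: among four quarters one carries at least a
   quarter of the integral. *)
Lemma goursat x0 x1 y0 y1 F : x0 <= x1 -> y0 <= y1 ->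
  (forall z, in_rect x0 x1 y0 y1 z -> cdiff F z) -> rint x0 x1 y0 y1 F = 0.
Proof.
move=> x01 y01 dF.
pose sub (q : R * R * R * R) := let: (a, b, c, d) := q in
  [/\ x0 <= a, a <= b, b <= x1, y0 <= c & c <= d /\ d <= y1].
pose J (q : R * R * R * R) := let: (a, b, c, d) := q in rint a b c d F.
pose half (q q' : R * R * R * R) := let: (a, b, c, d) := q in
  let: (a', b', c', d') := q' in
  [/\ a <= a', b' <= b, c <= c' & d' <= d] /\
  (b' - a' = (b - a) / 2 /\ d' - c' = (d - c) / 2).
have rc : rcont x0 x1 y0 y1 F by move=> z /dF /cdiff_ccont.
have [nx nxP] : {nx | forall q, sub q ->
    [/\ sub (nx q), half q (nx q) & normc (J q) <= 4 * normc (J (nx q))]}.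
  suff /choice[nx h] : forall q, exists q', sub q ->
    [/\ sub q', half q q' & normc (J q) <= 4 * normc (J q')].
    by exists nx.
  move=> [[[a b] c] d]; have [|] := pselect (sub (a, b, c, d)); last by move=> ?; exists (a,b,c,d).
  move=> [h1 h2 h3 h4 [h5 h6]].
  pose u := (a + b) / 2; pose v := (c + d) / 2.
  have rq := rcontS h1 h3 h4 h6 rc.
  have e : rint a b c d F = rint a u c v F + rint a u v d F + (rint u b c v F + rint u b v d F).
    rewrite (@rint_vsplit u a b c d)//; last by rewrite /u; lra.
    rewrite (@rint_hsplit v a u c d)//; [|by rewrite /u; lra|by rewrite /v; lra|
      by apply: rcontS rq => //; rewrite /u; lra].
    rewrite (@rint_hsplit v u b c d)//; [by rewrite /u; lra|by rewrite /v; lra|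
      by apply: rcontS rq => //; rewrite /u; lra].
  have n4 : normc (rint a b c d F) <= normc (rint a u c v F) + normc (rint a u v d F) +
      (normc (rint u b c v F) + normc (rint u b v d F)).
    rewrite e; apply: le_trans (normcD _ _) _; apply: lerD; exact: normcD.
  have u1 : a <= u by rewrite /u; clear -h2; lra.
  have u2 : u <= b by rewrite /u; clear -h2; lra.
  have v1 : c <= v by rewrite /v; clear -h5; lra.
  have v2 : v <= d by rewrite /v; clear -h5; lra.
  have u3 : u - a = (b - a) / 2 by rewrite /u; field.
  have u4 : b - u = (b - a) / 2 by rewrite /u; field.
  have v3 : v - c = (d - c) / 2 by rewrite /v; field.
  have v4 : d - v = (d - c) / 2 by rewrite /v; field.
  have u5 := le_trans h1 u1; have u6 := le_trans u2 h3.
  have v5 := le_trans h4 v1; have v6 := le_trans v2 h6.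
  clearbody u v; move: n4; rewrite /J.
  set t := normc (rint a b c d F).
  set t1 := normc (rint a u c v F); set t2 := normc (rint a u v d F).
  set t3 := normc (rint u b c v F); set t4 := normc (rint u b v d F) => n4.
  have [k|k] := leP t (4 * t1); first by exists (a, u, c, v) => _; do !split.
  have [k2|k2] := leP t (4 * t2); first by exists (a, u, v, d) => _; do !split.
  have [k3|k3] := leP t (4 * t3); first by exists (u, b, c, v) => _; do !split.
  exists (u, b, v, d) => _; split; [by do !split|by do !split|]; rewrite /J -/t -/t4.
  by clear -n4 k k2 k3; lra.
pose q k := iter k nx (x0, x1, y0, y1).
have sq k : sub (q k) by elim: k => [|k /nxP[]//]; rewrite /q /=; split.
pose A k := (q k).1.1.1; pose B k := (q k).1.1.2; pose C k := (q k).1.2; pose D k := (q k).2.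
have qE k : q k = (A k, B k, C k, D k) by rewrite /A /B /C /D; case: (q k) => [[[]]].
have step k : [/\ A k <= A k.+1, B k.+1 <= B k, C k <= C k.+1 & D k.+1 <= D k] /\
  (B k.+1 - A k.+1 = (B k - A k) / 2 /\ D k.+1 - C k.+1 = (D k - C k) / 2).
  by have [_] := nxP _ (sq k); rewrite -[nx (q k)]/(q k.+1) !qE.
have jk k : normc (J (q 0%N)) <= 4 ^+ k * normc (J (q k)).
  elim: k => [|k IH]; first by rewrite mul1r.
  have [_ _ h] := nxP _ (sq k); apply: le_trans IH _.
  by rewrite exprSr -mulrA ler_pM2l// exprn_gt0.
have sz k : B k - A k = (x1 - x0) / 2 ^+ k /\ D k - C k = (y1 - y0) / 2 ^+ k.
  elim: k => [|k [IH1 IH2]]; first by rewrite !divr1.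
  have [_ [-> ->]] := step k; rewrite IH1 IH2 exprSr invfM.
  by split; rewrite mulrA.
have AB k : A k <= B k by have := sq k; rewrite qE => -[].
have CD k : C k <= D k by have := sq k; rewrite qE => -[_ _ _ _ []].
have mA : {homo A : i j / (i <= j)%N >-> i <= j}.
  by apply: homo_leq => [|? ? ?|i]; [by []|exact: le_trans|have [[]] := step i].
have mC : {homo C : i j / (i <= j)%N >-> i <= j}.
  by apply: homo_leq => [|? ? ?|i]; [by []|exact: le_trans|have [[]] := step i].
have mB : {homo B : i j / (i <= j)%N >-> j <= i}.
  by apply: homo_leq => [|? ? ? h1 h2|i]; [by []|exact: le_trans h2 h1|have [[]] := step i].
have mD : {homo D : i j / (i <= j)%N >-> j <= i}.
  by apply: homo_leq => [|? ? ? h1 h2|i]; [by []|exact: le_trans h2 h1|have [[]] := step i].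
have ABij i j : A i <= B j.
  apply: le_trans (mA _ _ (leq_maxl i j)) _; apply: le_trans (AB _) _.
  exact/mB/leq_maxr.
have CDij i j : C i <= D j.
  apply: le_trans (mC _ _ (leq_maxl i j)) _; apply: le_trans (CD _) _.
  exact/mD/leq_maxr.
(* The nested rectangles shrink to the point [X +i* Y], where the derivative of [F] is used. *)
pose X := sup (range A); pose Y := sup (range C).
have Xin k : A k <= X <= B k.
  apply/andP; split.
    apply: ub_le_sup; last by exists k.
    by exists (B 0%N) => _ [i _ <-].
  by apply: ge_sup => [|_ [i _ <-]//]; exists (A 0%N), 0%N.
have Yin k : C k <= Y <= D k.
  apply/andP; split.
    apply: ub_le_sup; last by exists k.
    by exists (D 0%N) => _ [i _ <-].
  by apply: ge_sup => [|_ [i _ <-]//]; exists (C 0%N), 0%N.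
have [d hd] : cdiff F (X +i* Y) by apply: dF; split; [exact: (Xin 0%N)|exact: (Yin 0%N)].
apply/eqP; rewrite -normc_eq0 eq_le normc_ge0 andbT.
pose S := (x1 - x0) + (y1 - y0).
have S0 : 0 <= S by rewrite /S; lra.
apply/ler_addgt0Pl => e e0; rewrite addr0.
(* The integral over the [k]-th rectangle is at most [4 * e' * h ^+ 2] with [h = S / 2 ^+ k]; the
   factor [4 ^+ k] cancels the powers of 2 and leaves [4 * e' * S ^+ 2 <= e]. The summand 1 covers
   [S = 0]. *)
pose e' := e / (4 * (S ^+ 2 + 1)).
have S2 : 0 <= S ^+ 2 by exact: sqr_ge0.
have e'0 : 0 < e' by rewrite divr_gt0//; lra.
have [r r0 hr] := hd _ e'0.
have [k hk] : exists k, S / 2 ^+ k < r.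
  have [k hk] : exists k, S / r < k%:R.
    by exists (Num.truncn (S / r)).+1; rewrite truncnS_gt.
  exists k; rewrite ltr_pdivrMr ?exprn_gt0// mulrC -ltr_pdivrMr//.
  by apply: lt_trans hk _; rewrite -natrX ltr_nat ltn_expl.
have szk : (B k - A k) + (D k - C k) = S / 2 ^+ k by have [-> ->] := sz k; rewrite -mulrDl.
pose h := S / 2 ^+ k.
have h0 : 0 <= h by rewrite divr_ge0// exprn_ge0.
have [s1 s2 s3 s4 [s5 s6]] : sub (A k, B k, C k, D k) by rewrite -qE; exact: sq.
have rk : rcont (A k) (B k) (C k) (D k) F by apply: rcontS rc.
(* The first-order expansion of [F] at the limit point: subtracting it leaves the boundary integral
   unchanged and the integrand of size [e' * h]. *)
pose aff z := (F (X +i* Y) - d * (X +i* Y)) + d * z.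
have caff : forall z, ccont aff z.
  by move=> z; apply: ccontD; [exact: ccont_cst|apply: ccontM; [exact: ccont_cst|exact: ccont_id]].
have JE : J (q k) = rint (A k) (B k) (C k) (D k) (fun z => F z - aff z).
  by rewrite rintB// ?rint_affine ?subr0 ?qE//; exact: rcont_bcont.
have Jk : normc (J (q k)) <= 4 * (e' * h) * h.
  rewrite JE -[X in _ <= _ * X]szk; apply: rint_norm_le => //.
    move=> z [hz _]; apply: ccontD; first exact: rk.
    apply: (@ccont_near _ (fun z => -1 * aff z)).
      by exists 1 => // w _; rewrite mulN1r.
    by apply: ccontM => //; exact: ccont_cst.
  move=> z [[/andP[z1 z2] /andP[z3 z4]] _].
  have /andP[X1 X2] := Xin k; have /andP[Y1 Y2] := Yin k.
  have nz : normc (z - (X +i* Y)) <= h.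
    apply: le_trans (normc_leReIm _) _; rewrite /h -szk; apply: lerD; rewrite !rcE /= ler_norml; lra.
  have := hr _ (le_lt_trans nz hk).
  rewrite (_ : F z - _ - _ = F z - aff z); last by rewrite /aff; ring.
  by move/le_trans; apply; rewrite ler_pM2l.
have -> : rint x0 x1 y0 y1 F = J (q 0%N) by [].
apply: le_trans (jk k) _.
have : 4 ^+ k * normc (J (q k)) <= 4 ^+ k * (4 * (e' * h) * h).
  by rewrite ler_pM2l// exprn_gt0.
move/le_trans; apply.
have -> : 4 ^+ k * (4 * (e' * h) * h) = 4 * e' * S ^+ 2.
  rewrite /h (_ : 4 = 2 ^+ 2 :> R); last by ring.
  rewrite exprAC; field; by rewrite expf_neq0.
have : e' * (4 * (S ^+ 2 + 1)) = e by rewrite divfK// gt_eqF//; clear -S2; lra.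
by clear -e'0; lra.
Qed.

End rectangles.

(** * Cauchy's formula on a rectangle *)

Section cauchy.
Context {R : realType}.
Local Open Scope complex_scope.
Local Notation normc := (@Normc.normc R).
Local Notation leb := (@lebesgue_measure R).
Implicit Types (F G : R[i] -> R[i]) (b z w d : R[i]) (x y : R).
Variables (x0 x1 y0 y1 r : R).
Hypothesis r0 : 0 < r.
Hypotheses (w4 : x1 - x0 <= 4 * r) (h4 : y1 - y0 <= 4 * r).
(** Distance at least [r] from every side. Together with sides of length at most [4 * r] this keeps
    the shape of the rectangle under control, so that the lower bound for [kappa] is an absolute
    constant. *)
Definition margin b := (x0 + r <= complex.Re b <= x1 - r) /\
  (y0 + r <= complex.Im b <= y1 - r).
Local Notation Q := (in_rect x0 x1 y0 y1).
Local Notation bd := (on_bd x0 x1 y0 y1).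
Lemma margin_rect b : margin b -> Q b.
Proof.
have r0' := r0; have w4' := w4; have h4' := h4.
by clear -w4 h4 r0 r0' w4' h4' => -[b1 b2]; split; lra. Qed.

Lemma margin_wide b : margin b -> x0 + 2 * r <= x1 /\ y0 + 2 * r <= y1.
Proof.
have r0' := r0; have w4' := w4; have h4' := h4.
by clear -w4 h4 r0 r0' w4' h4' => -[b1 b2]; split; lra. Qed.

Lemma margin_dist b z : margin b -> bd z -> r <= normc (z - b).
Proof.
have r0' := r0; have w4' := w4; have h4' := h4.
clear -w4 h4 r0 r0' w4' h4' => -[b1 b2] [_ h].
have := normc_Re (z - b); have := normc_Im (z - b); rewrite !rcE !ler_norml.
by case: h => ->; lra.
Qed.

Lemma margin_bd b z : margin b -> bd z -> z - b != 0.
Proof.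
have r0' := r0; have w4' := w4; have h4' := h4.
move=> mb /(margin_dist mb) h; rewrite -normc_gt0; exact: lt_le_trans h.
Qed.

Lemma cdiff_inv_sub b z : z - b != 0 -> cdiff (fun w => (w - b)^-1) z.
Proof.
have r0' := r0; have w4' := w4; have h4' := h4.
by move=> zb; apply: cdiffV => //; exact: cdiff_subc. Qed.

(** Four strips avoiding [b] are cut off by Goursat's theorem. What remains is a square of half-side
    [s] around [b], on which [F] is bounded by continuity, and [s] is arbitrarily small. *)
Lemma rint_punctured F b : margin b -> rcont x0 x1 y0 y1 F ->
  (forall z, Q z -> z != b -> cdiff F z) -> rint x0 x1 y0 y1 F = 0.
Proof.
have r0' := r0; have w4' := w4; have h4' := h4.
move=> mb cF dF; have [wx wy] := margin_wide mb.
pose p := complex.Re b; pose q := complex.Im b.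
have [b1 b2] : (x0 + r <= p <= x1 - r) /\ (y0 + r <= q <= y1 - r) by [].
have small s : 0 < s -> s <= r ->
    rint x0 x1 y0 y1 F = rint (p - s) (p + s) (q - s) (q + s) F.
  move=> s0 sr.
  have sub a a' c c' : x0 <= a -> a' <= x1 -> y0 <= c -> c' <= y1 ->
      rcont a a' c c' F by move=> *; apply: rcontS cF.
  have zero a a' c c' : x0 <= a -> a <= a' -> a' <= x1 -> y0 <= c -> c <= c' -> c' <= y1 ->
      ~ in_rect a a' c c' b -> rint a a' c c' F = 0.
    move=> k1 k2 k3 k4 k5 k6 nb; apply: goursat => // z hz; apply: dF.
      by case: hz; clear -w4 h4 r0 r0' w4' h4' k1 k3 k4 k6 => *; split; lra.
    by apply: contra_notN nb => /eqP <-.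
  clear dF cF.
  rewrite (@rint_vsplit _ (p - s) x0 x1 y0 y1); [|clear -w4 h4 r0 r0' w4' h4' b1 s0 sr r0; lra|clear -w4 h4 r0 r0' w4' h4' wy r0; lra|
    by apply: sub].
  rewrite (@rint_vsplit _ (p + s) (p - s) x1 y0 y1); [|clear -w4 h4 r0 r0' w4' h4' b1 s0 sr r0; lra|clear -w4 h4 r0 r0' w4' h4' wy r0; lra|
    by apply: sub => //; clear -w4 h4 r0 r0' w4' h4' b1 s0 sr r0; lra].
  rewrite (@rint_hsplit _ (q - s) (p - s) (p + s) y0 y1); [|clear -w4 h4 r0 r0' w4' h4' s0; lra|clear -w4 h4 r0 r0' w4' h4' b2 s0 sr r0; lra|
    by apply: sub => //; clear -w4 h4 r0 r0' w4' h4' b1 s0 sr r0; lra].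
  rewrite (@rint_hsplit _ (q + s) (p - s) (p + s) (q - s) y1); [|clear -w4 h4 r0 r0' w4' h4' s0; lra|clear -w4 h4 r0 r0' w4' h4' b2 s0 sr r0; lra|
    by apply: sub => //; clear -w4 h4 r0 r0' w4' h4' b1 b2 s0 sr r0; lra].
  rewrite (zero x0 (p - s) y0 y1); [|clear -w4 h4 r0 r0' w4' h4' b1 s0 sr r0 wx wy; lra..|]; last first.
    by move=> [/= + _]; rewrite -/p; clear -w4 h4 r0 r0' w4' h4' s0; lra.
  rewrite (zero (p + s) x1 y0 y1); [|clear -w4 h4 r0 r0' w4' h4' b1 s0 sr r0 wx wy; lra..|]; last first.
    by move=> [/= + _]; rewrite -/p; clear -w4 h4 r0 r0' w4' h4' s0; lra.
  rewrite (zero (p - s) (p + s) y0 (q - s)); [|clear -w4 h4 r0 r0' w4' h4' b1 b2 s0 sr r0 wx wy; lra..|]; last first.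
    by move=> [_ /=]; rewrite -/q; clear -w4 h4 r0 r0' w4' h4' s0; lra.
  rewrite (zero (p - s) (p + s) (q + s) y1); [|clear -w4 h4 r0 r0' w4' h4' b1 b2 s0 sr r0 wx wy; lra..|]; last first.
    by move=> [_ /=]; rewrite -/q; clear -w4 h4 r0 r0' w4' h4' s0; lra.
  by ring.
apply/eqP; rewrite -normc_eq0 eq_le normc_ge0 andbT.
apply/ler_addgt0Pl => e e0; rewrite addr0.
have [d d0 hd] := cF _ (margin_rect mb) 1 ltr01.
pose M := normc (F b) + 1.
have M0 : 0 < M by rewrite /M; have := normc_ge0 (F b); clear -w4 h4 r0 r0' w4' h4'; lra.
(* The bound for the small square is [4 * M * (2 * s + 2 * s) = 16 * M * s]; the value [d / 3] keeps
   the square inside the region where [F] is bounded by [M]. *)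
pose s := Num.min r (Num.min (d / 3) (e / (16 * M))).
have s0 : 0 < s by rewrite !lt_min r0 !divr_gt0 ?mulr_gt0.
have [s1 s2 s3] : [/\ s <= r, s <= d / 3 & s <= e / (16 * M)].
  by rewrite /s !ge_min !lexx !orbT.
rewrite (small s)//.
have rs : rcont (p - s) (p + s) (q - s) (q + s) F.
  by apply: rcontS cF; clear -w4 h4 r0 r0' w4' h4' b1 b2 s1 s0; lra.
apply: le_trans (rint_norm_le (M := M) _ _ (rcont_bcont rs) _) _.
- by clear -w4 h4 r0 r0' w4' h4' s0; lra.
- by clear -w4 h4 r0 r0' w4' h4' s0; lra.
- move=> z [[z1 z2] _]; have h : normc (z - b) < d.
    apply: le_lt_trans (normc_leReIm _) _; rewrite !rcE -/p -/q.
    apply: (@le_lt_trans _ _ (s + s)); last by clear -w4 h4 r0 r0' w4' h4' s2 d0; lra.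
    by apply: lerD; rewrite ler_norml; clear -w4 h4 r0 r0' w4' h4' z1 z2; lra.
  have := normc_lower (F z) (F b); have := hd _ h; rewrite /M; clear -w4 h4 r0 r0' w4' h4'; lra.
- move: s3; rewrite ler_pdivlMr; last by rewrite mulr_gt0.
  by clear -w4 h4 r0 r0' w4' h4'; lra.
Qed.
(** The integral whose classical value is [2 pi i]. It is carried along as a factor and controlled
    by a lower bound for its modulus and, in the Taylor estimate, by a Lipschitz bound. *)
Definition kappa b := rint x0 x1 y0 y1 (fun z => (z - b)^-1).
Lemma bcont_inv b : margin b -> bcont x0 x1 y0 y1 (fun z => (z - b)^-1).
Proof.
have r0' := r0; have w4' := w4; have h4' := h4.
by move=> mb z /(margin_bd mb) zb; exact/cdiff_ccont/cdiff_inv_sub.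
Qed.

(** All four sides contribute nonnegatively to the imaginary part. Only the bottom side is kept: its
    integrand is at least [(32 * r)^-1] and its length at least [2 * r]. *)
Lemma kappa_lower b : margin b -> 16^-1 <= normc (kappa b).
Proof.
have r0' := r0; have w4' := w4; have h4' := h4.
move=> mb; apply: le_trans (normc_Im _); apply: le_trans (ler_norm _).
have [wx wy] := margin_wide mb.
have x01 : x0 <= x1 by clear -w4 h4 r0 r0' w4' h4' wx r0; lra.
have y01 : y0 <= y1 by clear -w4 h4 r0 r0' w4' h4' wy r0; lra.
have [c1 c2 c3 c4] := bcont_sides x01 y01 (bcont_inv mb).
case: b mb c1 c2 c3 c4 => p q [/= b1 b2] c1 c2 c3 c4.
rewrite mul0r add0r mul1r.
rewrite -[X in X <= _]addr0; apply: lerD; last first.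
  apply: Rintegral_ge0 => t ty0.
  have ty : y0 <= t <= y1 by move: ty0; rewrite /= in_itv.
  rewrite -mulNr; apply: addr_ge0; apply: divr_ge0;
    first [by apply: addr_ge0; apply: sqr_ge0|by clear -w4 h4 r0 r0' w4' h4' b1; lra].
have -> : 16^-1 = \int[leb]_(t in `[x0, x1]) (16 * (x1 - x0))^-1.
  rewrite Rintegral_cst// leb_itv//; field; clear -w4 h4 r0 r0' w4' h4' wx r0; lra.
apply: le_Rintegral => //.
- apply: (@cont_integrable _ _ _ (fun=> (16 * (x1 - x0))^-1)) => t _ e e0; exists 1 => // s _.
  by rewrite subrr normr0.
- exact: (ccont_Im (ccont_onB c1 c2)).
- move=> t tx0; have tx : x0 <= t <= x1 by move: tx0; rewrite /= in_itv.
  rewrite opprK.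
  have pos v : r <= v -> 0 < (t - p) ^+ 2 + v ^+ 2.
    move=> h; rewrite ltr_wpDl ?sqr_ge0// exprn_gt0//; exact: lt_le_trans h.
  have tp2 : (t - p) ^+ 2 <= 16 * r ^+ 2.
    by clear -w4 h4 r0 r0' w4' h4' tx b1 w4 r0; nra.
  have l v : r <= v <= 4 * r -> (32 * r)^-1 <= v / ((t - p) ^+ 2 + v ^+ 2).
    move=> /andP[v1 v2]; rewrite ler_pdivlMr ?pos// ler_pdivrMl ?mulr_gt0//.
    by clear -w4 h4 r0 r0' w4' h4' tp2 v1 v2 r0; nra.
  have k1 := l (q - y0); have k2 := l (y1 - q).
  rewrite -mulNr opprB -(sqrrN (y0 - q)) opprB.
  have w2 : (16 * (x1 - x0))^-1 <= (32 * r)^-1.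
    by rewrite lef_pV2 ?posrE; clear -w4 h4 r0 r0' w4' h4' wx r0; lra.
  apply: le_trans w2 _; apply: le_trans (k1 _) _; first by clear -w4 h4 r0 r0' w4' h4' b2 h4 r0; lra.
  by rewrite lerDl divr_ge0 ?ltW ?pos//; clear -w4 h4 r0 r0' w4' h4' b2 r0; lra.
Qed.

Lemma kappa_neq0 b : margin b -> kappa b != 0.
Proof.
have r0' := r0; have w4' := w4; have h4' := h4.
by move=> /kappa_lower h; rewrite -normc_gt0; apply: lt_le_trans h. Qed.
Section holomorphic.
Variable G : R[i] -> R[i].
Hypothesis dG : forall z, Q z -> cdiff G z.
Lemma bcont_quot b : margin b -> bcont x0 x1 y0 y1 (fun z => G z * (z - b)^-1).
Proof.
have r0' := r0; have w4' := w4; have h4' := h4.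
move=> mb z hz; apply: cdiff_ccont; apply: cdiffM; first by apply: dG; case: hz.
exact/cdiff_inv_sub/(margin_bd mb).
Qed.

(** The difference quotient of [G] at [b], continued by the derivative, is continuous and is
    holomorphic off [b], so that its integral vanishes by [rint_punctured]. *)
Lemma cauchy_formula b : margin b ->
  rint x0 x1 y0 y1 (fun z => G z * (z - b)^-1) = G b * kappa b.
Proof.
have r0' := r0; have w4' := w4; have h4' := h4.
move=> mb; have [wx wy] := margin_wide mb.
have x01 : x0 <= x1 by clear -w4 h4 r0 r0' w4' h4' dG wx r0; lra.
have y01 : y0 <= y1 by clear -w4 h4 r0 r0' w4' h4' dG wy r0; lra.
have [d /cderP[phi [cphi _ hphi]]] := dG (margin_rect mb).
have phiE z : z != b -> phi z = (G z - G b) * (z - b)^-1.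
  by move=> zb; rewrite hphi mulfK// subr_eq0.
have dphi z : Q z -> z != b -> cdiff phi z.
  move=> Qz zb; have [d' hd'] : cdiff (fun z => (G z - G b) * (z - b)^-1) z.
    apply: cdiffM; last by apply: cdiff_inv_sub; rewrite subr_eq0.
    by apply: cdiffB; [exact: dG|exact: cdiff_cst].
  exists d'; apply: cder_near hd'; exists (normc (z - b)).
    by rewrite normc_gt0 subr_eq0.
  move=> w wz; rewrite phiE//; apply: contraTneq wz => ->.
  by rewrite normcBC ltxx.
have : rint x0 x1 y0 y1 phi = 0.
  apply: (rint_punctured mb) => // z Qz.
  by have [->//|zb] := eqVneq z b; apply/cdiff_ccont/dphi.
rewrite (@eq_rint _ _ _ _ _ _ _ _ (fun z => G z * (z - b)^-1 - G b * (z - b)^-1))//; last first.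
  by move=> z hz; rewrite phiE -?mulrBl// -subr_eq0 (margin_bd mb).
rewrite rintB//; [|exact: bcont_quot|exact/bcontZ/bcont_inv].
rewrite rintZ//; last exact: bcont_inv.
by move=> /eqP; rewrite subr_eq0 => /eqP.
Qed.

(** On the boundary [|z - b| >= r]. The constant 32 is the 2 of [rint_norm] times the 16 of
    [kappa_lower]. The four side integrals are kept apart so that each can later be compared with an
    area integral. *)
Lemma cauchy_L1 b : margin b -> normc (G b) * r <= 32 *
  (\int[leb]_(t in `[x0, x1]) normc (G (t +i* y0)) +
   \int[leb]_(t in `[x0, x1]) normc (G (t +i* y1)) +
   \int[leb]_(t in `[y0, y1]) normc (G (x0 +i* t)) +
   \int[leb]_(t in `[y0, y1]) normc (G (x1 +i* t))).
Proof.
have r0' := r0; have w4' := w4; have h4' := h4.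
move=> mb; have [wx wy] := margin_wide mb.
have x01 : x0 <= x1 by clear -w4 h4 r0 r0' w4' h4' dG wx r0; lra.
have y01 : y0 <= y1 by clear -w4 h4 r0 r0' w4' h4' dG wy r0; lra.
have := rint_norm x01 y01 (bcont_quot mb).
rewrite cauchy_formula// normcM.
have [c1 c2 c3 c4] := bcont_sides x01 y01 (bcont_quot mb).
have [d1 d2 d3 d4] := bcont_sides x01 y01
  (fun z h => cdiff_ccont (dG (proj1 h)) : ccont G z).
have key a a' (h : R -> R[i]) : a <= a' ->
    ccont_on a a' (fun t => G (h t) * (h t - b)^-1) -> ccont_on a a' (fun t => G (h t)) ->
    (forall t, a <= t <= a' -> bd (h t)) ->
    \int[leb]_(t in `[a, a']) normc (G (h t) * (h t - b)^-1) * r <=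
    \int[leb]_(t in `[a, a']) normc (G (h t)).
  move=> aa k1 k2 hb; rewrite -RintegralZr//; last exact: ccont_normc.
  apply: le_Rintegral => //; [| exact: ccont_normc|].
    exact: (integrableZr _ r (ccont_normc k1)).
  move=> t; rewrite /= in_itv/= => /hb /(margin_dist mb) h1.
  rewrite normcM normcV -mulrA ler_piMr ?normc_ge0//.
  by rewrite ler_pdivrMl ?mulr1//; exact: lt_le_trans h1.
have e1 := key _ _ _ x01 c1 d1; have e2 := key _ _ _ x01 c2 d2.
have e3 := key _ _ _ y01 c3 d3; have e4 := key _ _ _ y01 c4 d4.
have bd1 t : x0 <= t <= x1 -> bd (t +i* y0).
  by move=> h; split; [split=> //=; rewrite lexx|constructor 3].
have bd2 t : x0 <= t <= x1 -> bd (t +i* y1).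
  by move=> h; split; [split=> //=; rewrite lexx y01|constructor 4].
have bd3 t : y0 <= t <= y1 -> bd (x0 +i* t).
  by move=> h; split; [split=> //=; rewrite lexx|constructor 1].
have bd4 t : y0 <= t <= y1 -> bd (x1 +i* t).
  by move=> h; split; [split=> //=; rewrite lexx x01|constructor 2].
move: e1 e2 e3 e4 => /(_ bd1) + /(_ bd2) + /(_ bd3) + /(_ bd4).
have := kappa_lower mb.
have := normc_ge0 (G b); move: (normc (G b)) (normc (kappa b)) => g k g0 hk.
move: (Rintegral _ _ _) (Rintegral _ _ _) (Rintegral _ _ _) (Rintegral _ _ _)
  (Rintegral _ _ _) (Rintegral _ _ _) (Rintegral _ _ _) (Rintegral _ _ _).
move=> i1 j1 i2 j2 i3 j3 i4 j4 e1 e2 e3 e4 h.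
have h1 : g * 16^-1 <= g * k by rewrite ler_wpM2l.
have h2 := ler_wpM2r (ltW r0) (le_trans h1 h).
clear -w4 h4 r0 r0' w4' h4' dG h2 e1 e2 e3 e4; lra.
Qed.

End holomorphic.
End cauchy.

(** * Cauchy estimates for the derivative and the Taylor remainder on squares *)

Section cauchy_taylor.
Context {R : realType}.
Local Open Scope complex_scope.
Local Notation normc := (@Normc.normc R).
Implicit Types (F G : R[i] -> R[i]) (a b c z w d : R[i]) (x y r : R).

Definition in_sq c r := in_rect (complex.Re c - r) (complex.Re c + r)
  (complex.Im c - r) (complex.Im c + r).

Lemma in_sqP c r z : in_sq c r z <->
  `|complex.Re (z - c)| <= r /\ `|complex.Im (z - c)| <= r.
Proof.
rewrite /in_sq /in_rect !rcE !ler_norml.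
by split=> -[h1 h2]; split; move: h1 h2; clear; lra.
Qed.

Lemma normc_in_sq c r z : normc (z - c) <= r -> in_sq c r z.
Proof.
by move=> h; apply/in_sqP; split; apply: le_trans h; [exact: normc_Re|exact: normc_Im].
Qed.

Lemma in_sqD c r s z w : in_sq c r z -> normc (w - z) <= s -> in_sq c (r + s) w.
Proof.
move=> /in_sqP[h1 h2] h; have h3 := le_trans (normc_Re _) h; have h4 := le_trans (normc_Im _) h.
apply/in_sqP; have -> : w - c = (z - c) + (w - z) by ring.
rewrite !rcE; split; apply: le_trans (ler_normD _ _) _; apply: lerD;
  by rewrite -?rcE//; move: h1 h2 h3 h4; rewrite !rcE.
Qed.

Lemma in_sqS c r s z : r <= s -> in_sq c r z -> in_sq c s z.
Proof. by move=> rs [h1 h2]; split; move: h1 h2 rs; clear; lra. Qed.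

Lemma in_sq_normc c r z : in_sq c r z -> normc (z - c) <= 2 * r.
Proof.
move=> /in_sqP[h1 h2]; apply: le_trans (normc_leReIm _) _.
by move: h1 h2; clear; lra.
Qed.

(** [S] is the constant of [rint_norm_le] for a square of side [4 * r]. The numbers [nA] and [nE]
    bound the integrals of [G - G a], at most [2 * M] in modulus, against two and three factors of
    size at most [r^-1]; [nL] is the Lipschitz constant of [kappa]; each 16 pays for a division by
    [kappa]. *)
Definition taylor_bound r : R := let S := 4 * (4 * r + 4 * r) in
  let nA := S * (2 * (r^-1 * r^-1)) in
  let nE := S * (2 * (r^-1 * r^-1 * r^-1)) in
  let nL := S * (r^-1 * r^-1) in
  16 * nA + 16 * (nE + nL * (16 * nA)) + 1.

(* All difference quotients of [G] at [a] are read off the Cauchy formula for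
   [G - G a]; the factor [kappa] need not be known to be constant, only to be
   Lipschitz and bounded away from 0. *)
Lemma cauchy_taylor r c G M : 0 < r -> (forall z, in_sq c (2 * r) z -> cdiff G z) ->
  (forall z, in_sq c (2 * r) z -> normc (G z) <= M) ->
  forall a d, in_sq c (r / 2) a -> cder G a d ->
  normc d <= taylor_bound r * M /\
  forall b, in_sq c r b ->
    normc (G b - G a - d * (b - a)) <= taylor_bound r * M * normc (b - a) ^+ 2.
Proof.
move=> r0 dG MG a d ha hd.
pose S := 4 * (4 * r + 4 * r).
pose nA := S * (2 * (r^-1 * r^-1)).
pose nE := S * (2 * (r^-1 * r^-1 * r^-1)).
pose nL := S * (r^-1 * r^-1).
have TE : taylor_bound r = 16 * nA + 16 * (nE + nL * (16 * nA)) + 1 by [].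
have ri0 : 0 < r^-1 by rewrite invr_gt0.
have S0 : 0 < S by rewrite /S; lra.
have nA0 : 0 < nA := mulr_gt0 S0 (mulr_gt0 (ltr0Sn _ 1) (mulr_gt0 ri0 ri0)).
have nE0 : 0 < nE := mulr_gt0 S0 (mulr_gt0 (ltr0Sn _ 1) (mulr_gt0 (mulr_gt0 ri0 ri0) ri0)).
have nL0 : 0 < nL := mulr_gt0 S0 (mulr_gt0 ri0 ri0).
have nn0 : 0 <= 16 * (nE + nL * (16 * nA)).
  exact: mulr_ge0 (ler0n _ 16) (addr_ge0 (ltW nE0) (mulr_ge0 (ltW nL0) (mulr_ge0 (ler0n _ 16) (ltW nA0)))).
have nAE : nA = S * (2 * (r^-1 * r^-1)) by [].
have nEE : nE = S * (2 * (r^-1 * r^-1 * r^-1)) by [].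
have nLE : nL = S * (r^-1 * r^-1) by [].
clearbody nA nE nL.
set x0 := complex.Re c - 2 * r; set x1 := complex.Re c + 2 * r.
set y0 := complex.Im c - 2 * r; set y1 := complex.Im c + 2 * r.
have w4 : x1 - x0 <= 4 * r by rewrite /x1 /x0; lra.
have h4 : y1 - y0 <= 4 * r by rewrite /y1 /y0; lra.
have x01 : x0 <= x1 by rewrite /x1 /x0; lra.
have y01 : y0 <= y1 by rewrite /y1 /y0; lra.
have mgn b : in_sq c r b -> margin x0 x1 y0 y1 r b.
  by move=> [b1 b2]; split; rewrite /x0 /x1 /y0 /y1; move: b1 b2 => /andP[? ?] /andP[? ?]; lra.
have ha1 : in_sq c r a by apply: in_sqS ha; lra.
have ma := mgn a ha1.
pose H z := G z - G a.
have dH z : in_rect x0 x1 y0 y1 z -> cdiff H z.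
  by move=> hz; apply: cdiffB; [exact: dG|exact: cdiff_cst].
have M0 : 0 <= M by apply: le_trans (normc_ge0 _) (MG a _); apply: in_sqS ha; lra.
have MH z : in_rect x0 x1 y0 y1 z -> normc (H z) <= 2 * M.
  move=> hz; have := normcB (G z) (G a); have := MG z hz.
  have := MG a (in_sqS (_ : r <= 2 * r) ha1); rewrite /H; move=> /(_ ltac:(lra)); lra.
have cH z : in_rect x0 x1 y0 y1 z -> ccont H z by move=> /dH /cdiff_ccont.
pose k b := kappa x0 x1 y0 y1 b.
pose I := rint x0 x1 y0 y1.
(* [A b] comes from the divided difference of the Cauchy kernel at [a] and [b], [D] is [A a], [E]
   comes from the next divided difference, and [L] from that of [kappa]. *)
pose A b := I (fun z => H z * ((z - b)^-1 * (z - a)^-1)).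
pose D := I (fun z => H z * ((z - a)^-1 * (z - a)^-1)).
pose E b := I (fun z => H z * ((z - b)^-1 * (z - a)^-1 * (z - a)^-1)).
pose L b := I (fun z => (z - b)^-1 * (z - a)^-1).
have bc b := bcont_inv (b := b) r0 w4 h4.
have bH : bcont x0 x1 y0 y1 H by move=> z [/cH].
have bM F F' : bcont x0 x1 y0 y1 F -> bcont x0 x1 y0 y1 F' ->
    bcont x0 x1 y0 y1 (fun z => F z * F' z).
  by move=> h h' z hz; apply: ccontM; [exact: h|exact: h'].
have bnd F N : bcont x0 x1 y0 y1 F -> (forall z, on_bd x0 x1 y0 y1 z -> normc (F z) <= N) ->
    normc (I F) <= S * N.
  move=> h1 h2; apply: le_trans (rint_norm_le x01 y01 h1 h2) _.
  by rewrite /S /x0 /x1 /y0 /y1; have := le_trans (normc_ge0 _) (h2 (x0 +i* y0) _); lra.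
have inv b z : in_sq c r b -> on_bd x0 x1 y0 y1 z -> normc (z - b)^-1 <= r^-1.
  move=> /mgn mb hz; rewrite normcV lef_pV2 ?posrE//; have := margin_dist r0 w4 h4 mb hz => //.
  exact: lt_le_trans.
have DE : normc D <= nA * M.
  rewrite (_ : nA * M = S * (2 * M * (r^-1 * r^-1))); last by rewrite nAE; ring.
  apply: bnd => [|z hz]; first by apply: (bM) => //; apply: (bM); exact: bc.
  by rewrite !normcM !ler_pM ?mulr_ge0 ?normc_ge0//; [apply: MH; case: hz|exact: inv..].
have AE b : in_sq c r b -> normc (A b) <= nA * M.
  move=> hb.
  rewrite (_ : nA * M = S * (2 * M * (r^-1 * r^-1))); last by rewrite nAE; ring.
  apply: bnd => [|z hz]; first by apply: (bM) => //; apply: (bM); apply: bc => //; exact: mgn.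
  by rewrite !normcM !ler_pM ?mulr_ge0 ?normc_ge0//; [apply: MH; case: hz|exact: inv..].
have EE b : in_sq c r b -> normc (E b) <= nE * M.
  move=> hb.
  rewrite (_ : nE * M = S * (2 * M * (r^-1 * r^-1 * r^-1))); last by rewrite nEE; ring.
  apply: bnd => [|z hz].
    by apply: (bM) => //; apply: (bM); [apply: (bM)|]; apply: bc => //; exact: mgn.
  by rewrite !normcM !ler_pM ?mulr_ge0 ?normc_ge0//; [apply: MH; case: hz|exact: inv..].
have LE b : in_sq c r b -> normc (L b) <= nL.
  move=> hb; rewrite nLE; apply: bnd => [|z hz]; first by apply: (bM); apply: bc => //; exact: mgn.
  by rewrite !normcM !ler_pM ?mulr_ge0 ?normc_ge0//; exact: inv.
have nz b z : in_sq c r b -> on_bd x0 x1 y0 y1 z -> z - b != 0.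
  by move=> /mgn mb; exact: margin_bd mb.
(* Since [H a = 0], the Cauchy formula at [a] may be subtracted without changing the left-hand side,
   and the difference of the two kernels produces the factor [b - a]. *)
have HA b : in_sq c r b -> H b * k b = (b - a) * A b.
  move=> hb; have mb := mgn b hb.
  have e1 := cauchy_formula r0 w4 h4 dH mb.
  have e2 := cauchy_formula r0 w4 h4 dH ma.
  rewrite -e1 -[LHS]subr0 -[X in _ - X](_ : H a * kappa x0 x1 y0 y1 a = 0); last by rewrite /H subrr mul0r.
  rewrite -e2 -rintB//; [|exact: (bcont_quot r0 w4 h4 dH mb)|exact: (bcont_quot r0 w4 h4 dH ma)].
  rewrite -rintZ//; last by apply: (bM) => //; apply: (bM); exact: bc.
  apply: eq_rint => // z hz; field.
  by rewrite !nz.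
have AD b : in_sq c r b -> A b - D = (b - a) * E b.
  move=> hb; have mb := mgn b hb.
  rewrite /A /D /I -rintB//; [|by apply: (bM) => //; apply: (bM); exact: bc..].
  rewrite -rintZ//; last by apply: (bM) => //; apply: (bM); [apply: (bM)|]; exact: bc.
  apply: eq_rint => // z hz; field.
  by rewrite !nz.
have kL b : in_sq c r b -> k b - k a = (b - a) * L b.
  move=> hb; have mb := mgn b hb.
  rewrite /k /kappa -rintB//; [|exact: bc..].
  rewrite -rintZ//; last by apply: (bM); exact: bc.
  apply: eq_rint => // z hz; field.
  by rewrite !nz.
have klow b : in_sq c r b -> forall t, normc t <= 16 * normc (t * k b).
  move=> /mgn mb t; rewrite normcM mulrCA -[X in X <= _]mulr1 ler_wpM2l ?normc_ge0//.
  have := kappa_lower r0 w4 h4 mb; rewrite -/(k b); clear; lra.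
have k0 : k a != 0 by apply: (kappa_neq0 r0 w4 h4 ma).
pose d0 := D / k a.
(* Multiplied by [k a], the remainder is [(b - a)^2 E b - (b - a) L b H b]; the second term is also
   quadratic because [HA] makes [H b] of order [b - a]. The estimate shows that [d0] is a
   derivative, hence equal to [d] by uniqueness. *)
have key b : in_sq c r b -> normc (H b - d0 * (b - a)) <=
    (16 * (nE + nL * (16 * nA))) * M * normc (b - a) ^+ 2.
  move=> hb; apply: le_trans (klow a ha1 _) _.
  rewrite (_ : (H b - d0 * (b - a)) * k a = (b - a) * ((b - a) * E b) - (b - a) * L b * H b);
    last first.
    rewrite -AD// -kL// /d0 mulrBl mulrAC -mulrA.
    have -> : H b * k a = H b * k b - (k b - k a) * H b by ring.
    by rewrite HA// [D / k a * _]mulrA divfK//; ring.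
  have HbE : normc (H b) <= 16 * (normc (b - a) * (nA * M)).
    apply: le_trans (klow b hb _) _; rewrite HA// normcM ler_pM2l//.
    by rewrite ler_wpM2l ?normc_ge0// AE.
  rewrite -!mulrA ler_pM2l//; apply: le_trans (normcB _ _) _; rewrite !normcM.
  have n0 := normc_ge0 (b - a).
  have t1 : normc (b - a) * (normc (b - a) * normc (E b)) <=
      normc (b - a) * (normc (b - a) * (nE * M)) by rewrite !ler_wpM2l// EE.
  have t2 : normc (b - a) * (normc (L b) * normc (H b)) <=
      normc (b - a) * (nL * (16 * (normc (b - a) * (nA * M)))).
    by rewrite ler_wpM2l//; apply: ler_pM; rewrite ?normc_ge0// LE.
  apply: le_trans (lerD t1 t2) _.
  by rewrite le_eqVlt; apply/orP; left; apply/eqP; ring.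
have cd0 : cder G a d0.
  move=> e e0; pose N := (16 * (nE + nL * (16 * nA))) * M.
  have N0 : 0 <= N by exact: mulr_ge0.
  exists (Num.min (r / 2) (e / (N + 1))).
    by rewrite lt_min !divr_gt0//; lra.
  move=> w; rewrite lt_min => /andP[w1 w2].
  have hw : in_sq c r w.
    by have := in_sqD ha (ltW w1); apply: in_sqS; clear -r0; lra.
  apply: le_trans (key w hw) _; rewrite -/N expr2.
  move: w2; rewrite ltr_pdivlMr; last by lra.
  have := normc_ge0 (w - a); move: (normc _) => t t0 h.
  have : t * (t * (N + 1)) <= t * e by rewrite ler_wpM2l// ltW.
  have : 0 <= t * t by rewrite mulr_ge0.
  by clear; lra.
have -> : d = d0 by exact: cder_uniq hd cd0.
split.
  apply: le_trans (klow a ha1 _) _; rewrite /d0 mulfVK//.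
  apply: (@le_trans _ _ (16 * (nA * M))); first by rewrite ler_pM2l.
  rewrite mulrA ler_wpM2r// TE; clear -nn0; lra.
move=> b hb; apply: le_trans (key b hb) _.
rewrite ler_wpM2r ?sqr_ge0// ler_wpM2r// TE.
have : 0 <= 16 * nA := mulr_ge0 (ler0n _ 16) (ltW nA0).
clear; lra.
Qed.

End cauchy_taylor.

(** * Several complex variables *)

Section complex_space.
Context {R : realType}.
Local Open Scope complex_scope.
Local Notation normc := (@Normc.normc R).

Lemma ltcRe (e : R[i]) : 0 < e -> e = (complex.Re e)%:C /\ 0 < complex.Re e.
Proof.
by case: e => a b; rewrite ltcE /= => /andP[/eqP -> ->].
Qed.

Section vnorm.
Variable n : nat.
Implicit Types (u v w z : 'rV[R[i]]_n).

(** The norm of a row lies in [R[i]]; this is its real version, the maximum of the moduli of the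
    coordinates. *)
Definition vn v : R := complex.Re `|v|.

Lemma vnE v : `|v| = (vn v)%:C.
Proof. by rewrite /vn RRe_real// normr_real. Qed.

Lemma vn_ge0 v : 0 <= vn v.
Proof. by rewrite -lecR -vnE normr_ge0. Qed.

Lemma vnD u v : vn (u + v) <= vn u + vn v.
Proof. by have := ler_normD u v; rewrite !vnE -rmorphD lecR. Qed.

Lemma vnN v : vn (- v) = vn v.
Proof. by rewrite /vn normrN. Qed.

Lemma vnB u v : vn (u - v) = vn (v - u).
Proof. by rewrite -vnN opprB. Qed.

Lemma vnZ a v : vn (a *: v) = normc a * vn v.
Proof. by have := normrZ a v; rewrite !vnE normcE_def -rmorphM => /complexI. Qed.

Lemma vn0 : vn 0 = 0.
Proof. by rewrite /vn normr0. Qed.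

Lemma vn_eq0 v : vn v = 0 -> v = 0.
Proof. by move=> h; apply/normr0_eq0; rewrite vnE h. Qed.

Lemma vn_gt0 v : v != 0 -> 0 < vn v.
Proof.
by move=> v0; rewrite lt_neqAle vn_ge0 andbT eq_sym; apply: contraNneq v0 => /vn_eq0 ->.
Qed.

Lemma vn_lt v (e : R) : 0 < e -> vn v < e <-> forall j, normc (v 0 j) < e.
Proof.
move=> e0; have e0' : 0 < e%:C by rewrite ltcR.
have := congr1 (fun B => B 0 e%:C (- v)) (@mx_norm_ball R[i] 1 n).
rewrite /ball_ /= sub0r opprK vnE ltcR => <-; split=> [[_ h] j|h].
  by have := h 0 j; rewrite /ball /= !mxE sub0r opprK normcE_def ltcR.
split=> // i j; have := h j; rewrite /ball /= !mxE sub0r opprK normcE_def ltcR.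
by rewrite ord1.
Qed.

Lemma normc_le_vn v j : normc (v 0 j) <= vn v.
Proof.
apply/ler_addgt0Pl => e e0; apply/ltW.
have /(vn_lt v) [+ _] : 0 < e + vn v by rewrite ltr_wpDr ?vn_ge0.
by apply; rewrite ltrDr.
Qed.

Lemma vn_le v (e : R) : 0 <= e -> (forall j, normc (v 0 j) <= e) -> vn v <= e.
Proof.
move=> e0 h; apply/ler_addgt0Pl => d d0; apply/ltW/vn_lt; first by lra.
by move=> j; rewrite (le_lt_trans (h j))// ltrDr.
Qed.

Lemma open_vn (Om : set 'rV[R[i]]_n) z : open Om -> Om z ->
  exists2 r : R, 0 < r & forall w, vn (w - z) < r -> Om w.
Proof.
rewrite openE => /(_ z) h /h /nbhs_ballP[e /= e0 he].
have [ee e0'] := ltcRe e0.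
exists (complex.Re e) => // w wz; apply: he.
by rewrite mx_norm_ball /ball_ /= -normrN opprB vnE ee ltcR.
Qed.

Lemma nbhs_vn z (A : set 'rV[R[i]]_n) :
  nbhs z A <-> exists2 r : R, 0 < r & forall w, vn (w - z) < r -> A w.
Proof.
split=> [/nbhs_ballP[e /= e0 he]|[r r0 hr]].
  have [ee e0'] := ltcRe e0; exists (complex.Re e) => // w wz; apply: he.
  by rewrite mx_norm_ball /ball_ /= -normrN opprB vnE ee ltcR.
apply/nbhs_ballP; exists r%:C; rewrite /= ?ltcR// => w.
by rewrite mx_norm_ball /ball_ /= vnE ltcR vnB => /hr.
Qed.

Lemma vn_open (Om : set 'rV[R[i]]_n) :
  (forall z, Om z -> exists2 r : R, 0 < r & forall w, vn (w - z) < r -> Om w) ->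
  open Om.
Proof. by move=> h; rewrite openE => z /h /nbhs_vn. Qed.

Lemma bounded_linear (L : 'rV[R[i]]_n -> R[i]) : linear L ->
  exists2 K : R, 0 <= K & forall v, normc (L v) <= K * vn v.
Proof.
move=> linL; exists (\sum_j normc (L (delta_mx 0 j))).
  by apply: sumr_ge0 => j _; exact: normc_ge0.
move=> v; have -> : L v = \sum_j v 0 j * L (delta_mx 0 j).
  pose L' : {linear 'rV[R[i]]_n -> R[i]} := HB.pack L
    (GRing.isLinear.Build _ _ _ _ L linL).
  rewrite -[L v]/(L' v) {1}(row_sum_delta v) linear_sum.
  by apply: eq_bigr => j _; rewrite linearZ.
apply: le_trans (normc_sum _ _) _; rewrite mulr_suml; apply: ler_sum => j _.
by rewrite normcM mulrC ler_wpM2l ?normc_ge0 ?normc_le_vn.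
Qed.

End vnorm.

(** Complex Fréchet differentiability with real epsilons. [L] is a bare function, so that a
    pointwise limit of differentials can be inserted directly. *)
Definition fder n (f : 'rV[R[i]]_n -> R[i]) (z : 'rV[R[i]]_n) (L : 'rV[R[i]]_n -> R[i]) :=
  forall e : R, 0 < e -> exists2 r : R, 0 < r & forall v, vn v < r ->
    normc (f (z + v) - f z - L v) <= e * vn v.

Fact cdif_key n : {D : ('rV[R[i]]_n -> R[i]) -> 'rV[R[i]]_n -> 'rV[R[i]]_n -> R[i] |
  forall f z v, D f z v = 'd f z v}.
Proof. by exists (fun f z v => 'd f z v). Qed.

(* The complex differential, sealed so that rewriting never unfolds ['d]. *)
Definition cdif n := sval (cdif_key n).

Lemma cdifE n (f : 'rV[R[i]]_n -> R[i]) (z v : 'rV[R[i]]_n) : cdif f z v = 'd f z v.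
Proof. exact: (svalP (cdif_key n)). Qed.

Lemma cdif_linear n (f : 'rV[R[i]]_n -> R[i]) (z : 'rV[R[i]]_n) : linear (cdif f z).
Proof. by move=> a v w; rewrite !cdifE linearP. Qed.

Lemma cdifZv n (f : 'rV[R[i]]_n -> R[i]) (z : 'rV[R[i]]_n) a v :
  cdif f z (a *: v) = a * cdif f z v.
Proof. by rewrite !cdifE linearZ. Qed.

Lemma cdif0v n (f : 'rV[R[i]]_n -> R[i]) (z : 'rV[R[i]]_n) : cdif f z 0 = 0.
Proof. by rewrite cdifE linear0. Qed.

Lemma cdif_sumv n (f : 'rV[R[i]]_n -> R[i]) (z v : 'rV[R[i]]_n) :
  cdif f z v = \sum_j v 0 j * cdif f z (delta_mx 0 j).
Proof.
rewrite cdifE {1}(row_sum_delta v) linear_sum; apply: eq_bigr => j _.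
by rewrite linearZ cdifE.
Qed.

Lemma differentiable_fder n (f : 'rV[R[i]]_n -> R[i]) (z : 'rV[R[i]]_n) :
  differentiable f z -> fder f z (cdif f z).
Proof.
have -> : cdif f z = 'd f z by apply/funext => v; rewrite cdifE.
move=> /diff_locally /eqaddoP h e e0.
have e0' : 0 < e%:C by rewrite ltcR.
have /nbhs_vn[r r0 hr] := h _ e0'; exists r => // v vr.
have := hr v; rewrite subr0 => /(_ vr) /=; rewrite /= !fctE /=.
rewrite vnE normcE_def -rmorphM lecR. by rewrite opprD addrA [v + z]addrC.
Qed.

Lemma diff_of_estimate (V W : normedModType R[i]) (f : V -> W) (df : {linear V -> W}) x :
  continuous df ->
  (forall e, 0 < e -> \forall v \near (0 : V), `|f (v + x) - (f x + df v)| <= e * `|v|) ->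
  differentiable f x /\ 'd f x = df :> (V -> W).
Proof.
move=> cdf h; have LE : f \o shift x = cst (f x) + df +o_ 0 id by apply/eqaddoP.
have dE := diff_unique cdf LE; split => //.
by apply/diff_locallyP; rewrite dE.
Qed.

Lemma fder_differentiable n (f : 'rV[R[i]]_n -> R[i]) (z : 'rV[R[i]]_n) (L : 'rV[R[i]]_n -> R[i]) :
  linear L -> fder f z L -> differentiable f z /\ forall v, cdif f z v = L v.
Proof.
move=> linL h; pose L' : {linear 'rV[R[i]]_n -> R[i]} := HB.pack L
    (GRing.isLinear.Build _ _ _ _ L linL).
have cL : continuous L'.
  apply: continuousfor0_continuous; have [K K0 hK] := bounded_linear linL.
  apply/(@cvgrPdist_lt _ _ _ (nbhs (0 : 'rV[R[i]]_n))) => e /ltcRe[ee e0].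
  apply/nbhs_vn; exists (complex.Re e / (K + 1)); first by rewrite divr_gt0//; lra.
  move=> v; rewrite subr0 linear0 sub0r normrN normcE_def ee ltcR.
  rewrite ltr_pdivlMr => [vr|]; last by lra.
  apply: le_lt_trans (hK v) _; apply: le_lt_trans vr.
  by rewrite mulrC ler_wpM2l ?vn_ge0//; lra.
have [|df dE] := diff_of_estimate (f := f) (x := z) cL; last by split => // v; rewrite cdifE dE.
move=> e /ltcRe[ee e0]; rewrite ee.
have [r r0 hr] := h _ e0; apply/nbhs_vn; exists r => // v; rewrite subr0 => /hr.
by rewrite vnE normcE_def -rmorphM lecR opprD addrA [v + z]addrC.
Qed.

Lemma fder_line n (f : 'rV[R[i]]_n -> R[i]) (z v : 'rV[R[i]]_n) (b : R[i]) (L : 'rV[R[i]]_n -> R[i]) : linear L ->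
  fder f (z + b *: v) L -> cder (fun a => f (z + a *: v)) b (L v).
Proof.
move=> linL h e e0; have v0 := vn_ge0 v.
have [r r0 hr] := h (e / (vn v + 1)) ltac:(rewrite divr_gt0//; lra).
exists (r / (vn v + 1)) => [|a]; first by rewrite divr_gt0//; lra.
rewrite ltr_pdivlMr; last by lra.
move=> ar; have a0 := normc_ge0 (a - b).
have := hr ((a - b) *: v); rewrite vnZ (_ : z + b *: v + (a - b) *: v = z + a *: v); last first.
  by rewrite -addrA -scalerDl [b + _]addrC subrK.
move=> /(_ _)/le_trans h2.
have LZ : L ((a - b) *: v) = L v * (a - b).
  have L0 : L 0 = 0 by have := linL 1 0 0; rewrite scaler0 add0r scale1r => /eqP; rewrite -subr_eq0 opprD addrA subrr sub0r oppr_eq0 => /eqP.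
  by have := linL (a - b) v 0; rewrite !addr0 L0 addr0 mulrC.
rewrite -LZ; apply: h2.
  apply: le_lt_trans ar; rewrite ler_wpM2l//; lra.
have q : e / (vn v + 1) * vn v <= e.
  rewrite mulrAC ler_pdivrMr ?ler_pM2l//; lra.
rewrite (_ : e / (vn v + 1) * _ = e / (vn v + 1) * vn v * normc (a - b)); last by ring.
by rewrite ler_wpM2r.
Qed.

Lemma differentiable_line n (f : 'rV[R[i]]_n -> R[i]) (z v : 'rV[R[i]]_n) (b : R[i]) :
  differentiable f (z + b *: v) ->
  cder (fun a => f (z + a *: v)) b (cdif f (z + b *: v) v).
Proof. by move=> /differentiable_fder; apply: fder_line; exact: cdif_linear. Qed.

End complex_space.

(** * Measurability in the real coordinates used by [dV] *)

Section measurability.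
Context {R : realType} (n : nat).
Local Open Scope complex_scope.
Local Notation normc := (@Normc.normc R).
Local Notation plane := (measurableTypeR R * measurableTypeR R)%type.

Definition tbox (t0 : n.-tuple plane) (r : R) : set (n.-tuple plane) :=
  [set t | forall j, `|(tnth t j).1 - (tnth t0 j).1| <= r /\
                     `|(tnth t j).2 - (tnth t0 j).2| <= r].

Lemma measurable_ball_dist (a r : R) :
  measurable ([set x | `|x - a| <= r] : set (measurableTypeR R)).
Proof.
rewrite (_ : [set x | _] = `[a - r, a + r]%classic); first exact: measurable_itv.
by apply/seteqP; split=> x /=; rewrite in_itv/= ler_norml; lra.
Qed.

Lemma measurable_tbox t0 r : measurable (tbox t0 r).
Proof.
pose F (j : 'I_n) := (fun t : n.-tuple plane => tnth t j) @^-1`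
  ([set x | `|x - (tnth t0 j).1| <= r] `*` [set y | `|y - (tnth t0 j).2| <= r]).
rewrite (_ : tbox t0 r = \bigcap_(j in setT) F j).
  apply: fin_bigcap_measurable => // j _; rewrite -[X in measurable X]setTI.
  apply: measurable_tnth => //; apply: measurableX; exact: measurable_ball_dist.
by apply/seteqP; split=> t /= h j; have := h j; [move=> [? ?] _|move=> /(_ I) []].
Qed.

(** The sigma-algebra on tuples comes from the coordinates, not from the topology: an open set is
    written as the countable union of the boxes with rational centre and half-side [1 / (k + 1)]
    that it contains. *)
Lemma measurable_xyC (V : set 'rV[R[i]]_n) : open V -> measurable (@xyC R n @^-1` V).
Proof.
move=> oV.
pose c (q : {ffun 'I_n -> rat * rat}) : n.-tuple plane :=
  [tuple (ratr (q j).1, ratr (q j).2) | j < n].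
pose B (i : {ffun 'I_n -> rat * rat} * nat) := tbox (c i.1) (i.2.+1%:R^-1).
pose D i := if `[< B i `<=` @xyC R n @^-1` V >] then B i else set0.
rewrite (_ : _ @^-1` V = \bigcup_i D i).
  apply: countable_bigcupT_measurable => [|i]; first exact: countableP.
  by rewrite /D; case: ifP => // _; exact: measurable_tbox.
apply/seteqP; split=> [t /= Vt|t [i _]]; last first.
  by rewrite /D; case: asboolP => // h /h.
have [r r0 hr] := open_vn oV Vt.
(* Two points of a box of half-side [s] differ by at most [2 * s] in each real coordinate, hence by
   at most [4 * s] in each complex one, and [4 * s < r]. *)
pose k := Num.truncn (4 / r).
have k4 : (k.+1%:R : R)^-1 < r / 4.
  rewrite -[r / 4]invrK ltf_pV2 ?posrE ?invr_gt0 ?divr_gt0// invf_div.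
  by rewrite truncnS_gt.
set s := (k.+1%:R : R)^-1 in k4 *.
have s0 : 0 < s by rewrite invr_gt0.
have /choice[q hq] : forall j, exists q : rat * rat,
    `|(tnth t j).1 - ratr q.1| <= s /\ `|(tnth t j).2 - ratr q.2| <= s.
  move=> j.
  have [q1] := @rat_in_itvoo R ((tnth t j).1 - s) ((tnth t j).1 + s) ltac:(lra).
  have [q2] := @rat_in_itvoo R ((tnth t j).2 - s) ((tnth t j).2 + s) ltac:(lra).
  rewrite !in_itv/= => h2 h1; exists (q1, q2) => /=.
  by rewrite !ler_norml; clear -h1 h2; lra.
exists ([ffun j => q j], k) => //; rewrite /D.
have tB : B ([ffun j => q j], k) t by move=> j; rewrite /c tnth_mktuple ffunE.
case: asboolP => // nB; exfalso; apply: nB => t' ht' /=.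
apply: hr; apply/vn_lt => // j; rewrite !mxE.
have [h1 h1'] : `|(tnth t' j).1 - (tnth (c [ffun j => q j]) j).1| <= s /\
    `|(tnth t' j).2 - (tnth (c [ffun j => q j]) j).2| <= s := ht' j.
have [h2 h2'] : `|(tnth t j).1 - (tnth (c [ffun j => q j]) j).1| <= s /\
    `|(tnth t j).2 - (tnth (c [ffun j => q j]) j).2| <= s := tB j.
move: h1 h1' h2 h2'; rewrite !ler_norml => h1 h1' h2 h2'.
apply: le_lt_trans (normc_leReIm _) _; rewrite !rcE /=.
apply: (@le_lt_trans _ _ ((s + s) + (s + s))); last by clear -k4; lra.
by apply: lerD; rewrite ler_norml; clear -h1 h2 h1' h2'; lra.
Qed.

Lemma measurable_fun_xyC (V : set 'rV[R[i]]_n) (g : 'rV[R[i]]_n -> R) : open V ->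
  (forall z, V z -> forall e : R, 0 < e -> exists2 r : R, 0 < r &
     forall w, vn (w - z) < r -> `|g w - g z| < e) ->
  measurable_fun (@xyC R n @^-1` V) (fun t => g (xyC t)).
Proof.
move=> oV cg; have mV := measurable_xyC oV.
apply: (measurability _ (RGenOInfty.measurableE R)) => //.
move=> _ [_ [a ->] <-].
rewrite (_ : _ `&` _ = @xyC R n @^-1` [set z | V z /\ a < g z]).
  apply: measurable_xyC; apply: vn_open => z [Vz az].
  have [r r0 hr] := open_vn oV Vz.
  have [s s0 hs] := cg z Vz (g z - a) ltac:(lra).
  exists (Num.min r s) => [|w]; first by rewrite lt_min r0.
  rewrite lt_min => /andP[/hr Vw /hs h]; split => //.
  by move: h; rewrite ltr_norml; lra.
by apply/seteqP; split=> t /=; rewrite in_itv/= andbT.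
Qed.

End measurability.

(** * Iterated integrals and the mean value inequality in one variable *)

Section tonelli.
Context {R : realType}.
Local Open Scope complex_scope.
Local Open Scope ereal_scope.
Local Notation normc := (@Normc.normc R).
Local Notation leb := (@lebesgue_measure R).
Local Notation plane := (measurableTypeR R * measurableTypeR R)%type.
Local Notation area := (sigma_finite_product leb leb).

Lemma integral_tuple_cons d (T : measurableType d)
    (mu : {sigma_finite_measure set T -> \bar R}) n (h : n.+1.-tuple T -> \bar R) :
  measurable_fun setT h -> (forall t, 0 <= h t) ->
  \int[tuple_measure mu n.+1]_t h t =
  \int[mu]_x \int[tuple_measure mu n]_t h (tuple_cons (x, t)).
Proof.
move=> mh h0.
change (\int[pushforward (sigma_finite_product mu (tuple_measure mu n)) (@tuple_cons _ T n)]_t h t =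
  \int[mu]_x \int[tuple_measure mu n]_t h (tuple_cons (x, t))).
rewrite ge0_integral_pushforward//; last exact: measurable_tuple_cons.
change (\int[mu \x tuple_measure mu n]_x (h \o @tuple_cons _ T n) x =
  \int[mu]_x \int[tuple_measure mu n]_t h (tuple_cons (x, t))).
rewrite fubini_tonelli1//; last by move=> x; exact: h0.
by apply: measurableT_comp => //; exact: measurable_tuple_cons.
Qed.

Lemma exists_le_average (a r : R) (f : R -> \bar R) (A : R) : (0 < r)%R ->
  measurable_fun `[a, (a + r)%R] f -> (forall x, 0 <= f x) ->
  \int[leb]_(x in `[a, (a + r)%R]) f x < (A * r)%:E ->
  exists2 x, (a <= x <= a + r)%R & f x <= A%:E.
Proof.
move=> r0 mf f0 h; apply: contrapT => nh.
have A0 : (0 <= A)%R.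
  have : 0 < (A * r)%:E by apply: le_lt_trans h; exact: integral_ge0.
  by rewrite lte_fin => /ltW; rewrite pmulr_lge0.
move: h; apply/negP; rewrite -leNgt.
have -> : (A * r)%:E = \int[leb]_(x in `[a, (a + r)%R]) (A%:E).
  have Lr : leb `[a, (a + r)%R] = r%:E.
    by rewrite lebesgue_measure_itv/= lte_fin ltrDl r0 -EFinD addrAC subrr add0r.
  by rewrite integral_cst// EFinM; congr (_ * _); exact/esym/Lr.
apply: ge0_le_integral => // x; rewrite /= in_itv/= => xI.
apply: ltW; rewrite ltNge; apply/negP => fx.
by apply: nh; exists x.
Qed.

Definition pbox (x0 : plane) (r : R) : set plane :=
  [set x | (`|x.1 - x0.1| <= r)%R /\ (`|x.2 - x0.2| <= r)%R].

Lemma pboxE x0 r : pbox x0 r =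
  `[(x0.1 - r)%R, (x0.1 + r)%R] `*` `[(x0.2 - r)%R, (x0.2 + r)%R].
Proof.
by apply/seteqP; split=> x; rewrite /pbox /= !in_itv/= !ler_norml => -[? ?]; split; lra.
Qed.

Lemma measurable_pbox x0 r : measurable (pbox x0 r).
Proof. by rewrite pboxE; apply: measurableX; exact: measurable_itv. Qed.

Lemma integral_le_line (a b a' b' : R) (f : R -> R) (F : R -> \bar R) :
  (a' <= a)%R -> (b <= b')%R ->
  leb.-integrable `[a, b] (EFin \o f) -> measurable_fun setT F -> (forall x, 0 <= F x) ->
  (forall x, (a <= x <= b)%R -> (f x)%:E <= F x) -> (forall x, (a <= x <= b)%R -> (0 <= f x)%R) ->
  (\int[leb]_(x in `[a, b]) f x)%:E <= \int[leb]_x F x.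
Proof.
move=> aa bb If mF F0 fF f0; rewrite /Rintegral fineK; last exact: integrable_fin_num.
apply: (@le_trans _ _ (\int[leb]_(x in `[a, b]) F x)).
  apply: ge0_le_integral => //.
  - exact: measurable_int If.
  - exact: measurable_funTS.
by apply: ge0_subset_integral => //.
Qed.

(* The four sides of the rectangle are chosen as lines on which the integral of
   [|g|^2] does not exceed its average. *)
Lemma mean_value_square (g : R[i] -> R[i]) (c : plane) (r : R) : (0 < r)%R ->
  (forall z, in_sq (c.1 +i* c.2) (2 * r)%R z -> cdiff g z) ->
  measurable_fun (pbox c (2 * r)%R) (fun x : plane => ((normc (g (x.1 +i* x.2)) ^+ 2)%R%:E : \bar R)) ->
  (normc (g (c.1 +i* c.2)) ^+ 2 * r ^+ 2)%:E <=
  128%:E * \int[area]_(x in pbox c (2 * r)%R) (normc (g (x.1 +i* x.2)) ^+ 2)%:E.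
Proof.
case: c => cx cy /= r0 dg mg.
set A := \int[area]_(x in _) _.
have A0 : 0 <= A by apply: integral_ge0 => x _; rewrite lee_fin sqr_ge0.
have [->|Afin] := eqVneq A +oo; first by rewrite gt0_muley ?leey// lte_fin.
have {}Afin : A \is a fin_num by rewrite ge0_fin_numE// lt_neqAle Afin leey.
rewrite -(fineK Afin) -EFinM lee_fin; set B := fine A.
have B0 : (0 <= B)%R by rewrite fine_ge0.
(* The square is holomorphic, so the L1 form of Cauchy's estimate for [G] is an L2 estimate for
   [g]. *)
pose G z := (g z ^+ 2)%R.
have dG z : in_sq (cx +i* cy) (2 * r)%R z -> cdiff G z.
  move=> hz; have [d hd] := cdiffM (dg z hz) (dg z hz).
  by exists d; apply: cder_near hd; exists 1%R => // w _; rewrite /G expr2.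
have nG z : normc (G z) = (normc (g z) ^+ 2)%R by rewrite /G normcX.
pose F := (fun x : plane => (normc (G (x.1 +i* x.2)))%:E) \_ (pbox (cx, cy) (2 * r)%R).
have mF : measurable_fun setT F.
  apply/(measurable_restrictT _ (measurable_pbox _ _)).
  by under eq_fun do rewrite nG.
have F0 x : 0 <= F x by rewrite /F patchE; case: ifP => // _; rewrite lee_fin normc_ge0.
have FA : \int[(leb \x leb)%E]_x F x = A.
  rewrite /A [RHS]integral_mkcond /sigma_finite_product.
  by apply: eq_integral => x _; rewrite /F !patchE; case: ifP => //; rewrite nG.
pose J y := \int[leb]_x F (x, y).
pose K x := \int[leb]_y F (x, y).
have J0 y : 0 <= J y by exact: integral_ge0.
have K0 x : 0 <= K x by exact: integral_ge0.
have mJ : measurable_fun setT J by exact: measurable_fun_fubini_tonelli_G.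
have mK : measurable_fun setT K by exact: measurable_fun_fubini_tonelli_F.
have JA : \int[leb]_y J y = A by rewrite -FA [RHS]fubini_tonelli2.
have KA : \int[leb]_y K y = A by rewrite -FA [RHS]fubini_tonelli1.
apply/ler_addgt0Pl => e e0.
(* The level must exceed the average strictly, hence the [e]. Four sides at level [N] in [cauchy_L1]
   give [32 * 4 * N * r = 128 * B + e]. *)
pose N := ((B + e / 128) / r)%R.
have Nr : (N * r = B + e / 128)%R by rewrite divfK// gt_eqF.
have pick (H : R -> \bar R) a : measurable_fun setT H -> (forall x, 0 <= H x) ->
    \int[leb]_x H x = A -> exists2 x, (a <= x <= a + r)%R & H x <= N%:E.
  move=> mH H0 HA; apply: exists_le_average => //; first exact: measurable_funTS.
  apply: (@le_lt_trans _ _ A).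
    by rewrite -HA; apply: ge0_subset_integral.
  by rewrite -(fineK Afin) Nr lte_fin -/B ltrDl divr_gt0.
(* Each side is sought in a strip at distance between [r] and [2 * r] from the centre: this gives
   margin [r] and sides of length at most [4 * r]. *)
have [x0 hx0 Kx0] := pick K (cx - 2 * r)%R mK K0 KA.
have [x1 hx1 Kx1] := pick K (cx + r)%R mK K0 KA.
have [y0 hy0 Jy0] := pick J (cy - 2 * r)%R mJ J0 JA.
have [y1 hy1 Jy1] := pick J (cy + r)%R mJ J0 JA.
have w4 : (x1 - x0 <= 4 * r)%R by clear -hx0 hx1 r0; lra.
have h4 : (y1 - y0 <= 4 * r)%R by clear -hy0 hy1 r0; lra.
have sub z : in_rect x0 x1 y0 y1 z -> in_sq (cx +i* cy) (2 * r)%R z.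
  by move=> [h1 h2]; split; move: h1 h2; rewrite /=; clear -hx0 hx1 hy0 hy1 r0; lra.
have mc : margin x0 x1 y0 y1 r (cx +i* cy).
  by split; rewrite /=; clear -hx0 hx1 hy0 hy1 r0; lra.
have main := cauchy_L1 r0 w4 h4 (fun z h => dG z (sub z h)) mc.
have x01 : (x0 <= x1)%R by clear -hx0 hx1 r0; lra.
have y01 : (y0 <= y1)%R by clear -hy0 hy1 r0; lra.
have [c1 c2 c3 c4] := bcont_sides x01 y01
  (fun z h => cdiff_ccont (dG z (sub z (proj1 h))) : ccont G z).
have FE x y : (x0 <= x <= x1)%R -> (y0 <= y <= y1)%R -> F (x, y) = (normc (G (x +i* y)))%:E.
  move=> hx hy; rewrite /F patchE ifT// inE; split; rewrite /= ler_norml;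
    clear -hx0 hx1 hy0 hy1 r0 hx hy; lra.
have y0y : (y0 <= y0 <= y1)%R by rewrite lexx.
have y1y : (y0 <= y1 <= y1)%R by rewrite lexx y01.
have x0x : (x0 <= x0 <= x1)%R by rewrite lexx.
have x1x : (x0 <= x1 <= x1)%R by rewrite lexx x01.
have s1 : (\int[leb]_(t in `[x0, x1]) normc (G (t +i* y0)) <= N)%R.
  rewrite -lee_fin; apply: le_trans Jy0.
  apply: integral_le_line (lexx _) (lexx _) (ccont_normc c1) _ _ _ _ => //.
  - exact: measurableT_comp mF (measurable_pair2 _).
  - by move=> x hx; rewrite FE.
  - by move=> x _; exact: normc_ge0.
have s2 : (\int[leb]_(t in `[x0, x1]) normc (G (t +i* y1)) <= N)%R.
  rewrite -lee_fin; apply: le_trans Jy1.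
  apply: integral_le_line (lexx _) (lexx _) (ccont_normc c2) _ _ _ _ => //.
  - exact: measurableT_comp mF (measurable_pair2 _).
  - by move=> x hx; rewrite FE.
  - by move=> x _; exact: normc_ge0.
have s3 : (\int[leb]_(t in `[y0, y1]) normc (G (x0 +i* t)) <= N)%R.
  rewrite -lee_fin; apply: le_trans Kx0.
  apply: integral_le_line (lexx _) (lexx _) (ccont_normc c3) _ _ _ _ => //.
  - exact: measurableT_comp mF (measurable_pair1 _).
  - by move=> x hx; rewrite FE.
  - by move=> x _; exact: normc_ge0.
have s4 : (\int[leb]_(t in `[y0, y1]) normc (G (x1 +i* t)) <= N)%R.
  rewrite -lee_fin; apply: le_trans Kx1.
  apply: integral_le_line (lexx _) (lexx _) (ccont_normc c4) _ _ _ _ => //.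
  - exact: measurableT_comp mF (measurable_pair1 _).
  - by move=> x hx; rewrite FE.
  - by move=> x _; exact: normc_ge0.
move: main; rewrite nG => main.
have : (normc (g (cx +i* cy)) ^+ 2 * r * r <= 32 * (N + N + N + N) * r)%R.
  by rewrite ler_pM2r//; apply: le_trans main _; clear -s1 s2 s3 s4; lra.
by rewrite -mulrA -expr2; move: Nr; clear; lra.
Qed.

End tonelli.

(** * The mean value inequality in several variables *)

Section polydisc_mean_value.
Context {R : realType}.
Local Open Scope complex_scope.
Local Notation normc := (@Normc.normc R).
Local Notation leb := (@lebesgue_measure R).
Local Notation plane := (measurableTypeR R * measurableTypeR R)%type.
Local Notation area := (sigma_finite_product leb leb).

Definition planeC (x : plane) : R[i] := x.1 +i* x.2.

Lemma tbox_cons n (x0 : plane) (t0 : n.-tuple plane) r x t :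
  tbox (tuple_cons (x0, t0)) r (tuple_cons (x, t)) <-> pbox x0 r x /\ tbox t0 r t.
Proof.
split=> [h|[h k] j].
  split; first by have := h ord0; rewrite /tuple_cons /= !tnth0.
  by move=> j; have := h (lift ord0 j); rewrite /tuple_cons /= !tnthS.
case: (unliftP ord0 j) => [j' ->|->]; first by rewrite /tuple_cons /= !tnthS; exact: k.
by rewrite /tuple_cons /= !tnth0.
Qed.

Section affine.
Variables (N : nat).
Implicit Types (w : 'rV[R[i]]_N).

(** Made for an induction on the number [n] of integrated coordinates with fixed ambient dimension
    [N]: frozen coordinates are absorbed into [w]. *)
Definition affine_point n w (v : 'I_n -> 'rV[R[i]]_N) (t : n.-tuple plane) :=
  w + \sum_(j < n) planeC (tnth t j) *: v j.

Lemma affine_point_cons n w (v : 'I_n.+1 -> 'rV[R[i]]_N) x t :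
  affine_point w v (tuple_cons (x, t)) =
  affine_point (w + planeC x *: v ord0) (fun j => v (lift ord0 j)) t.
Proof.
rewrite /affine_point big_ord_recl /tuple_cons /= tnth0 addrA; congr (_ + _).
by apply: eq_bigr => j _; rewrite tnthS.
Qed.

(** The one-variable inequality is applied in the first coordinate with the others frozen at [t0],
    then the induction hypothesis for each value of the first coordinate; Tonelli assembles the two.
    Each coordinate costs a factor [128 / r ^+ 2]. *)
Lemma affine_mean_value n (f : 'rV[R[i]]_N -> R[i]) (r : R) : 0 < r ->
  forall w (v : 'I_n -> 'rV[R[i]]_N) (t0 : n.-tuple plane),
  (forall t, tbox t0 (2 * r) t -> differentiable f (affine_point w v t)) ->
  measurable_fun (tbox t0 (2 * r))
    (fun t => (normc (f (affine_point w v t)) ^+ 2)%:E : \bar R) ->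
  ((normc (f (affine_point w v t0)) ^+ 2 * (r ^+ 2) ^+ n)%:E <= (128 ^+ n)%:E *
   \int[tuple_measure area n]_(t in tbox t0 (2 * r))
      (normc (f (affine_point w v t)) ^+ 2)%:E)%E.
Proof.
move=> r0; elim: n => [|n IH] w v t0 df mf.
  rewrite !expr0 mulr1 mul1e /=.
  have -> : t0 = [tuple] by apply/val_inj; case: t0 {df mf} => -[].
  rewrite integral_dirac//; last 2 first.
  - exact: measurable_tbox.
  - by have -> : [tuple] = t0 by apply/val_inj; case: t0 {df mf} => -[].
  by rewrite diracE mem_set ?mul1e// => -[].
case/tupleP: t0 df mf => x0 t0; rewrite -[ [tuple of _] ]/(tuple_cons (x0, t0)) => df mf.
set D := tbox _ _ in df mf *.
pose h t : \bar R := (normc (f (affine_point w v t)) ^+ 2)%:E.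
pose H := h \_ D.
have mD : measurable D by exact: measurable_tbox.
have mH : measurable_fun setT H by exact/(measurable_restrictT _ mD).
have H0 t : (0 <= H t)%E.
  by rewrite /H patchE; case: ifP => // _; rewrite lee_fin sqr_ge0.
rewrite (integral_mkcond D) -/H integral_tuple_cons//.
pose Phi x := (\int[tuple_measure area n]_t H (tuple_cons (x, t)))%E.
have mPhi : measurable_fun setT Phi.
  apply: (@measurable_fun_fubini_tonelli_F _ _ _ _ R (tuple_measure area n) (H \o @tuple_cons _ _ n)).
    by apply: measurableT_comp => //; exact: measurable_tuple_cons.
  by move=> x; exact: H0.
have Phi0 x : (0 <= Phi x)%E by apply: integral_ge0 => t _; exact: H0.
pose g a := f (affine_point w v (tuple_cons ((complex.Re a, complex.Im a) : plane, t0))).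
have gE (x : plane) : g (x.1 +i* x.2) = f (affine_point w v (tuple_cons (x, t0))).
  by case: x.
have t00 : tbox t0 (2 * r) t0.
  by move=> j; rewrite !subrr normr0; split; rewrite mulr_ge0// ltW.
have mP : measurable_fun (pbox x0 (2 * r))
    (fun x : plane => (normc (g (x.1 +i* x.2)) ^+ 2)%:E : \bar R).
  apply/(measurable_restrictT _ (measurable_pbox _ _)).
  rewrite (_ : _ \_ _ = fun x => H (tuple_cons (x, t0))).
    apply: measurableT_comp => //.
    exact: (measurableT_comp (@measurable_tuple_cons _ plane n) (measurable_pair2 _)).
  apply/funext => x; rewrite /H !patchE.
  case: ifPn; rewrite ?inE ?notin_setE => hx.
    by rewrite ifT ?gE// inE; apply/tbox_cons.
  by rewrite ifF//; apply/negbTE; rewrite notin_setE => /tbox_cons[].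
have outer := mean_value_square (g := g) (c := x0) r0 _ mP.
have {}outer : ((normc (g (x0.1 +i* x0.2)) ^+ 2 * r ^+ 2)%:E <=
    128%:E * \int[area]_(x in pbox x0 (2 * r)) (normc (g (x.1 +i* x.2)) ^+ 2)%:E)%E.
  apply: outer => a ha.
  pose u := affine_point w v (tuple_cons ((0, 0) : plane, t0)).
  have uE b : affine_point w v (tuple_cons ((complex.Re b, complex.Im b) : plane, t0)) =
      u + b *: v ord0.
    rewrite /u !affine_point_cons /affine_point {2}/planeC /= scale0r addr0 -[RHS]addrAC.
    by congr (_ + _ *: _ + _); case: b.
  have -> : g = fun b => f (u + b *: v ord0) by apply/funext => b; rewrite /g uE.
  eexists; apply: differentiable_line; rewrite -uE; apply: df.
  apply/tbox_cons; split => //; case/in_sqP: ha; rewrite /pbox /= !rcE /= => h1 h2.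
  by split.
have inner x : pbox x0 (2 * r) x ->
    ((normc (g (x.1 +i* x.2)) ^+ 2 * (r ^+ 2) ^+ n)%:E <= (128 ^+ n)%:E * Phi x)%E.
  move=> hx; rewrite gE affine_point_cons.
  have e t : f (affine_point (w + planeC x *: v ord0) (fun j => v (lift ord0 j)) t) =
      f (affine_point w v (tuple_cons (x, t))) by rewrite affine_point_cons.
  have PhiE : Phi x = (\int[tuple_measure area n]_(t in tbox t0 (2 * r))
      (normc (f (affine_point w v (tuple_cons (x, t)))) ^+ 2)%:E)%E.
    rewrite [RHS]integral_mkcond; apply: eq_integral => t _; rewrite /H !patchE.
    case: ifPn; rewrite ?inE ?notin_setE => ht.
      by case/tbox_cons: ht => _ ht; rewrite ifT ?inE.
    rewrite ifF//; apply/negbTE; rewrite notin_setE => ht'.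
    by apply: ht; apply/tbox_cons.
  rewrite PhiE; under eq_integral do rewrite -e.
  apply: IH => [t ht|]; first by rewrite -affine_point_cons; apply: df; apply/tbox_cons.
  under eq_fun do rewrite e.
  apply/(measurable_restrictT _ (measurable_tbox _ _)).
  rewrite (_ : _ \_ _ = fun t => H (tuple_cons (x, t))).
    apply: measurableT_comp => //.
    exact: (measurableT_comp (@measurable_tuple_cons _ plane n) (measurable_pair1 _)).
  apply/funext => t; rewrite /H !patchE.
  case: ifPn; rewrite ?inE ?notin_setE => ht.
    by rewrite ifT// inE; apply/tbox_cons.
  by rewrite ifF//; apply/negbTE; rewrite notin_setE => /tbox_cons[].
rewrite gE in outer.
have rn : 0 <= (r ^+ 2) ^+ n by rewrite exprn_ge0// exprn_ge0// ltW.
rewrite [(r ^+ 2) ^+ n.+1]exprS mulrA EFinM.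
apply: (le_trans (lee_wpmul2r _ outer)); first by rewrite lee_fin.
rewrite [128 ^+ n.+1]exprS EFinM -!muleA; apply: lee_wpmul2l; first by rewrite lee_fin.
rewrite muleC -ge0_integralZl//; last 2 first.
- exact: measurable_pbox.
- by move=> x _; rewrite lee_fin sqr_ge0.
rewrite -[leRHS]ge0_integralZl//; do ?[by rewrite lee_fin exprn_ge0|by move=> x _; exact: Phi0].
apply: (@le_trans _ _ (\int[area]_(x in pbox x0 (2 * r)) ((128 ^+ n)%:E * Phi x))%E).
  apply: ge0_le_integral => //.
  - exact: measurable_pbox.
  - by move=> x _; rewrite -EFinM lee_fin mulr_ge0// sqr_ge0.
  - exact: emeasurable_funM.
  - by apply: emeasurable_funM => //; exact: measurable_funTS.
  - by move=> x /inner; rewrite EFinM muleC.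
apply: ge0_subset_integral => //.
- exact: measurable_pbox.
- exact: emeasurable_funM.
- by move=> x _; rewrite mule_ge0// lee_fin exprn_ge0.
Qed.

End affine.

Lemma xyC_affine n : @xyC R n = affine_point 0 (fun j => delta_mx 0 j).
Proof.
apply/funext => t; rewrite /affine_point add0r [LHS]row_sum_delta.
by apply: eq_bigr => j _; rewrite mxE.
Qed.

End polydisc_mean_value.

(** * Convergence of complex sequences *)

Section complex_sequences.
Context {R : realType}.
Local Open Scope complex_scope.
Local Notation normc := (@Normc.normc R).
Implicit Types (u v : nat -> R[i]) (l : R[i]).

Definition ccvg u l := forall e : R, 0 < e ->
  exists N, forall k, (N <= k)%N -> normc (u k - l) < e.

Definition ccauchy u := forall e : R, 0 < e ->
  exists N, forall k k', (N <= k)%N -> (N <= k')%N -> normc (u k - u k') < e.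

(** The limit is the supremum of the eventual lower bounds, that is, the lower limit. *)
Lemma real_cauchy_cvg (u : nat -> R) :
  (forall e, 0 < e -> exists N, forall k k', (N <= k)%N -> (N <= k')%N -> `|u k - u k'| < e) ->
  exists l : R, forall e : R, 0 < e -> exists N, forall k, (N <= k)%N -> `|u k - l| < e.
Proof.
move=> h; pose S := [set x | exists N, forall k, (N <= k)%N -> x <= u k].
have bnd e : 0 < e -> exists N, (forall k, (N <= k)%N -> `|u k - u N| < e) /\
    S (u N - e) /\ ubound S (u N + e).
  move=> /h[N hN]; exists N; split=> [k Nk|]; first exact: hN.
  split.
    exists N => k Nk; have := hN k N Nk (leqnn _).
    by rewrite ltr_norml; move: (u k) (u N) e {hN} => a b e; lra.
  move=> x [N' hN']; have := hN' (maxn N N') (leq_maxr _ _).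
  have := hN (maxn N N') N (leq_maxl _ _) (leqnn _).
  by rewrite ltr_norml; move: (u _) (u N) e {hN} => a b e; lra.
exists (sup S) => e e0.
have e20 : 0 < e / 2 by lra.
have [N [h1 [h2 h3]]] := bnd _ e20; exists N => k /h1.
have l1 : u N - e / 2 <= sup S by apply: ub_le_sup => //; exists (u N + e / 2).
have l2 : sup S <= u N + e / 2 by apply: ge_sup => //; exists (u N - e / 2).
by rewrite !ltr_norml; clear -l1 l2; lra.
Qed.

Lemma ccauchy_cvg u : ccauchy u -> exists l, ccvg u l.
Proof.
move=> h.
have [a ha] : exists l : R, forall e : R, 0 < e -> exists N, forall k, (N <= k)%N ->
    `|complex.Re (u k) - l| < e.
  apply: real_cauchy_cvg => e /h[N hN]; exists N => k k' hk hk'.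
  by apply: le_lt_trans (hN k k' hk hk'); rewrite -ReN -ReD normc_Re.
have [b hb] : exists l : R, forall e : R, 0 < e -> exists N, forall k, (N <= k)%N ->
    `|complex.Im (u k) - l| < e.
  apply: real_cauchy_cvg => e /h[N hN]; exists N => k k' hk hk'.
  by apply: le_lt_trans (hN k k' hk hk'); rewrite -ImN -ImD normc_Im.
exists (a +i* b) => e e0; have e20 : 0 < e / 2 by lra.
have [N hN] := ha _ e20; have [N' hN'] := hb _ e20; exists (maxn N N') => k.
rewrite geq_max => /andP[/hN h1 /hN' h2].
by apply: le_lt_trans (normc_leReIm _) _; rewrite !rcE /=; lra.
Qed.

Lemma ccvg_le u l a (M : R) : ccvg u l ->
  (exists N, forall k, (N <= k)%N -> normc (u k - a) <= M) -> normc (l - a) <= M.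
Proof.
move=> h [N hN]; apply/ler_addgt0Pl => e /h[N' hN'].
have := hN _ (leq_maxl N N'); have := hN' _ (leq_maxr N N').
have := normc_trians l (u (maxn N N')) a; rewrite (normcBC l (u _)); lra.
Qed.

Lemma ccvg_uniq u l l' : ccvg u l -> ccvg u l' -> l = l'.
Proof.
move=> h h'; apply/eqP; rewrite -subr_eq0 -normc_eq0 eq_le normc_ge0 andbT.
apply/ler_addgt0Pl => e e0; rewrite addr0; apply: (ccvg_le h).
by have [N hN] := h' e e0; exists N => k /hN /ltW.
Qed.

Lemma ccvgD u v l l' : ccvg u l -> ccvg v l' -> ccvg (fun k => u k + v k) (l + l').
Proof.
move=> h h' e e0; have e20 : 0 < e / 2 by lra.
have [N hN] := h _ e20; have [N' hN'] := h' _ e20; exists (maxn N N') => k.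
rewrite geq_max => /andP[/hN h1 /hN' h2].
have := normcD (u k - l) (v k - l'); rewrite (_ : u k - l + _ = u k + v k - (l + l')); last by ring.
lra.
Qed.

Lemma ccvgZ a u l : ccvg u l -> ccvg (fun k => a * u k) (a * l).
Proof.
move=> h e e0; have a0 := normc_ge0 a.
have a1 : 0 < normc a + 1 by lra.
have [N hN] := h _ (divr_gt0 e0 a1); exists N => k /hN; rewrite ltr_pdivlMr//.
rewrite -mulrBr normcM; have := normc_ge0 (u k - l).
by move: (normc _) (normc _) a0 => x y; clear; nra.
Qed.

Lemma eq_ccvg u v l : u =1 v -> ccvg u l -> ccvg v l.
Proof. by move=> uv h e /h[N hN]; exists N => k /hN; rewrite uv. Qed.

Lemma ccvgJ u l : ccvg u l -> ccvg (fun k => (u k)^*) l^*.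
Proof. by move=> h e /h[N hN]; exists N => k /hN; rewrite -rmorphB normcJ. Qed.

End complex_sequences.

(** * Local control of values and differentials by the L2 norm *)

Section local_estimates.
Context {R : realType} {n : nat}.
Local Open Scope complex_scope.
Local Notation normc := (@Normc.normc R).
Local Notation Cn := 'rV[R[i]]_n.
Local Notation plane := (measurableTypeR R * measurableTypeR R)%type.
Variable Om : set Cn.
Hypothesis oOm : open Om.
Implicit Types (z w v : Cn) (f : Cn -> R[i]).

Lemma hol_continuous f z : differentiable f z -> forall e : R, 0 < e ->
  exists2 r : R, 0 < r & forall w, vn (w - z) < r -> normc (f w - f z) < e.
Proof.
move=> df e e0; have /differentiable_fder h := df.
have [K K0 hK] := bounded_linear (cdif_linear f z).
have [r r0 hr] := h 1 ltr01.
exists (Num.min r (e / (K + 1))) => [|w].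
  by rewrite lt_min r0 divr_gt0//; clear -K0; lra.
rewrite lt_min => /andP[/hr]; rewrite [z + _]addrC subrK => h1.
rewrite ltr_pdivlMr; last by clear -K0; lra.
move=> h2; have := normcD (f w - f z - cdif f z (w - z)) (cdif f z (w - z)).
rewrite subrK; have := hK (w - z); clear -h1 h2; lra.
Qed.

Lemma measurable_hol (g : Cn -> R) :
  (forall z, Om z -> forall e : R, 0 < e -> exists2 r : R, 0 < r &
     forall w, vn (w - z) < r -> `|g w - g z| < e) ->
  measurable_fun (@xyC R n @^-1` Om) (fun t => g (xyC t)).
Proof. exact: measurable_fun_xyC. Qed.

Lemma measurable_normc2 f : holomorphic_fun_on Om f ->
  measurable_fun (@xyC R n @^-1` Om) (fun t => (normc (f (xyC t)) ^+ 2)%:E : \bar R).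
Proof.
move=> hf; apply/measurable_EFinP; apply: measurable_funX.
apply: (@measurable_hol (fun z => normc (f z))) => z Oz e e0.
have [r r0 hr] := hol_continuous (hf z Oz) e0; exists r => // w /hr h.
have := normc_lower (f w) (f z); have := normc_lower (f z) (f w).
by rewrite (normcBC (f z)) ltr_norml; clear -h; lra.
Qed.

Lemma mOm : measurable (@xyC R n @^-1` Om).
Proof. exact: measurable_xyC. Qed.

(** The mean value inequality on a box around [w]. What matters is that [r] and [c] depend only on
    [z] and [Om], neither on [f] nor on [w] near [z]. *)
Lemma eval_bound z : Om z -> exists r c : R, [/\ 0 < r, 0 < c,
  forall w, vn (w - z) < r -> Om w &
  forall f (M : R), holomorphic_fun_on Om f -> 0 <= M -> (L2normsq Om f <= (M ^+ 2)%:E)%E ->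
    forall w, vn (w - z) < r -> normc (f w) <= c * M].
Proof.
move=> Oz; have [s s0 hs] := open_vn oOm Oz.
(* The box of half-side [2 * r] around [w] lies within [4 * r] of [w], and [w] within [r] of [z]. *)
pose r := s / 5; have r0 : 0 < r by rewrite /r; lra.
pose q := (128 ^+ n / (r ^+ 2) ^+ n : R).
have rn : 0 < (r ^+ 2) ^+ n by rewrite !exprn_gt0.
have q0 : 0 < q by rewrite divr_gt0// exprn_gt0.
exists r, (Num.sqrt q); split => //; first by rewrite sqrtr_gt0.
  by move=> w h; apply: hs; apply: lt_trans h _; rewrite /r; lra.
move=> f M hf M0 fM w wz.
pose t0 : n.-tuple plane := [tuple (complex.Re (w 0 j), complex.Im (w 0 j)) | j < n].
have wE : xyC t0 = w.
  by apply/rowP => j; rewrite mxE tnth_mktuple /=; case: (w 0 j).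
have sub : tbox t0 (2 * r) `<=` @xyC R n @^-1` Om.
  move=> t ht; apply: hs.
  have h1 : vn (xyC t - w) <= 4 * r.
    apply: vn_le => [|j]; first by clear -r0; lra.
    have [] := ht j; rewrite tnth_mktuple /= => h1 h2.
    rewrite !mxE; apply: le_trans (normc_leReIm _) _; rewrite !rcE /=.
    by clear -h1 h2; lra.
  have := vnD (xyC t - w) (w - z); rewrite addrA subrK.
  by move: h1 wz; rewrite /r; clear; lra.
have Ef : @affine_point R n n 0 (fun j => delta_mx 0 j) = @xyC R n by rewrite xyC_affine.
have := @affine_mean_value R n n f r r0 0 (fun j => delta_mx 0 j) t0; rewrite Ef wE.
have mt : measurable_fun (tbox t0 (2 * r)) (fun t => (normc (f (xyC t)) ^+ 2)%:E : \bar R).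
  by apply: measurable_funS (measurable_normc2 hf) => //; exact: mOm.
move=> /(_ (fun t ht => hf _ (sub t ht)) mt) h.
have : ((normc (f w) ^+ 2 * (r ^+ 2) ^+ n)%:E <= (128 ^+ n)%:E * (M ^+ 2)%:E)%E.
  apply: le_trans h _; apply: lee_wpmul2l; first by rewrite lee_fin exprn_ge0.
  apply: le_trans fM; apply: ge0_subset_integral => //.
  - exact: measurable_tbox.
  - exact: mOm.
  - exact: measurable_normc2.
  - by move=> t _; rewrite lee_fin sqr_ge0.
rewrite -EFinM lee_fin -ler_pdivlMr// mulrAC -/q => h2.
rewrite -(ler_pXn2r (ltn0Sn 1)) ?nnegrE ?normc_ge0 ?mulr_ge0 ?sqrtr_ge0//.
by rewrite exprMn sqr_sqrtr// ltW.
Qed.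

Lemma line_cdiff f z v b : differentiable f (z + b *: v) -> cdiff (fun a => f (z + a *: v)) b.
Proof. by move=> /differentiable_line h; eexists; exact: h. Qed.

(** [cauchy_taylor] is applied to the slices [a |-> f (w + a *: u)] with [vn u = 1], whose constants
    are independent of [u]; a general [v] follows by homogeneity. *)
Lemma local_bounds z : Om z -> exists r c : R, [/\ 0 < r, 0 < c,
  forall w, vn (w - z) < r -> Om w &
  forall f (M : R), holomorphic_fun_on Om f -> 0 <= M -> (L2normsq Om f <= (M ^+ 2)%:E)%E ->
    forall w, vn (w - z) < r -> [/\ normc (f w) <= c * M,
      forall v, normc (cdif f w v) <= c * M * vn v &
      forall v, vn v < r -> normc (f (w + v) - f w - cdif f w v) <= c * M * vn v ^+ 2]].
Proof.
move=> /eval_bound[r [c [r0 c0 hO he]]].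
(* A parameter in the square of half-side [2 * s] has modulus at most [4 * s]; with [vn (w - z) < s]
   the slice remains within [5 * s < r] of [z]. *)
pose s := r / 8; have s0 : 0 < s by rewrite /s; lra.
pose K := taylor_bound s.
have K0 : 0 < K.
  have i0 : 0 < s^-1 by rewrite invr_gt0.
  have S0 : 0 < 4 * (4 * s + 4 * s) by clear -s0; lra.
  apply: ltr_wpDl => //.
  do ?[exact: (ltW i0)|exact: (ltW S0)|exact: ler0n|apply: addr_ge0|apply: mulr_ge0].
exists s, (c * (K + 1)); split => //.
- by rewrite mulr_gt0//; clear -K0; lra.
- by move=> w h; apply: hO; move: h; rewrite /s; clear -r0; lra.
move=> f M hf M0 fM w wz.
have wr : vn (w - z) < r by move: wz; rewrite /s; clear -r0; lra.
have bw := he f M hf M0 fM w wr.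
have cM0 : 0 <= c * M by rewrite mulr_ge0// ltW.
have unit u : vn u = 1 ->
    normc (cdif f w u) <= K * (c * M) /\
    forall b, in_sq 0 s b -> normc (f (w + b *: u) - f w - cdif f w u * b) <=
      K * (c * M) * normc b ^+ 2.
  move=> u1.
  have sub a : in_sq 0 (2 * s) a -> vn (w + a *: u - z) < r.
    move=> /in_sq_normc; rewrite subr0 => ha.
    rewrite addrAC; have := vnD (w - z) (a *: u); rewrite vnZ u1 mulr1.
    by move: wz ha; rewrite /s; clear -r0; lra.
  have := @cauchy_taylor R s 0 (fun a => f (w + a *: u)) (c * M) s0.
  move=> /(_ (fun a ha => line_cdiff (hf _ (hO _ (sub a ha))))
            (fun a ha => he f M hf M0 fM _ (sub a ha)) 0 (cdif f w u)).
  have h00 : in_sq 0 (s / 2) (0 : R[i]).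
    by apply/in_sqP; rewrite subrr /= normr0; split; clear -s0; lra.
  have hd : cder (fun a => f (w + a *: u)) 0 (cdif f w u).
    have := @differentiable_line R n f w u 0; rewrite scale0r addr0; apply.
    exact/hf/hO.
  move=> /(_ h00 hd)[h1 h2]; split => // b /h2.
  by rewrite scale0r addr0 subr0.
have scal v : v != 0 -> exists u, vn u = 1 /\ v = (vn v)%:C *: u.
  move=> v0; have nv := vn_gt0 v0.
  exists ((vn v)^-1%:C *: v); rewrite vnZ normcR ger0_norm ?invr_ge0 ?vn_ge0// mulVf ?gt_eqF//.
  by split => //; rewrite scalerA -rmorphM divff ?gt_eqF// scale1r.
have Kc : K * (c * M) <= c * (K + 1) * M by rewrite mulrCA mulrA; clear -cM0; lra.
split.
- by apply: le_trans bw _; clear -cM0 K0; nra.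
- move=> v; have [->|v0] := eqVneq v 0; first by rewrite cdif0v normc0 vn0 mulr0.
  have [u [u1 ->]] := scal v v0; have [h1 _] := unit u u1.
  rewrite cdifZv normcM vnZ u1 mulr1 mulrC ler_wpM2r ?normc_ge0//.
  exact: le_trans h1 Kc.
- move=> v vs; have [->|v0] := eqVneq v 0.
    by rewrite addr0 subrr cdif0v subrr normc0 vn0 expr0n mulr0.
  have [u [u1 vE]] := scal v v0; have [_ h2] := unit u u1.
  have nv : normc (vn v)%:C = vn v by rewrite normcR ger0_norm ?vn_ge0.
  have := h2 (vn v)%:C; rewrite -vE nv => h3.
  have -> : cdif f w v = cdif f w u * (vn v)%:C by rewrite {1}vE cdifZv mulrC.
  apply: le_trans (h3 _) _; last by rewrite ler_wpM2r ?sqr_ge0.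
  by apply: normc_in_sq; rewrite subr0 nv ltW.
Qed.

End local_estimates.

(** * Expansion of the differential along a line *)

Section second_order.
Context {R : realType} {n : nat}.
Local Open Scope complex_scope.
Local Notation normc := (@Normc.normc R).
Local Notation Cn := 'rV[R[i]]_n.
Implicit Types (Om : set Cn) (z w v X : Cn) (f : Cn -> R[i]).

Lemma taylor_bound_gt0 (s : R) : 0 < s -> 0 < taylor_bound s.
Proof.
move=> s0; have i0 : 0 < s^-1 by rewrite invr_gt0.
have S0 : 0 < 4 * (4 * s + 4 * s) by clear -s0; lra.
apply: ltr_wpDl => //.
do ?[exact: (ltW i0)|exact: (ltW S0)|exact: ler0n|apply: addr_ge0|apply: mulr_ge0].
Qed.

Lemma small_div (t e : R) : 0 < t -> 0 < e ->
  exists N, forall k, (N <= k)%N -> t / k.+1%:R < e.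
Proof.
move=> t0 e0; exists (Num.truncn (t / e)) => k hk.
rewrite ltr_pdivrMr// mulrC -ltr_pdivrMr//.
apply: lt_le_trans (truncnS_gt _) _; rewrite ler_nat; exact: hk.
Qed.

(** The map [a |-> cdif f (z + a *: X) v] is not yet known to be holomorphic. It is a uniform limit
    of the difference quotients [q k], which are, and the estimates of [cauchy_taylor] for [q k]
    pass to the limit with [d2] the limit of the derivatives. *)
Lemma second_bounds Om z X v : open Om -> Om z -> exists r c : R, [/\ 0 < r, 0 <= c &
  forall f (M : R), holomorphic_fun_on Om f -> 0 <= M -> (L2normsq Om f <= (M ^+ 2)%:E)%E ->
    exists2 d2, normc d2 <= c * M & forall a, normc a < r ->
      normc (cdif f (z + a *: X) v - cdif f z v - d2 * a) <= c * M * normc a ^+ 2].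
Proof.
move=> oOm Oz; have [r [c [r0 c0 hO hb]]] := local_bounds oOm Oz.
have X0 := vn_ge0 X; have v0 := vn_ge0 v.
(* With [t] below, displacements along [X] and along [v] each stay below [r / 2], so that every
   point occurring in [q k] lies in the ball of radius [r] around [z]. *)
pose s := r / (8 * (vn X + 1)).
have s0 : 0 < s by rewrite divr_gt0//; clear -X0; lra.
have sX : s * (8 * (vn X + 1)) = r by rewrite divfK// gt_eqF//; clear -X0; lra.
pose t := r / (2 * (vn v + 1)).
have t0 : 0 < t by rewrite divr_gt0//; clear -v0; lra.
have tv : t * (2 * (vn v + 1)) = r by rewrite divfK// gt_eqF//; clear -v0; lra.
pose T := taylor_bound s; have T0 := taylor_bound_gt0 s0.
pose B := c * (vn v + vn v ^+ 2 * t).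
have B0 : 0 <= B by rewrite mulr_ge0 ?(ltW c0)// addr_ge0// mulr_ge0 ?sqr_ge0// ltW.
exists s, (T * B); split => //; first by rewrite mulr_ge0// ltW.
move=> f M hf M0 fM.
have {}hb := hb f M hf M0 fM.
have near a : in_sq 0 (2 * s) a -> vn (z + a *: X - z) < r / 2.
  move=> /in_sq_normc; rewrite subr0 addrC addKr vnZ => ha.
  apply: (@le_lt_trans _ _ (2 * (2 * s) * vn X)); first by rewrite ler_wpM2r.
  by rewrite -sX; clear -s0 X0; nra.
pose sk (k : nat) := t / k.+1%:R.
have sk0 k : 0 < sk k by rewrite divr_gt0.
have skt k : sk k <= t by rewrite ler_pdivrMr// ler_peMr ?ler1n// ltW.
pose h a := cdif f (z + a *: X) v.
pose q k a := (f (z + a *: X + (sk k)%:C *: v) - f (z + a *: X)) * (sk k)^-1%:C.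
have skv k : vn ((sk k)%:C *: v) < r / 2.
  rewrite vnZ normcR gtr0_norm// -tv.
  apply: (@le_lt_trans _ _ (t * vn v)); first by rewrite ler_wpM2r.
  by clear -t0 v0; nra.
have qh k a : in_sq 0 (2 * s) a -> normc (q k a - h a) <= c * M * vn v ^+ 2 * sk k.
  move=> /near ha; have har : vn (z + a *: X - z) < r by clear -ha r0; lra.
  have [_ _ /(_ ((sk k)%:C *: v))] := hb _ har.
  have hs : vn ((sk k)%:C *: v) < r by have := skv k; clear -r0; lra.
  move=> /(_ hs); rewrite cdifZv vnZ normcR gtr0_norm// exprMn => h1.
  have -> : q k a - h a = (f (z + a *: X + (sk k)%:C *: v) - f (z + a *: X) - (sk k)%:C * h a) *
      (sk k)^-1%:C.
    rewrite /q [RHS]mulrBl; congr (_ - _).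
    by rewrite mulrAC -rmorphM divff ?gt_eqF// mul1r.
  have inn : normc (sk k)^-1%:C = (sk k)^-1 by rewrite normcR gtr0_norm ?invr_gt0.
  rewrite normcM inn ler_pdivrMr//.
  by apply: le_trans h1 _; rewrite le_eqVlt; apply/orP; left; apply/eqP; ring.
have hbd a : in_sq 0 (2 * s) a -> normc (h a) <= c * M * vn v.
  move=> /near ha; have har : vn (z + a *: X - z) < r by clear -ha r0; lra.
  by have [_ + _] := hb _ har; apply.
have qbd k a : in_sq 0 (2 * s) a -> normc (q k a) <= B * M.
  move=> ha; have h1 := qh k a ha; have h2 := hbd a ha.
  have := normcD (q k a - h a) (h a); rewrite subrK => h3.
  have h4 : c * M * vn v ^+ 2 * sk k <= c * M * vn v ^+ 2 * t.
    by rewrite ler_wpM2l// mulr_ge0 ?sqr_ge0// mulr_ge0// ltW.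
  by rewrite /B; clear -h1 h2 h3 h4; lra.
have dq k a : in_sq 0 (2 * s) a -> cdiff (q k) a.
  move=> /near ha; apply: cdiffM; last exact: cdiff_cst.
  apply: cdiffB.
    have [d hd] : cdiff (fun a => f (z + (sk k)%:C *: v + a *: X)) a.
      apply: line_cdiff; apply: hf; apply: hO.
      rewrite (_ : _ - z = z + a *: X - z + (sk k)%:C *: v).
        by apply: le_lt_trans (vnD _ _) _; have := skv k; clear -ha; lra.
      by rewrite [RHS]addrAC; congr (_ - _); rewrite addrAC.
    by exists d; apply: cder_near hd; exists 1 => // w _; rewrite addrAC.
  apply: line_cdiff; apply: hf; apply: hO; clear -ha r0; lra.
have in0 : in_sq 0 (s / 2) (0 : R[i]).
  by apply/in_sqP; rewrite subrr /= normr0; split; clear -s0; lra.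
have in02 : in_sq 0 (2 * s) (0 : R[i]) by apply: in_sqS in0; clear -s0; lra.
have /choice[d hd] : forall k, exists d, cder (q k) 0 d := fun k => dq k 0 in02.
have tq k := cauchy_taylor s0 (dq k) (qbd k) in0 (hd k).
have cE e : 0 < e -> exists N, forall k, (N <= k)%N -> c * M * vn v ^+ 2 * sk k < e.
  move=> e0; pose E := c * M * vn v ^+ 2.
  have E0 : 0 <= E by rewrite mulr_ge0 ?sqr_ge0// mulr_ge0// ltW.
  have E1 : 0 < E + 1 by clear -E0; lra.
  have [N hN] := small_div t0 (divr_gt0 e0 E1); exists N => k /hN.
  rewrite -/(sk k) ltr_pdivlMr//; have := sk0 k; rewrite -/E; clear; nra.
(* The difference [q k - q l] is uniformly small because both are close to [h], so its derivative at
   0 is small by [cauchy_taylor]. *)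
have [d2 hd2] : exists l, ccvg d l.
  apply: ccauchy_cvg => e e0.
  have [N hN] := cE (e / (2 * T + 1)) ltac:(apply: divr_gt0; rewrite /T; clear -T0 e0; lra).
  exists N => k l /hN hk /hN hl.
  set E1 := c * M * vn v ^+ 2 * sk k in hk; set E2 := c * M * vn v ^+ 2 * sk l in hl.
  have bkl a : in_sq 0 (2 * s) a -> normc (q k a - q l a) <= E1 + E2.
    move=> ha; have := normc_trians (q k a) (h a) (q l a).
    rewrite (normcBC (h a)); have := qh k a ha; have := qh l a ha.
    by rewrite -/E1 -/E2; clear; lra.
  have dkl : cder (fun a => q k a - q l a) 0 (d k - d l).
    have := cderD (hd k) (cderM (cder_cst (-1) 0) (hd l)).
    rewrite mul0r add0r mulN1r; apply: cder_near; exists 1 => // w _.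
    by rewrite mulN1r.
  have [h1 _] := cauchy_taylor s0 (fun a ha => cdiffB (dq k a ha) (dq l a ha)) bkl in0 dkl.
  apply: le_lt_trans h1 _; rewrite -/T.
  have T2 : 0 < 2 * T + 1 by rewrite /T; clear -T0; lra.
  move: hk hl; rewrite !ltr_pdivlMr// => hk hl.
  have E10 : 0 <= E1 by rewrite mulr_ge0 ?(ltW (sk0 _))// mulr_ge0 ?sqr_ge0// mulr_ge0// ltW.
  have E20 : 0 <= E2 by rewrite mulr_ge0 ?(ltW (sk0 _))// mulr_ge0 ?sqr_ge0// mulr_ge0// ltW.
  by clear -hk hl E10 E20; lra.
have qcvg a : in_sq 0 (2 * s) a -> ccvg (q ^~ a) (h a).
  move=> ha e /cE[N hN]; exists N => k /hN; apply: le_lt_trans; exact: qh.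
exists d2.
  rewrite -[d2]subr0; apply: (ccvg_le hd2); exists 0%N => k _; rewrite subr0.
  by have [+ _] := tq k; rewrite mulrA.
move=> a ha; rewrite -[X in normc X]subr0.
have ina : in_sq 0 s a by apply: normc_in_sq; rewrite subr0 ltW.
have ina2 : in_sq 0 (2 * s) a by apply: in_sqS ina; clear -s0; lra.
have -> : cdif f z v = h 0 by rewrite /h scale0r addr0.
have cv := ccvgD (ccvgD (qcvg a ina2) (ccvgZ (-1) (qcvg 0 in02))) (ccvgZ (- a) hd2).
have -> : cdif f (z + a *: X) v - h 0 - d2 * a = h a + -1 * h 0 + - a * d2.
  by rewrite -/(h a); ring.
apply: (ccvg_le cv); exists 0%N => k _.
have [_ /(_ a ina)] := tq k; rewrite subr0 -mulrA.
rewrite (_ : _ + _ - 0 = q k a - q k 0 - d k * a); last by ring.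
by rewrite -/T !mulrA.
Qed.

End second_order.

(** * Completeness of the Bergman space *)

Section completeness.
Context {R : realType} {n : nat}.
Local Open Scope complex_scope.
Local Notation normc := (@Normc.normc R).
Local Notation Cn := 'rV[R[i]]_n.
Variable Om : set Cn.
Hypothesis oOm : open Om.
Implicit Types (z w v X : Cn) (f g : Cn -> R[i]).

Lemma hol_add f g : holomorphic_fun_on Om f -> holomorphic_fun_on Om g ->
  holomorphic_fun_on Om (fun z => f z + g z).
Proof. by move=> hf hg z Oz; apply: differentiableD; [exact: hf|exact: hg]. Qed.

Lemma hol_scale a f : holomorphic_fun_on Om f -> holomorphic_fun_on Om (fun z => a * f z).
Proof. by move=> hf z Oz; apply: (differentiableZ a (hf z Oz)). Qed.

Lemma hol_sub f g : holomorphic_fun_on Om f -> holomorphic_fun_on Om g ->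
  holomorphic_fun_on Om (fun z => f z - g z).
Proof. by move=> hf hg z Oz; apply: differentiableB; [exact: hf|exact: hg]. Qed.

Lemma L2_ge0 f : (0 <= L2normsq Om f)%E.
Proof. by apply: integral_ge0 => t _; rewrite lee_fin sqr_ge0. Qed.

Lemma L2_scale a f : holomorphic_fun_on Om f ->
  L2normsq Om (fun z => a * f z) = ((normc a ^+ 2)%:E * L2normsq Om f)%E.
Proof.
move=> hf; rewrite /L2normsq -ge0_integralZl//.
- by apply: eq_integral => t _; rewrite normcM exprMn EFinM.
- exact: mOm.
- exact: measurable_normc2.
- by move=> t _; rewrite lee_fin sqr_ge0.
- by rewrite lee_fin sqr_ge0.
Qed.

(** From [|a + b|^2 <= 2 |a|^2 + 2 |b|^2]. It serves as triangle inequality in the extended reals,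
    before an inner product is at hand. *)
Lemma L2_add f g : holomorphic_fun_on Om f -> holomorphic_fun_on Om g ->
  (L2normsq Om (fun z => f z + g z)%R <= 2%:E * L2normsq Om f + 2%:E * L2normsq Om g)%E.
Proof.
move=> hf hg; have mO := mOm oOm.
have mf := measurable_normc2 oOm hf; have mg := measurable_normc2 oOm hg.
have p0 (h : Cn -> R[i]) (t : n.-tuple (measurableTypeR R * measurableTypeR R)) :
  (0 <= (normc (h (xyC t)) ^+ 2)%:E)%E by rewrite lee_fin sqr_ge0.
rewrite /L2normsq -!ge0_integralZl//; do ?[by move=> t _; exact: p0].
rewrite -ge0_integralD//; last 4 first.
- by move=> t _; rewrite mule_ge0// p0.
- exact: emeasurable_funM.
- by move=> t _; rewrite mule_ge0// p0.
- exact: emeasurable_funM.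
apply: ge0_le_integral => //; do ?[by move=> t _; rewrite lee_fin sqr_ge0].
- exact: (measurable_normc2 oOm (hol_add hf hg)).
- by apply: emeasurable_funD; exact: emeasurable_funM.
- move=> t _; rewrite -!EFinM -EFinD lee_fin.
  have h := normcD (f (xyC t)) (g (xyC t)).
  have h0 := normc_ge0 (f (xyC t) + g (xyC t)).
  apply: (@le_trans _ _ ((normc (f (xyC t)) + normc (g (xyC t))) ^+ 2)).
    by rewrite ler_pXn2r ?nnegrE// addr_ge0 ?normc_ge0.
  by have := sqr_ge0 (normc (f (xyC t)) - normc (g (xyC t))); clear; lra.
Qed.

Lemma ccvg_normc2 (u : nat -> R[i]) l : ccvg u l ->
  ((normc (u k) ^+ 2)%:E @[k --> \oo] --> (normc l ^+ 2)%:E)%E.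
Proof.
move=> h; apply: cvg_EFin; first exact: nearW.
have c1 : normc (u k) @[k --> \oo] --> normc l.
  apply/cvgrPdist_lt => e /h[N hN]; exists N => // k /= /hN h1.
  have := normc_lower (u k) l; have := normc_lower l (u k).
  by rewrite (normcBC l) ltr_norml; clear -h1; lra.
rewrite expr2; under eq_fun do rewrite expr2.
exact: cvgM.
Qed.

Lemma cdifB f g z v : differentiable f z -> differentiable g z ->
  cdif (fun z => f z - g z) z v = cdif f z v - cdif g z v.
Proof.
move=> df dg; rewrite !cdifE.
by have := diffB df dg => /(congr1 (fun h => h v)).
Qed.

(** By [local_bounds] an L2-Cauchy sequence converges pointwise together with its differentials. The
    limit is holomorphic because the quadratic remainder bounds pass to the limit, and convergence
    in norm follows from Fatou's lemma. *)
Lemma bergman_complete (u : nat -> Cn -> R[i]) :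
  (forall k, bergman_space Om (u k)) ->
  (forall e : R, 0 < e -> exists N, forall k l, (N <= k)%N -> (N <= l)%N ->
     (L2normsq Om (fun z => u k z - u l z)%R <= (e ^+ 2)%:E)%E) ->
  exists f, [/\ bergman_space Om f,
    forall e : R, 0 < e -> exists N, forall k, (N <= k)%N ->
     (L2normsq Om (fun z => u k z - f z)%R <= (e ^+ 2)%:E)%E,
    forall z, Om z -> ccvg (u ^~ z) (f z) &
    forall z v, Om z -> ccvg (fun k => cdif (u k) z v) (cdif f z v)].
Proof.
move=> hu cu; have hol k : holomorphic_fun_on Om (u k) by case: (hu k).
have /choice[f hf] : forall z, exists l, Om z -> ccvg (u ^~ z) l.
  move=> z; have [Oz|] := pselect (Om z); last by move=> nO; exists 0 => /nO.
  have [r [c [r0 c0 hO hb]]] := local_bounds oOm Oz.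
  suff /ccauchy_cvg[l hl] : ccauchy (u ^~ z) by exists l.
  move=> e e0; have [N hN] := cu (e / (2 * c)) ltac:(rewrite divr_gt0// mulr_gt0//).
  exists N => k l hk hl.
  have E0 : 0 <= e / (2 * c) by rewrite divr_ge0 ?mulr_ge0 ?ltW.
  have [+ _ _] := hb _ _ (hol_sub (hol k) (hol l)) E0 (hN k l hk hl) z ltac:(by rewrite subrr vn0).
  move=> /le_lt_trans; apply; rewrite mulrA ltr_pdivrMr ?mulr_gt0//; have := mulr_gt0 c0 e0; lra.
have /choice[L hL] : forall z, exists L : Cn -> R[i], Om z -> forall v, ccvg (fun k => cdif (u k) z v) (L v).
  move=> z; have [Oz|] := pselect (Om z); last by move=> nO; exists (fun=> 0) => /nO.
  have [r [c [r0 c0 hO hb]]] := local_bounds oOm Oz.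
  suff /choice[L hL] : forall v, exists l, ccvg (fun k => cdif (u k) z v) l by exists L.
  move=> v; apply: ccauchy_cvg => e e0; have v0 := vn_ge0 v.
  pose q := 2 * c * (vn v + 1).
  have q0 : 0 < q by rewrite !mulr_gt0//; clear -v0; lra.
  have [N hN] := cu (e / q) ltac:(exact: divr_gt0).
  exists N => k l hk hl.
  have E0 : 0 <= e / q by rewrite divr_ge0 ?ltW.
  have [_ /(_ v) + _] := hb _ _ (hol_sub (hol k) (hol l)) E0 (hN k l hk hl) z ltac:(by rewrite subrr vn0).
  rewrite (cdifB v (hol k z Oz) (hol l z Oz)).
  move=> /le_lt_trans; apply; rewrite mulrAC mulrA ltr_pdivrMr// /q.
  have p := mulr_gt0 c0 e0; have := mulr_ge0 (ltW p) v0; move: p; clear; lra.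
have [N0 hN0] := cu 1 ltr01.
have [M M0 hM] : exists2 M : R, 0 <= M & forall k, (N0 <= k)%N -> (L2normsq Om (u k) <= (M ^+ 2)%:E)%E.
  have [_ fin0] := hu N0.
  have f0 : L2normsq Om (u N0) \is a fin_num by rewrite ge0_fin_numE// L2_ge0.
  pose B := 2 + 2 * fine (L2normsq Om (u N0)).
  have B0 : 0 <= B by rewrite addr_ge0// mulr_ge0// fine_ge0// L2_ge0.
  exists (Num.sqrt B); rewrite ?sqrtr_ge0// sqr_sqrtr// => k hk.
  have := L2_add (hol_sub (hol k) (hol N0)) (hol N0).
  under [X in L2normsq Om X]eq_fun do rewrite subrK.
  have -> : B%:E = (2%:E + 2%:E * L2normsq Om (u N0))%E.
    by rewrite -[in RHS](fineK f0) -EFinM -EFinD.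
  move/le_trans; apply; apply: leeD2r.
  rewrite -[leRHS]mule1; apply: lee_wpmul2l; first by rewrite lee_fin.
  by have := hN0 k N0 hk (leqnn _); rewrite expr1n.
(* The bound [c * M * vn v ^+ 2] for the remainder is common to all [u k] with [N0 <= k], so it
   holds for the limit. *)
have df z : Om z -> differentiable f z /\ forall v, cdif f z v = L z v.
  move=> Oz; apply: fder_differentiable.
    move=> a v w; apply: (ccvg_uniq (hL z Oz _)).
    have := ccvgD (ccvgZ a (hL z Oz v)) (hL z Oz w).
    by apply: eq_ccvg => k; rewrite cdif_linear.
  have [r [c [r0 c0 hO hb]]] := local_bounds oOm Oz.
  move=> e e0; have cM0 : 0 <= c * M by rewrite mulr_ge0// ltW.
  exists (Num.min r (e / (c * M + 1))) => [|v].
    by rewrite lt_min r0 divr_gt0//; clear -cM0; lra.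
  rewrite lt_min => /andP[vr]; rewrite ltr_pdivlMr; last by clear -cM0; lra.
  move=> ve; apply: (@le_trans _ _ (c * M * vn v ^+ 2)); last first.
    by rewrite expr2; have := vn_ge0 v; move: ve; move: (vn v) (c * M) => x y; clear; nra.
  have Ozv : Om (z + v) by apply: hO; rewrite addrC addKr.
  have cv := ccvgD (ccvgD (hf _ Ozv) (ccvgZ (-1) (hf _ Oz))) (ccvgZ (-1) (hL z Oz v)).
  rewrite -[X in normc X]subr0 (_ : f (z + v) - f z - L z v = f (z + v) + -1 * f z + -1 * L z v);
    last by ring.
  apply: (ccvg_le cv); exists N0 => k hk.
  have [_ _ /(_ v vr)] := hb _ _ (hol k) M0 (hM k hk) z ltac:(by rewrite subrr vn0).
  by rewrite subr0 !mulN1r.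
have holf : holomorphic_fun_on Om f by move=> z /df[].
have lim e : 0 < e -> exists N, forall k, (N <= k)%N ->
     (L2normsq Om (fun z => u k z - f z)%R <= (e ^+ 2)%:E)%E.
  move=> /cu[N hN]; exists N => k hk.
  (* The shift by [N] puts every member of the sequence in the range where the Cauchy bound applies,
     so the lower limit in Fatou's lemma is bounded termwise. *)
  pose g l t := (normc (u k (xyC t) - u (l + N)%N (xyC t)) ^+ 2)%:E : \bar R.
  have gE t : (@xyC R n @^-1` Om) t ->
      (normc (u k (xyC t) - f (xyC t)) ^+ 2)%:E = limn_einf (g ^~ t).
    move=> Ot; have /ccvg_normc2/cvg_limn_einf_sup[-> _] // :
      ccvg (fun l => u k (xyC t) - u (l + N)%N (xyC t)) (u k (xyC t) - f (xyC t)).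
    move=> d /(hf _ Ot)[N' hN']; exists N' => l hl.
    rewrite (_ : _ - _ - _ = - (u (l + N)%N (xyC t) - f (xyC t))); last by ring.
    by rewrite normc_opp; apply: hN'; rewrite (leq_trans hl)// leq_addr.
  rewrite /L2normsq (eq_integral (fun t => limn_einf (g ^~ t))); last first.
    by move=> t; rewrite inE => /gE.
  apply: (le_trans (fatou _ (mOm oOm) _ _)).
  - by move=> l; exact: (measurable_normc2 oOm (hol_sub (hol k) (hol _))).
  - by move=> l t _; rewrite lee_fin sqr_ge0.
  rewrite limn_einf_lim; apply: lime_le; first exact: is_cvg_einfs.
  apply: nearW => l; apply: (@le_trans _ _ (\int[dV R n]_(t in @xyC R n @^-1` Om) g l t)%E).
    by apply: ereal_inf_lbound; exists l => //=.
  by apply: hN => //; rewrite leq_addl.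
exists f; split => //.
  split => //; have [N hN] := lim 1 ltr01.
  have hfN : (L2normsq Om f <= 2%:E * 1 + 2%:E * L2normsq Om (u N))%E.
    have := L2_add (hol_sub holf (hol N)) (hol N).
    under [X in L2normsq Om X]eq_fun do rewrite subrK.
    move/le_trans; apply; apply: leeD2r; apply: lee_wpmul2l; first by rewrite lee_fin.
    have := hN N (leqnn _); rewrite expr1n; apply: le_trans.
    rewrite le_eqVlt; apply/orP; left; apply/eqP.
    by apply: eq_integral => t _; rewrite normcBC.
  apply: le_lt_trans hfN _; rewrite lte_add_pinfty ?ltry// lte_mul_pinfty//; case: (hu N) => //.
by move=> z v Oz; have [_ ->] := df z Oz; exact: hL.
Qed.

End completeness.

Arguments inner : simpl never.
Arguments Normc.normc : simpl never.

(** * Orthonormal bases of the Bergman space *)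

Section inner_product.
Context {R : realType} {n : nat}.
Local Open Scope complex_scope.
Local Notation normc := (@Normc.normc R).
Local Notation Cn := 'rV[R[i]]_n.
Variable Om : set Cn.
Hypothesis oOm : open Om.
Implicit Types (z w v : Cn) (f g h : Cn -> R[i]) (phi : nat -> Cn -> R[i]).
Local Notation D := (@xyC R n @^-1` Om).
Local Notation A2 := (bergman_space Om).
Local Notation ip := (inner Om).

Definition nrm2 f : R := fine (L2normsq Om f).
Definition nrm f : R := Num.sqrt (nrm2 f).

Lemma nrm2_ge0 f : 0 <= nrm2 f.
Proof. by rewrite fine_ge0// L2_ge0. Qed.

Lemma nrm_ge0 f : 0 <= nrm f.
Proof. exact: sqrtr_ge0. Qed.

Lemma sqr_nrm f : nrm f ^+ 2 = nrm2 f.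
Proof. by rewrite sqr_sqrtr// nrm2_ge0. Qed.

Lemma L2_nrm2 f : A2 f -> L2normsq Om f = (nrm2 f)%:E.
Proof. by move=> [_ h]; rewrite fineK// ge0_fin_numE// L2_ge0. Qed.

Lemma L2_nrm f : A2 f -> (L2normsq Om f <= (nrm f ^+ 2)%:E)%E.
Proof. by move=> /L2_nrm2 ->; rewrite sqr_nrm. Qed.

Lemma A2D f g : A2 f -> A2 g -> A2 (fun z => f z + g z).
Proof.
move=> Af Ag; split; first by apply: hol_add; [case: Af|case: Ag].
have := L2_add oOm (proj1 Af) (proj1 Ag).
by rewrite (L2_nrm2 Af) (L2_nrm2 Ag) => /le_lt_trans; apply; rewrite -!EFinM -EFinD ltry.
Qed.

Lemma A2Z a f : A2 f -> A2 (fun z => a * f z).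
Proof.
move=> Af; split; first by apply: hol_scale; case: Af.
by rewrite L2_scale//; [rewrite L2_nrm2// -EFinM ltry|case: Af].
Qed.

Lemma eq_A2 f g : f =1 g -> A2 f -> A2 g.
Proof. by move=> /funext ->. Qed.

Lemma A2B f g : A2 f -> A2 g -> A2 (fun z => f z - g z).
Proof.
by move=> Af /(A2Z (-1)) /(A2D Af); apply: eq_A2 => z; rewrite mulN1r.
Qed.

Lemma A20 : A2 (fun=> 0).
Proof.
split; first by move=> z _; exact: differentiable_cst.
rewrite /L2normsq; under eq_integral do rewrite normc0 expr0n.
by rewrite integral0 ltry.
Qed.

Lemma A2_sum N (c : nat -> R[i]) phi : (forall j, A2 (phi j)) ->
  A2 (fun z => \sum_(j < N) c j * phi j z).
Proof.
move=> hp; elim: N => [|N IH].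
  by apply: eq_A2 A20 => z; rewrite big_ord0.
by apply: eq_A2 (A2D IH (A2Z (c N) (hp N))) => z; rewrite big_ord_recr.
Qed.

Lemma hol_Re_cont f z : differentiable f z -> forall e : R, 0 < e -> exists2 r : R, 0 < r &
  forall w, vn (w - z) < r -> `|complex.Re (f w) - complex.Re (f z)| < e.
Proof.
move=> df e e0; have [r r0 hr] := hol_continuous df e0; exists r => // w /hr.
by apply: le_lt_trans; rewrite -ReN -ReD normc_Re.
Qed.

Lemma hol_Im_cont f z : differentiable f z -> forall e : R, 0 < e -> exists2 r : R, 0 < r &
  forall w, vn (w - z) < r -> `|complex.Im (f w) - complex.Im (f z)| < e.
Proof.
move=> df e e0; have [r r0 hr] := hol_continuous df e0; exists r => // w /hr.
by apply: le_lt_trans; rewrite -ImN -ImD normc_Im.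
Qed.

Lemma measurable_Re f : A2 f -> measurable_fun D (fun t => complex.Re (f (xyC t))).
Proof.
move=> [hf _]; apply: (measurable_hol oOm (g := fun z => complex.Re (f z))) => z Oz.
by apply: hol_Re_cont; exact: hf.
Qed.

Lemma measurable_Im f : A2 f -> measurable_fun D (fun t => complex.Im (f (xyC t))).
Proof.
move=> [hf _]; apply: (measurable_hol oOm (g := fun z => complex.Im (f z))) => z Oz.
by apply: hol_Im_cont; exact: hf.
Qed.

(** The dominating function is [|f|^2 + |g|^2], which majorises [|f| |g|]. *)
Lemma integrable_dominated f g (F : n.-tuple (measurableTypeR R * measurableTypeR R) -> R) :
  A2 f -> A2 g -> measurable_fun D F ->
  (forall t, `|F t| <= normc (f (xyC t) * (g (xyC t))^*)) ->
  (dV R n).-integrable D (EFin \o F).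
Proof.
move=> Af Ag mF hF; have mO := mOm oOm.
have mf := measurable_normc2 oOm (proj1 Af); have mg := measurable_normc2 oOm (proj1 Ag).
apply/integrableP; split; first exact/measurable_EFinP.
apply: (@le_lt_trans _ _ (L2normsq Om f + L2normsq Om g)%E); last first.
  by rewrite !L2_nrm2// -EFinD ltry.
rewrite /L2normsq -ge0_integralD//; do ?[by move=> t _; rewrite lee_fin sqr_ge0].
apply: ge0_le_integral => //.
- by apply: measurableT_comp => //; exact/measurable_EFinP.
- exact: emeasurable_funD.
- move=> t _; rewrite -EFinD lee_fin; apply: le_trans (hF t) _.
  rewrite normcM normcJ.
  have := sqr_ge0 (normc (f (xyC t)) - normc (g (xyC t))).
  have := sqr_ge0 (normc (f (xyC t)) + normc (g (xyC t))).
  by clear; lra.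
Qed.

Lemma inner_integrable f g : A2 f -> A2 g ->
  (dV R n).-integrable D (EFin \o (fun t => complex.Re (f (xyC t) * (g (xyC t))^*))) /\
  (dV R n).-integrable D (EFin \o (fun t => complex.Im (f (xyC t) * (g (xyC t))^*))).
Proof.
move=> Af Ag; have a := measurable_Re Af; have b := measurable_Im Af.
have c := measurable_Re Ag; have d := measurable_Im Ag.
split; apply: (integrable_dominated Af Ag); do ?[by move=> t; exact: normc_Re|by move=> t; exact: normc_Im].
- rewrite (_ : (fun t => _) = (fun t => complex.Re (f (xyC t)) * complex.Re (g (xyC t)) +
    complex.Im (f (xyC t)) * complex.Im (g (xyC t)))).
    by apply: measurable_funD; exact: measurable_funM.
  by apply/funext => t; rewrite rcE; case: (g _) => ? ? /=; ring.
- rewrite (_ : (fun t => _) = (fun t => complex.Im (f (xyC t)) * complex.Re (g (xyC t)) -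
    complex.Re (f (xyC t)) * complex.Im (g (xyC t)))).
    by apply: measurable_funB; exact: measurable_funM.
  by apply/funext => t; rewrite rcE; case: (g _) => ? ? /=; ring.
Qed.

Lemma innerD f g h : A2 f -> A2 g -> A2 h -> ip (fun z => f z + g z) h = ip f h + ip g h.
Proof.
move=> Af Ag Ah; have [a b] := inner_integrable Af Ah; have [c d] := inner_integrable Ag Ah.
have mO := mOm oOm.
apply: complex_ext; rewrite rcE /inner /= -RintegralD//; apply: eq_Rintegral => t _;
  by rewrite mulrDl rcE.
Qed.

Lemma innerZ a f h : A2 f -> A2 h -> ip (fun z => a * f z) h = a * ip f h.
Proof.
move=> Af Ah; have [b c] := inner_integrable Af Ah; have mO := mOm oOm.
have zR r : (dV R n).-integrable D (EFin \o (fun t => r * complex.Re (f (xyC t) * (h (xyC t))^*))).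
  exact: (integrableZl _ r b).
have zI r : (dV R n).-integrable D (EFin \o (fun t => r * complex.Im (f (xyC t) * (h (xyC t))^*))).
  exact: (integrableZl _ r c).
apply: complex_ext; rewrite rcE /inner /= -!RintegralZl//.
- by rewrite -RintegralB//; apply: eq_Rintegral => t _; rewrite -mulrA rcE.
- by rewrite -RintegralD//; apply: eq_Rintegral => t _; rewrite -mulrA rcE.
Qed.

Lemma innerC f g : A2 f -> A2 g -> ip g f = (ip f g)^*.
Proof.
move=> Af Ag; have mO := mOm oOm; have [b c] := inner_integrable Af Ag.
apply: complex_ext; rewrite /inner /=.
  by apply: eq_Rintegral => t _; case: (f _) => ? ?; case: (g _) => ? ? /=; ring.
rewrite -mulN1r -RintegralZl//; apply: eq_Rintegral => t _.
by case: (f _) => ? ?; case: (g _) => ? ? /=; ring.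
Qed.

Lemma innerff f : A2 f -> ip f f = (nrm2 f)%:C.
Proof.
move=> Af; apply: complex_ext; rewrite /inner /=.
  by rewrite /Rintegral /nrm2 /L2normsq; congr fine; apply: eq_integral => t _; rewrite mulcJ.
under eq_Rintegral do rewrite mulcJ /=.
by rewrite Rintegral_cst ?mul0r//; exact: mOm.
Qed.

Lemma innerB f g h : A2 f -> A2 g -> A2 h -> ip (fun z => f z - g z) h = ip f h - ip g h.
Proof.
move=> Af Ag Ah; rewrite -mulN1r -(innerZ (-1) Ag Ah) -(innerD Af (A2Z (-1) Ag) Ah).
by congr (ip _ _); apply/funext => z; rewrite mulN1r.
Qed.

Lemma innerBr f g h : A2 f -> A2 g -> A2 h -> ip h (fun z => f z - g z) = ip h f - ip h g.
Proof.
move=> Af Ag Ah; rewrite (innerC (A2B Af Ag) Ah) innerB// rmorphB/=.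
by rewrite (innerC Af Ah) (innerC Ag Ah).
Qed.

Lemma inner_sum N (c : nat -> R[i]) phi h : (forall j, A2 (phi j)) -> A2 h ->
  ip (fun z => \sum_(j < N) c j * phi j z) h = \sum_(j < N) c j * ip (phi j) h.
Proof.
move=> hp Ah; elim: N => [|N IH].
  rewrite big_ord0 -[RHS](mul0r (ip (fun=> 0) h)) -innerZ//; last exact: A20.
  by congr (ip _ _); apply/funext => z; rewrite big_ord0 mul0r.
rewrite big_ord_recr /= -IH -innerZ// -innerD//; [|exact: A2_sum|exact: A2Z].
by congr (ip _ _); apply/funext => z; rewrite big_ord_recr.
Qed.

Section orthonormal.
Variable phi : nat -> Cn -> R[i].
Hypothesis Ap : forall j, A2 (phi j).

Definition orthonormal_upto N := forall j k, (j < N)%N -> (k < N)%N ->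
  ip (phi j) (phi k) = (j == k)%:R.

Lemma inner_psum N (c : nat -> R[i]) k : orthonormal_upto N -> (k < N)%N ->
  ip (fun z => \sum_(j < N) c j * phi j z) (phi k) = c k.
Proof.
move=> on kN; rewrite inner_sum// (bigD1 (Ordinal kN))//= on// eqxx mulr1.
rewrite big1 ?addr0// => j jk; rewrite on//.
by rewrite (negPf (_ : nat_of_ord j != k)) ?mulr0.
Qed.

Lemma nrm2_psum N (c : nat -> R[i]) : orthonormal_upto N ->
  nrm2 (fun z => \sum_(j < N) c j * phi j z) = \sum_(j < N) normc (c j) ^+ 2.
Proof.
move=> on; have As := A2_sum N c Ap; apply: complexI.
rewrite -innerff// {1}inner_sum// rmorph_sum; apply: eq_bigr => j _.
by rewrite innerC// inner_psum// mulcJ.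
Qed.

Lemma inner_residual N f k : A2 f -> orthonormal_upto N -> (k < N)%N ->
  ip (fun z => f z - \sum_(j < N) ip f (phi j) * phi j z) (phi k) = 0.
Proof.
move=> Af on kN; rewrite innerB//; last exact: (A2_sum N (fun j => ip f (phi j))).
by rewrite (inner_psum (fun j => ip f (phi j)))// subrr.
Qed.

Lemma psum_residual N M (c : nat -> R[i]) f : A2 f -> orthonormal_upto N -> (M <= N)%N ->
  ip (fun z => \sum_(j < M) c j * phi j z)
     (fun z => f z - \sum_(j < N) ip f (phi j) * phi j z) = 0.
Proof.
move=> Af on MN.
have As : A2 (fun z => f z - \sum_(j < N) ip f (phi j) * phi j z).
  by apply: A2B => //; exact: (A2_sum N (fun j => ip f (phi j))).
rewrite inner_sum// big1// => j _; rewrite innerC// inner_residual ?conjc0 ?mulr0//.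
exact: leq_trans (ltn_ord j) MN.
Qed.

Lemma bessel_eq N f : A2 f -> orthonormal_upto N ->
  nrm2 (fun z => f z - \sum_(j < N) ip f (phi j) * phi j z) =
  nrm2 f - \sum_(j < N) normc (ip f (phi j)) ^+ 2.
Proof.
move=> Af on; have Aps := A2_sum N (fun j => ip f (phi j)) Ap.
have As := A2B Af Aps.
apply: complexI; rewrite rmorphB/= -!innerff//.
rewrite [LHS]innerB// (psum_residual (fun j => ip f (phi j)) Af on (leqnn N)) subr0.
rewrite innerBr//; congr (_ - _).
rewrite (innerC Aps Af) (inner_sum _ (fun j => ip f (phi j)))//.
rewrite rmorph_sum [RHS]rmorph_sum; apply: eq_bigr => j _.
by rewrite (innerC Af (Ap j)) rmorphM [RHS]/= -mulcJ mulrC; congr (_ * _); exact: conjcK.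
Qed.

(** Pythagoras: the two residuals differ by a section of the expansion. Hence squared residual norms
    decrease, and the residuals form a Cauchy sequence even before the basis is known to be
    complete. *)
Lemma residual_diff N M f : A2 f -> orthonormal_upto M -> (N <= M)%N ->
  nrm2 (fun z => (f z - \sum_(j < N) ip f (phi j) * phi j z) -
                 (f z - \sum_(j < M) ip f (phi j) * phi j z)) =
  nrm2 (fun z => f z - \sum_(j < N) ip f (phi j) * phi j z) -
  nrm2 (fun z => f z - \sum_(j < M) ip f (phi j) * phi j z).
Proof.
move=> Af on NM; pose c j := ip f (phi j).
have onN : orthonormal_upto N.
  by move=> j k hj hk; apply: on; apply: leq_trans NM.
(* The section from [N] to [M] becomes a sum starting at 0 with coefficients set to 0 below [N], the
   form that [nrm2_psum] accepts. *)
rewrite (_ : nrm2 (fun z => _ - (_ - _)) =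
  nrm2 (fun z => \sum_(j < M) (if (N <= j)%N then c j else 0) * phi j z)).
  rewrite (nrm2_psum (fun j => if (N <= j)%N then c j else 0))// !bessel_eq//.
  rewrite [RHS](_ : _ = \sum_(j < M) normc (ip f (phi j)) ^+ 2 -
    \sum_(j < N) normc (ip f (phi j)) ^+ 2); last by ring.
  rewrite -!(big_mkord xpredT (fun j => normc (if (N <= j)%N then c j else 0) ^+ 2)).
  rewrite -!(big_mkord xpredT (fun j => normc (ip f (phi j)) ^+ 2)).
  rewrite (big_cat_nat (n := N))//= [X in _ = X - _](big_cat_nat (n := N))//=.
  rewrite [X in _ = X - _]addrC addrK big_nat_cond big1 ?add0r; last first.
    by move=> j /andP[/andP[_ jN] _]; rewrite ifF ?normc0 ?expr0n//; rewrite leqNgt jN.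
  by rewrite big_nat_cond [RHS]big_nat_cond; apply: eq_bigr => j /andP[/andP[-> _] _].
congr nrm2; apply/funext => z.
transitivity (\sum_(j < M) ip f (phi j) * phi j z - \sum_(j < N) ip f (phi j) * phi j z).
  by ring.
rewrite -!(big_mkord xpredT (fun j => ip f (phi j) * phi j z)).
rewrite -!(big_mkord xpredT (fun j => (if (N <= j)%N then c j else 0) * phi j z)).
rewrite (big_cat_nat (n := N))//= [RHS](big_cat_nat (n := N))//=.
rewrite addrAC subrr add0r [X in _ = X + _]big_nat_cond [X in _ = X + _]big1 ?add0r; last first.
  by move=> j /andP[/andP[_ jN] _]; rewrite ifF ?mul0r//; rewrite leqNgt jN.
by rewrite big_nat_cond [RHS]big_nat_cond; apply: eq_bigr => j /andP[/andP[-> _] _].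
Qed.

(* Bessel's inequality for a bounded functional instead of a vector. *)
Lemma bessel_functional N (L : (Cn -> R[i]) -> R[i]) (K : R) : 0 <= K ->
  orthonormal_upto N ->
  (forall c : nat -> R[i], L (fun z => \sum_(j < N) c j * phi j z) = \sum_(j < N) c j * L (phi j)) ->
  (forall f, A2 f -> normc (L f) <= K * nrm f) ->
  \sum_(j < N) normc (L (phi j)) ^+ 2 <= K ^+ 2.
Proof.
move=> K0 on lin bd; set S := \sum_(_ < _) _.
have S0 : 0 <= S by apply: sumr_ge0 => j _; exact: sqr_ge0.
(* On the vector with these coefficients [L] takes the value [S], while its squared norm is [S];
   hence [S <= K * Num.sqrt S]. *)
pose c j := (L (phi j))^*.
have := bd _ (A2_sum N c Ap); rewrite lin.
have -> : \sum_(j < N) c j * L (phi j) = S%:C.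
  by rewrite rmorph_sum; apply: eq_bigr => j _; rewrite mulrC mulcJ.
rewrite /nrm nrm2_psum// (eq_bigr (fun j : 'I_N => normc (L (phi j)) ^+ 2)); last first.
  by move=> j _; rewrite normcJ.
rewrite -/S normcR ger0_norm// => h.
have [->|Sn0] := eqVneq S 0; first exact: sqr_ge0.
have sS0 : 0 < Num.sqrt S by rewrite sqrtr_gt0 lt_neqAle eq_sym Sn0.
have : Num.sqrt S <= K.
  by rewrite -(ler_pM2r sS0) -expr2 sqr_sqrtr.
by move=> h2; rewrite -[S]sqr_sqrtr// ler_pXn2r ?nnegrE ?sqrtr_ge0.
Qed.

End orthonormal.

End inner_product.

(** * Finite volume of boxes *)

Section finite_volume.
Context {R : realType}.
Local Open Scope complex_scope.
Local Notation normc := (@Normc.normc R).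
Local Notation leb := (@lebesgue_measure R).
Local Notation plane := (measurableTypeR R * measurableTypeR R)%type.
Local Notation area := (sigma_finite_product leb leb).

Lemma area_pbox_fin (x0 : plane) (r : R) : (area (pbox x0 r) < +oo)%E.
Proof.
have lf (a b : R) : (leb `[a, b]%classic < +oo)%E.
  by rewrite lebesgue_measure_itv/=; case: ifP => // _; rewrite -EFinB ltry.
rewrite pboxE /sigma_finite_product product_measure1E//.
apply: lte_mul_pinfty; [exact: measure_ge0| |exact: lf].
by rewrite ge0_fin_numE; [exact: lf|exact: measure_ge0].
Qed.

(** Phrased as the integral of an indicator so that [integral_tuple_cons] drives the induction. It
    puts the constants in [A^2] of a bounded set. *)
Lemma volume_tbox_fin n (t0 : n.-tuple plane) (r : R) :
  (\int[tuple_measure area n]_t (\1_(tbox t0 r) t)%:E < +oo)%E.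
Proof.
elim: n t0 => [|n IH] t0.
  rewrite integral_indic ?setIT//=; last exact: measurable_tbox.
  by rewrite diracE ltry.
case/tupleP: t0 => x0 t0; rewrite -[ [tuple of _] ]/(tuple_cons (x0, t0)).
rewrite integral_tuple_cons//; last first.
  by apply/measurable_EFinP; apply: measurable_indic; exact: measurable_tbox.
have I0 : (0 <= \int[tuple_measure area n]_t (\1_(tbox t0 r) t)%:E)%E by exact: integral_ge0.
rewrite (eq_integral (fun x => (\int[tuple_measure area n]_t (\1_(tbox t0 r) t)%:E) *
  (\1_(pbox x0 r) x)%:E)%E); last first.
  move=> x _; rewrite muleC -ge0_integralZl//; last first.
    by apply/measurable_EFinP; apply: measurable_indic; exact: measurable_tbox.
  apply: eq_integral => t _; rewrite -EFinM; congr _%:E; rewrite !indicE.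
  have [h1|h1] := pselect (tbox (tuple_cons (x0, t0)) r (tuple_cons (x, t))).
    by rewrite mem_set//; move/tbox_cons: h1 => [? ?]; rewrite !mem_set// mulr1.
  rewrite memNset//; have [h2|h2] := pselect (pbox x0 r x); last by rewrite memNset// mul0r.
  by rewrite [t \in _]memNset ?mulr0// => h3; apply: h1; apply/tbox_cons.
rewrite ge0_integralZl//; last first.
  by apply/measurable_EFinP; apply: measurable_indic; exact: measurable_pbox.
apply: lte_mul_pinfty; [exact: I0| |]; last first.
  by rewrite integral_indic ?setIT//; [exact: area_pbox_fin|exact: measurable_pbox].
by rewrite ge0_fin_numE; [exact: IH|exact: I0].
Qed.

End finite_volume.

(** * Membership in the Bergman space by domination *)

Section bergman_basis_existence.
Context {R : realType} {n : nat}.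
Local Open Scope complex_scope.
Local Notation normc := (@Normc.normc R).
Local Notation Cn := 'rV[R[i]]_n.
Implicit Types (Om : set Cn) (z w v : Cn) (f g h : Cn -> R[i]) (phi : nat -> Cn -> R[i]).
Local Notation plane := (measurableTypeR R * measurableTypeR R)%type.

Lemma bounded_vn Om : bounded_set Om -> exists2 B : R, 0 <= B & forall z, Om z -> vn z <= B.
Proof.
move=> [M [Mreal hM]].
have ME : M = (complex.Re M)%:C by rewrite RRe_real.
exists (Num.max 0 (complex.Re M + 1)); first by rewrite le_max lexx.
move=> z Oz; have := hM (complex.Re M + 1)%:C; rewrite {1}ME ltcR ltrDl ltr01 => /(_ isT z Oz) /=.
by rewrite vnE lecR => h; rewrite le_max h orbT.
Qed.

(** Serves twice: for monomials, dominated by the constant 1, and for the test function of the final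
    estimate, dominated by [B1(., z)]. *)
Lemma A2_dominated Om f g (c : R) : open Om -> 0 <= c -> holomorphic_fun_on Om g ->
  bergman_space Om f -> (forall z, Om z -> normc (g z) <= c * normc (f z)) ->
  bergman_space Om g /\ nrm2 Om g <= c ^+ 2 * nrm2 Om f.
Proof.
move=> oOm c0 hg Af h.
have L : (L2normsq Om g <= (c ^+ 2)%:E * L2normsq Om f)%E.
  rewrite /L2normsq -ge0_integralZl//; first last.
  - by rewrite lee_fin sqr_ge0.
  - by move=> t _; rewrite lee_fin sqr_ge0.
  - by apply: measurable_normc2 => //; case: Af.
  - exact: mOm.
  apply: ge0_le_integral => //.
  - exact: mOm.
  - by move=> t _; rewrite lee_fin sqr_ge0.
  - exact: measurable_normc2.
  - by apply: emeasurable_funM => //; apply: measurable_normc2 => //; case: Af.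
  - move=> t Ot; rewrite -EFinM lee_fin -exprMn ler_pXn2r ?nnegrE ?normc_ge0//.
      exact: h.
    by rewrite mulr_ge0// normc_ge0.
have L2 := L; rewrite (L2_nrm2 Af) -EFinM in L2.
have Ag : bergman_space Om g by split => //; apply: le_lt_trans L2 _; rewrite ltry.
by split => //; rewrite (L2_nrm2 Ag) lee_fin in L2.
Qed.

Lemma A2_cst Om : open Om -> bounded_set Om -> bergman_space Om (fun=> 1).
Proof.
move=> oOm /bounded_vn[B B0 hB]; split; first by move=> z _; exact: differentiable_cst.
rewrite /L2normsq.
pose t0 : n.-tuple plane := [tuple (0, 0) | j < n].
apply: (le_lt_trans _ (volume_tbox_fin t0 B)).
under eq_integral do rewrite normc1 expr1n.
rewrite integral_mkcond; apply: ge0_le_integral => //.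
- by move=> t _; rewrite patchE; case: ifP.
- by apply/(measurable_restrictT _ (mOm oOm)).
- by apply/measurable_EFinP; apply: measurable_indic; exact: measurable_tbox.
- move=> t _; rewrite patchE; case: ifPn => [|_]; last by rewrite lee_fin indicE.
  rewrite inE => Ot; rewrite indicE mem_set// => j; rewrite tnth_mktuple /= !subr0.
  have h := le_trans (normc_le_vn (xyC t) j) (hB _ Ot); rewrite mxE in h.
  by have h1 := normc_Re ((tnth t j).1 +i* (tnth t j).2); have h2 := normc_Im ((tnth t j).1 +i* (tnth t j).2);
    split; apply: le_trans h.
Qed.

Lemma nrm0_zero Om f : open Om -> bergman_space Om f -> nrm2 Om f = 0 -> forall z, Om z -> f z = 0.
Proof.
move=> oOm Af f0 z Oz; have [r [c [r0 c0 _ hb]]] := eval_bound oOm Oz.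
have := hb f 0 (proj1 Af) (lexx _); rewrite (L2_nrm2 Af) f0 expr0n => /(_ (lexx _) z).
rewrite subrr vn0 mulr0 => /(_ r0) h; apply/eqP; rewrite -normc_eq0.
by rewrite eq_le h normc_ge0.
Qed.

Lemma monotone_cauchy (u : nat -> R) (B : R) : (forall k, u k <= u k.+1) -> (forall k, u k <= B) ->
  forall e, 0 < e -> exists N, forall k l, (N <= k)%N -> (k <= l)%N -> u l - u k < e.
Proof.
move=> inc ub e e0.
have mono : {homo u : i j / (i <= j)%N >-> i <= j}.
  by apply: homo_leq => [//|? ? ?|//]; exact: le_trans.
have hs : has_sup (range u) by split; [exists (u 0%N), 0%N|exists B => _ [k _ <-]].
have [_ [N _ <-] hN] := sup_adherent e0 hs.
exists N => k l Nk kl; have := mono _ _ Nk; have : u l <= sup (range u).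
  by apply: ub_le_sup; [case: hs|exists l].
by move: hN; clear; lra.
Qed.

End bergman_basis_existence.

(** * Existence of an orthonormal basis *)

Section greedy_basis.
Context {R : realType} {n : nat}.
Local Open Scope complex_scope.
Local Notation normc := (@Normc.normc R).
Local Notation Cn := 'rV[R[i]]_n.+1.
Implicit Types (z w v : Cn) (f g h : Cn -> R[i]) (phi : nat -> Cn -> R[i]).
Variable Om : set Cn.
Hypotheses (oOm : open Om) (bOm : bounded_set Om) (nOm : Om !=set0).
Local Notation A2 := (bergman_space Om).
Local Notation ip := (inner Om).

(** Powers of one coordinate provide the infinitely many independent elements of [A^2]; a first
    coordinate exists because the dimension is [n.+1]. *)
Lemma A2_monomial k : A2 (fun z => z 0 0 ^+ k).
Proof.
have [B B0 hB] := bounded_vn bOm.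
have hm : holomorphic_fun_on Om (fun z => z 0 0 ^+ k).
  elim: k => [|k IH] z Oz; first exact: differentiable_cst.
  rewrite (_ : (fun z => _) = (fun z : Cn => z 0 0) * (fun z : Cn => z 0 0 ^+ k)); last first.
    by apply/funext => w; rewrite exprS.
  by apply: differentiableM; [exact: differentiable_coord|exact: IH].
have [] // := @A2_dominated R n.+1 Om (fun=> 1) _ (B ^+ k) oOm (exprn_ge0 _ B0) hm (A2_cst oOm bOm).
move=> z Oz; rewrite normcX normc1 mulr1 lerXn2r ?nnegrE ?normc_ge0//.
exact: le_trans (normc_le_vn z 0) (hB z Oz).
Qed.

(** Moving a point of [Om] by [r / (k + 2)] in the first coordinate, for [k] below [size p], yields
    more distinct roots than a nonzero [p] can have. *)
Lemma polynomial_zero (p : {poly R[i]}) : (forall z, Om z -> p.[z 0 0] = 0) -> p = 0.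
Proof.
case: nOm => z0 Oz0 h; have [r r0 hr] := open_vn oOm Oz0.
apply/eqP/negPn/negP => p0.
pose t k : R[i] := (r / k.+2%:R)%:C.
pose rs := [seq z0 0 0 + t k | k <- iota 0 (size p)].
have : (size rs < size p)%N.
  apply: max_poly_roots p0 _ _.
    apply/allP => _ /mapP[k _ ->]; apply/eqP.
    have <- : (z0 + t k *: delta_mx 0 0) 0 0 = z0 0 0 + t k by rewrite !mxE eqxx mulr1.
    apply: h; apply: hr; rewrite addrC addKr vnZ.
    have -> : vn (delta_mx 0 0 : Cn) = 1.
      apply/eqP; rewrite eq_le; apply/andP; split.
        by apply: vn_le => // j; rewrite mxE; case: (_ && _); rewrite /= ?mulr1n ?mulr0n ?normc0 ?normc1.
      by have := normc_le_vn (delta_mx 0 0 : Cn) 0; rewrite mxE eqxx /= normc1.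
    rewrite mulr1 normcR ger0_norm; last by rewrite divr_ge0// ltW.
    by rewrite ltr_pdivrMr// ltr_pMr// ltr1n.
  rewrite map_inj_uniq ?iota_uniq// => k l /addrI/complexI.
  move/(mulfI (lt0r_neq0 r0)) => /invr_inj/eqP; rewrite eqr_nat => /eqP[].
  by [].
by rewrite size_map size_iota ltnn.
Qed.

Definition perp_to (l : seq (Cn -> R[i])) g :=
  forall j, (j < size l)%N -> ip g (nth (fun=> 0) l j) = 0.

Definition A2_seq (l : seq (Cn -> R[i])) :=
  forall j, (j < size l)%N -> A2 (nth (fun=> 0) l j).

(** Orthogonality to [N] functions imposes [N] linear conditions on the coefficients of [N + 1]
    monomials, so the matrix of inner products has a nonzero kernel vector. *)
Lemma exists_perp l : A2_seq l -> exists2 g, A2 g & perp_to l g /\ nrm2 Om g != 0.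
Proof.
move=> Al; pose N := size l.
pose m k := fun z : Cn => z 0 0 ^+ k.
have Am k : A2 (m k) := A2_monomial k.
pose A := \matrix_(k < N.+1, j < N) ip (m k) (nth (fun=> 0) l j).
have kerA : kermx A != 0.
  rewrite -mxrank_eq0 mxrank_ker subn_eq0 -ltnNge.
  exact: leq_ltn_trans (rank_leq_col A) (ltnSn _).
have [c /sub_kermxP cA c0] := rowV0Pn kerA.
(* The kernel vector is extended by 0 to all of [nat], because [A2_sum] and [inner_sum] take
   coefficients indexed by [nat]. *)
pose c' k := if (k < N.+1)%N =P true is ReflectT h then c 0 (Ordinal h) else 0.
have c'E (k : 'I_N.+1) : c' k = c 0 k.
  by rewrite /c'; case: eqP => [h|]; [congr (c 0 _); exact: val_inj|rewrite ltn_ord].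
pose g z := \sum_(k < N.+1) c' k * m k z.
have Ag : A2 g by exact: (A2_sum oOm N.+1 c' Am).
exists g => //; split.
  move=> j jN; rewrite (inner_sum oOm _ c')//; last exact: Al.
  have := congr1 (fun M : 'M[R[i]]_(1, N) => M 0 (Ordinal jN)) cA; rewrite !mxE => h; rewrite -[RHS]h.
  by apply: eq_bigr => k _; rewrite mxE c'E.
apply/eqP => /(nrm0_zero oOm Ag) gz.
have p0 : \poly_(k < N.+1) c' k = 0.
  by apply: polynomial_zero => z Oz; rewrite horner_poly; exact: gz.
move/eqP: c0; apply; apply/rowP => k; rewrite mxE -c'E.
by have := congr1 (fun p : {poly R[i]} => p`_k) p0; rewrite coef_poly ltn_ord coef0.
Qed.

Lemma perpZ l a g : A2_seq l -> A2 g -> perp_to l g -> perp_to l (fun z => a * g z).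
Proof. by move=> Al Ag h j jl; rewrite innerZ// ?h ?mulr0//; exact: Al. Qed.

Lemma nrm2Z a g : A2 g -> nrm2 Om (fun z => a * g z) = normc a ^+ 2 * nrm2 Om g.
Proof. by move=> Ag; rewrite /nrm2 L2_scale//; [rewrite (L2_nrm2 Ag)|case: Ag]. Qed.

Lemma normalize g : A2 g -> nrm2 Om g != 0 ->
  let a := (nrm Om g)^-1%:C in nrm2 Om (fun z => a * g z) = 1.
Proof.
move=> Ag g0 a; rewrite nrm2Z// normcR ger0_norm ?invr_ge0 ?nrm_ge0//.
by rewrite exprVn sqr_nrm mulVf.
Qed.

(** The supremum of [|g q|] over the competing unit vectors is finite by [eval_bound]. Some vector
    reaches half of it, whence the factor 2; a maximiser would call for a compactness argument. *)
Lemma greedy_step (q : Cn) l : A2_seq l -> exists psi,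
  [/\ A2 psi, perp_to l psi, nrm2 Om psi = 1 &
   Om q -> forall g, A2 g -> perp_to l g -> nrm2 Om g = 1 -> normc (g q) <= 2 * normc (psi q)].
Proof.
move=> Al; have [g0 Ag0 [pg0 g00]] := exists_perp Al.
pose g1 z := (nrm Om g0)^-1%:C * g0 z.
have Ag1 : A2 g1 by exact: A2Z.
have pg1 : perp_to l g1 by exact: perpZ.
have ng1 : nrm2 Om g1 = 1 by exact: normalize.
have [Oq|nOq] := pselect (Om q); last by exists g1; split.
pose S := [set x | exists g, [/\ A2 g, perp_to l g, nrm2 Om g = 1 & x = normc (g q)]].
have [r [c [r0 c0 _ hb]]] := eval_bound oOm Oq.
have hs : has_sup S.
  split; first by exists (normc (g1 q)), g1; split.
  exists c => _ [g [Ag _ ng ->]].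
  have := hb g 1 (proj1 Ag) ler01; rewrite (L2_nrm2 Ag) ng expr1n mulr1 => /(_ (lexx _) q).
  by rewrite subrr vn0; apply.
have ubS g : A2 g -> perp_to l g -> nrm2 Om g = 1 -> normc (g q) <= sup S.
  by move=> *; apply: ub_le_sup; [case: hs|exists g; split].
have [s0|s0] := leP (sup S) 0.
  exists g1; split => // _ g Ag pg ng; apply: le_trans (ubS g Ag pg ng) _.
  by apply: le_trans s0 _; rewrite mulr_ge0// normc_ge0.
have s20 : 0 < sup S / 2 by clear -s0; lra.
have [_ [g [Ag pg ng ->]] hg] := sup_adherent s20 hs.
exists g; split => // _ h Ah ph nh; apply: le_trans (ubS h Ah ph nh) _.
by move: hg; clear; lra.
Qed.

(* The [i]-th rational point is visited at every step [2 ^ i * (2 k + 1) - 1],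
   hence infinitely often. *)
Definition visit (N : nat) := logn 2 N.+1.

Lemma visit_often i N0 : exists2 N, (N0 <= N)%N & visit N = i.
Proof.
exists (2 ^ i * (2 * N0).+1).-1.
  rewrite -ltnS prednK ?muln_gt0 ?expn_gt0//.
  apply: (@leq_trans (2 * N0).+1); first by rewrite ltnS leq_pmull.
  by rewrite leq_pmull// expn_gt0.
rewrite /visit prednK ?muln_gt0 ?expn_gt0// lognM ?expn_gt0// pfactorK//.
by rewrite [logn 2 _.+1](lognE 2) dvdn2 /= oddM/= addn0.
Qed.

(** Numbers that are no code give the point 0, and rational points may lie outside [Om]; this is why
    the greedy condition is guarded by membership in [Om]. *)
Definition rational_point (i : nat) : Cn :=
  if unpickle i is Some q then
    \row_(j < n.+1) (ratr ((q : {ffun 'I_n.+1 -> rat * rat}) j).1 +i* ratr (q j).2)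
  else 0.

Lemma rational_dense z (e : R) : 0 < e -> exists i, vn (rational_point i - z) < e.
Proof.
move=> e0.
have /choice[q hq] : forall j, exists q : rat * rat,
    `|ratr q.1 - complex.Re (z 0 j)| <= e / 4 /\ `|ratr q.2 - complex.Im (z 0 j)| <= e / 4.
  move=> j.
  have [q1] := @rat_in_itvoo R (complex.Re (z 0 j) - e / 4) (complex.Re (z 0 j) + e / 4) ltac:(lra).
  have [q2] := @rat_in_itvoo R (complex.Im (z 0 j) - e / 4) (complex.Im (z 0 j) + e / 4) ltac:(lra).
  rewrite !in_itv/= => h2 h1; exists (q1, q2) => /=.
  by rewrite !ler_norml; clear -h1 h2; lra.
exists (pickle [ffun j => q j]); rewrite /rational_point pickleK.
apply/vn_lt => // j; rewrite !mxE ffunE; have [h1 h2] := hq j.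
by apply: le_lt_trans (normc_leReIm _) _; rewrite !rcE /=; clear -h1 h2 e0; lra.
Qed.

Lemma greedy_exists : exists next : seq (Cn -> R[i]) -> Cn -> R[i], forall l, A2_seq l ->
  [/\ A2 (next l), perp_to l (next l), nrm2 Om (next l) = 1 &
   Om (rational_point (visit (size l))) -> forall g, A2 g -> perp_to l g -> nrm2 Om g = 1 ->
     normc (g (rational_point (visit (size l)))) <=
     2 * normc (next l (rational_point (visit (size l))))].
Proof.
suff /choice[nx h] : forall l, exists psi, A2_seq l ->
  [/\ A2 psi, perp_to l psi, nrm2 Om psi = 1 &
   Om (rational_point (visit (size l))) -> forall g, A2 g -> perp_to l g -> nrm2 Om g = 1 ->
     normc (g (rational_point (visit (size l)))) <=
     2 * normc (psi (rational_point (visit (size l))))] by exists nx.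
move=> l; have [Al|nAl] := pselect (A2_seq l); last by exists (fun=> 0) => /nAl.
by have [psi h] := greedy_step (rational_point (visit (size l))) Al; exists psi.
Qed.

(** The greedy choice yields completeness. A unit vector [g] orthogonal to all [phi j] satisfies
    [|g q| <= 2 |phi N q|] at each visit of a rational point [q], while [phi N q] tends to 0 by
    Bessel; so [g] vanishes on a dense set. The residuals of any [f] then converge to such an
    orthogonal vector, which is 0. *)
Lemma orthonormal_basis_exists : exists phi, bergman_orthonormal_basis Om phi.
Proof.
have [nx hnx] := greedy_exists.
pose L N := iter N (fun l => rcons l (nx l)) [::].
have LS N : L N.+1 = rcons (L N) (nx (L N)) by [].
have szL N : size (L N) = N by elim: N => // N IH; rewrite LS size_rcons IH.
pose phi N := nx (L N).
have nthL N j : (j < N)%N -> nth (fun=> 0) (L N) j = phi j.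
  elim: N => // N IH; rewrite ltnS leq_eqVlt LS nth_rcons szL => /predU1P[->|jN].
    by rewrite ltnn eqxx.
  by rewrite jN IH.
have AL N : A2_seq (L N).
  elim: N => [|N IH] j; first by [].
  rewrite szL ltnS leq_eqVlt LS nth_rcons szL => /predU1P[->|jN].
    by rewrite ltnn eqxx; have [] := hnx _ IH.
  by rewrite jN; apply: IH; rewrite szL.
have Ap N : A2 (phi N) by have [] := hnx _ (AL N).
have perp N g : perp_to (L N) g <-> forall j, (j < N)%N -> ip g (phi j) = 0.
  split=> h j; first by move=> jN; have := h j; rewrite szL nthL//; apply.
  by rewrite szL => jN; rewrite nthL// h.
have on j k : ip (phi j) (phi k) = (j == k)%:R.
  have lt a b : (a < b)%N -> ip (phi b) (phi a) = 0.
    by move=> ab; have [_ /perp h _ _] := hnx _ (AL b); exact: h.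
  have [jk|kj|->] := ltngtP j k.
  - by rewrite (innerC oOm (Ap k) (Ap j)) lt// conjc0.
  - exact: lt.
  - by rewrite innerff//; have [_ _ -> _] := hnx _ (AL k).
have onN N : orthonormal_upto Om phi N by move=> j k _ _; exact: on.
have greedy N : Om (rational_point (visit N)) -> forall g, A2 g ->
    (forall j, ip g (phi j) = 0) -> nrm2 Om g = 1 ->
    normc (g (rational_point (visit N))) <= 2 * normc (phi N (rational_point (visit N))).
  move=> Oq g Ag pg ng; have [_ _ _ h] := hnx _ (AL N); rewrite szL in h.
  by apply: h => //; apply/perp.
have complete g : A2 g -> (forall j, ip g (phi j) = 0) -> nrm2 Om g = 0.
  move=> Ag pg; apply/eqP/negPn/negP => ng.
  have key i : Om (rational_point i) -> g (rational_point i) = 0.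
    move=> Oi; set q := rational_point i in Oi *.
    have [r [c [r0 c0 _ hb]]] := eval_bound oOm Oi.
    pose a := (nrm Om g)^-1%:C; pose g1 z := a * g z.
    have Ag1 : A2 g1 by exact: A2Z.
    have ng1 : nrm2 Om g1 = 1 by exact: normalize.
    have pg1 j : ip g1 (phi j) = 0 by rewrite innerZ// pg mulr0.
    (* Bessel's inequality for the functional of evaluation at [q]; it makes the terms [phi j q]
       tend to 0. *)
    have bess N : \sum_(j < N) normc (phi j q) ^+ 2 <= c ^+ 2.
      apply: (@bessel_functional R n.+1 Om oOm phi Ap N (fun f => f q) c (ltW c0) (onN N)) => //.
      by move=> f Af; apply: hb => //; [case: Af|exact: nrm_ge0|exact: L2_nrm|rewrite subrr vn0].
    suff : g1 q = 0.
      move=> /eqP; rewrite /g1 mulf_eq0 => /orP[|/eqP//].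
      rewrite /a -[0]/(0%:C) => /eqP/complexI/eqP; rewrite invr_eq0.
      by rewrite -sqrf_eq0 sqr_nrm (negPf ng).
    apply/eqP; rewrite -normc_eq0 eq_le normc_ge0 andbT.
    apply/ler_addgt0Pl => e e0; rewrite addr0.
    have e20 : 0 < (e / 2) ^+ 2 by rewrite exprn_gt0// divr_gt0.
    have [|N0 hN0] := @monotone_cauchy R (fun N => \sum_(j < N) normc (phi j q) ^+ 2) _ _ bess _ e20.
      by move=> k; rewrite big_ord_recr/= lerDl sqr_ge0.
    have [N N0N vN] := visit_often i N0.
    have := hN0 N N.+1 N0N (leqnSn N); rewrite big_ord_recr/= addrAC subrr add0r.
    rewrite ltr_pXn2r ?nnegrE ?normc_ge0 ?divr_ge0 ?(ltW e0)// => h1.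
    have := greedy N; rewrite vN -/q => /(_ Oi g1 Ag1 pg1 ng1); clear -h1; lra.
  move/eqP: ng; apply.
  have g0 z : Om z -> g z = 0.
    move=> Oz; apply/eqP; rewrite -normc_eq0 eq_le normc_ge0 andbT.
    apply/ler_addgt0Pl => e e0; rewrite addr0.
    have [s s0 hs] := hol_continuous (proj1 Ag z Oz) e0.
    have [t t0 ht] := open_vn oOm Oz.
    have [i hi] := @rational_dense z (Num.min s t) ltac:(by rewrite lt_min s0).
    move: hi; rewrite lt_min => /andP[/hs h1 /ht /key h2].
    by rewrite h2 sub0r normc_opp in h1; exact: ltW.
  rewrite /nrm2 /L2normsq (eq_integral (fun=> 0%E)) ?integral0// => t; rewrite inE => Ot.
  by rewrite g0// normc0 expr0n.
exists phi; split => // f Af.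
pose s N z := f z - \sum_(j < N) ip f (phi j) * phi j z.
have As N : A2 (s N) by apply: A2B => //; exact: (A2_sum oOm N (fun j => ip f (phi j))).
have mono N M : (N <= M)%N -> nrm2 Om (fun z => s N z - s M z) = nrm2 Om (s N) - nrm2 Om (s M).
  by move=> NM; exact: residual_diff.
have cau e : 0 < e -> exists N, forall k l, (N <= k)%N -> (N <= l)%N ->
     (L2normsq Om (fun z => s k z - s l z)%R <= (e ^+ 2)%:E)%E.
  move=> e0; have e20 : 0 < e ^+ 2 by rewrite exprn_gt0.
  have [k|k|N hN] := @monotone_cauchy R (fun N => - nrm2 Om (s N)) 0 _ _ _ e20.
  - by rewrite lerN2 -subr_ge0 -mono// nrm2_ge0.
  - by rewrite oppr_le0 nrm2_ge0.
  exists N => k l Nk Nl; wlog kl : k l Nk Nl / (k <= l)%N.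
    move=> W; have [kl|/ltnW lk] := leqP k l; first exact: W.
    rewrite (_ : L2normsq _ _ = L2normsq Om (fun z => s l z - s k z)); first exact: W.
    by apply: eq_integral => t _; rewrite normcBC.
  rewrite L2_nrm2; last exact: A2B.
  by rewrite lee_fin mono//; have := hN k l Nk kl; clear; lra.
have [g [Ag lim _ _]] := bergman_complete oOm As cau.
(* For [M > k] the residual [s M] is orthogonal to [phi k], and Bessel's inequality for [s M - g]
   bounds the coefficient of [g] by the distance from [s M] to [g]. *)
have pg k : ip g (phi k) = 0.
  apply/eqP; rewrite -normc_eq0 eq_le normc_ge0 andbT.
  apply/ler_addgt0Pl => e e0; rewrite addr0.
  have [N hN] := lim e e0; pose M := maxn N k.+1.
  have Ad : A2 (fun z => s M z - g z) by exact: A2B.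
  have h1 : nrm2 Om (fun z => s M z - g z) <= e ^+ 2.
    by have := hN M (leq_maxl _ _); rewrite L2_nrm2.
  have h2 : ip (s M) (phi k) = 0 by apply: inner_residual => //; exact: leq_maxr.
  have h3 : ip (fun z => s M z - g z) (phi k) = - ip g (phi k) by rewrite innerB// h2 sub0r.
  have := bessel_eq oOm Ap Ad (onN k.+1); rewrite big_ord_recr /= h3 normc_opp => h4.
  have := nrm2_ge0 Om (fun z => (s M z - g z) - \sum_(j < k.+1) ip (fun z => s M z - g z) (phi j) * phi j z).
  rewrite h4 => h5.
  have h6 : 0 <= \sum_(j < k) normc (ip (fun z => s M z - g z) (phi j)) ^+ 2.
    by apply: sumr_ge0 => j _; exact: sqr_ge0.
  rewrite -(ler_pXn2r (ltn0Sn 1)) ?nnegrE ?normc_ge0 ?(ltW e0)//.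
  by clear -h1 h5 h6; lra.
have g0 := nrm0_zero oOm Ag (complete g Ag pg).
have sz N : L2normsq Om (s N) = L2normsq Om (fun z => s N z - g z).
  by apply: eq_integral => t; rewrite inE => Ot; rewrite g0// subr0.
change (L2normsq Om (s N) @[N --> \oo] --> 0%E).
apply/fine_cvgP; split; first by apply: nearW => N; rewrite L2_nrm2.
apply/cvgrPdist_lt => e e0.
have [N hN] := lim (Num.sqrt (e / 2)) ltac:(by rewrite sqrtr_gt0 divr_gt0).
exists N => // k /= /hN; rewrite -sz L2_nrm2// lee_fin sqr_sqrtr ?divr_ge0 ?(ltW e0)// => h.
change (`|0 - nrm2 Om (s k)| < e); rewrite sub0r normrN ger0_norm ?nrm2_ge0//.
by clear -h e0; lra.
Qed.

End greedy_basis.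

Arguments Normc.normc : simpl never.

(** * Square summable sequences *)

Section square_summable.
Context {R : realType}.
Local Open Scope complex_scope.
Local Notation normc := (@Normc.normc R).
Implicit Types (a b c : nat -> R[i]) (K : R).

Definition l2bd a K := 0 <= K /\ forall N, \sum_(j < N) normc (a j) ^+ 2 <= K ^+ 2.
Definition l2 a := exists K, l2bd a K.

(** The quadratic polynomial [q] is a sum of squares; it is evaluated at its minimum [C / A]. *)
Lemma cauchy_schwarz_sum (I : Type) (s : seq I) (x y : I -> R) :
  (forall i, 0 <= x i) -> (forall i, 0 <= y i) ->
  (\sum_(i <- s) x i * y i) ^+ 2 <= (\sum_(i <- s) x i ^+ 2) * (\sum_(i <- s) y i ^+ 2).
Proof.
move=> x0 y0; set A := \sum_(i <- s) x i ^+ 2; set B := \sum_(i <- s) y i ^+ 2.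
set C := \sum_(i <- s) x i * y i.
have A0 : 0 <= A by apply: sumr_ge0 => i _; exact: sqr_ge0.
have q t : 0 <= A * t ^+ 2 - 2 * t * C + B.
  have -> : A * t ^+ 2 - 2 * t * C + B = \sum_(i <- s) (x i * t - y i) ^+ 2.
    rewrite /A /B /C mulr_suml mulr_sumr -sumrB -big_split /=.
    by apply: eq_bigr => i _; ring.
  by apply: sumr_ge0 => i _; exact: sqr_ge0.
have [A00|An0] := eqVneq A 0.
  have C0 : 0 <= C by apply: sumr_ge0 => i _; exact: mulr_ge0.
  have B0 : 0 <= B by apply: sumr_ge0 => i _; exact: sqr_ge0.
  rewrite A00 mul0r; have [->|Cn0] := eqVneq C 0; first by rewrite expr0n.
  have Cp : 0 < C by rewrite lt_neqAle eq_sym Cn0.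
  (* When [A = 0] the polynomial is affine, and at this [t] it would take the value [-1]. *)
  pose t := (B + 1) / (2 * C).
  have tC : t * C = (B + 1) / 2 by rewrite /t; field.
  by have := q t; rewrite A00 mul0r add0r; clear -B0 tC; lra.
have Ap : 0 < A by rewrite lt_neqAle eq_sym An0.
have := q (C / A); rewrite (_ : _ + B = B - C ^+ 2 / A); last by field.
by rewrite subr_ge0 ler_pdivrMr// mulrC.
Qed.

Definition psum2 a b N := \sum_(j < N) a j * (b j)^*.
(** The scalar product of l2, conjugate-linear in the second argument. By [pairP] the default 0 is
    never met on square summable sequences. *)
Definition pair a b : R[i] := xget 0 [set l | ccvg (psum2 a b) l].

Lemma sum_tail (V : zmodType) (u : nat -> V) k l : (k <= l)%N ->
  \sum_(j < l) u j - \sum_(j < k) u j = \sum_(k <= j < l) u j.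
Proof.
move=> kl; rewrite -!(big_mkord xpredT u) (big_cat_nat (n := k))//=.
by rewrite addrAC subrr add0r.
Qed.

Lemma psum2_tail a b k l : (k <= l)%N ->
  psum2 a b l - psum2 a b k = \sum_(k <= j < l) a j * (b j)^*.
Proof.
move=> kl; rewrite /psum2 -!(big_mkord xpredT (fun j => a j * (b j)^*)).
by rewrite (big_cat_nat (n := k))//= addrAC subrr add0r.
Qed.

Lemma tail_small a K : l2bd a K -> forall e : R, 0 < e ->
  exists N, forall k l, (N <= k)%N -> (k <= l)%N -> \sum_(k <= j < l) normc (a j) ^+ 2 < e.
Proof.
move=> [K0 hK] e e0.
have mono : {homo (fun N => \sum_(j < N) normc (a j) ^+ 2) : i j / (i <= j)%N >-> i <= j}.
  by apply: homo_leq => [//|? ? ?|k]; [exact: le_trans|rewrite big_ord_recr/= lerDl sqr_ge0].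
pose S := range (fun N => \sum_(j < N) normc (a j) ^+ 2).
have hs : has_sup S by split; [eexists; exists 0%N|exists (K ^+ 2) => _ [k _ <-]].
have [_ [N _ <-] hN] := sup_adherent e0 hs.
exists N => k l Nk kl; rewrite -sum_tail//.
have := mono _ _ Nk; have : \sum_(j < l) normc (a j) ^+ 2 <= sup S.
  by apply: ub_le_sup; [case: hs|exists l].
by move: hN; clear; lra.
Qed.

Lemma normc_sum_pair (s : seq nat) a b :
  normc (\sum_(j <- s) a j * (b j)^*) ^+ 2 <=
  (\sum_(j <- s) normc (a j) ^+ 2) * (\sum_(j <- s) normc (b j) ^+ 2).
Proof.
apply: le_trans (cauchy_schwarz_sum _ _ _); [|by move=> ?; exact: normc_ge0..].
rewrite ler_pXn2r ?nnegrE ?normc_ge0 ?sumr_ge0//; last first.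
  by move=> i _; rewrite mulr_ge0 ?normc_ge0.
apply: le_trans (normc_sum _ _) _; apply: ler_sum => i _.
by rewrite normcM normcJ.
Qed.

Lemma pairP a b : l2 a -> l2 b -> ccvg (psum2 a b) (pair a b).
Proof.
move=> [K hK] [K' hK']; suff /ccauchy_cvg h : ccauchy (psum2 a b) by exact: xgetPex h.
move=> e e0; have [N hN] := tail_small hK e0; have [N' hN'] := tail_small hK' e0.
exists (maxn N N') => k l hk hl; wlog kl : k l hk hl / (k <= l)%N.
  by move=> W; have [kl|/ltnW lk] := leqP k l; [exact: W|rewrite normcBC; exact: W].
move: hk; rewrite geq_max => /andP[Nk N'k].
rewrite normcBC psum2_tail// -(ltr_pXn2r (ltn0Sn 1)) ?nnegrE ?normc_ge0 ?(ltW e0)//.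
apply: le_lt_trans (normc_sum_pair _ a b) _.
have h1 := hN k l Nk kl; have h2 := hN' k l N'k kl.
rewrite expr2; apply: ltr_pM => //; apply: sumr_ge0 => j _; exact: sqr_ge0.
Qed.

Lemma pair_uniq a b l : l2 a -> l2 b -> ccvg (psum2 a b) l -> pair a b = l.
Proof. by move=> ha hb; apply: ccvg_uniq; exact: pairP. Qed.

Lemma pair_bd a b K K' : l2bd a K -> l2bd b K' -> normc (pair a b) <= K * K'.
Proof.
move=> ha hb; have [K0 hK] := ha; have [K'0 hK'] := hb.
have cv : ccvg (psum2 a b) (pair a b) by apply: pairP; eexists; [exact: ha|exact: hb].
rewrite -[X in normc X]subr0; apply: (ccvg_le cv); exists 0%N => N _; rewrite subr0.
rewrite -(ler_pXn2r (ltn0Sn 1)) ?nnegrE ?normc_ge0 ?mulr_ge0// exprMn.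
rewrite /psum2 -(big_mkord xpredT (fun j => a j * (b j)^*)).
apply: le_trans (normc_sum_pair _ a b) _; rewrite !big_mkord.
by apply: ler_pM => //; apply: sumr_ge0 => j _; exact: sqr_ge0.
Qed.

Lemma l2D a b : l2 a -> l2 b -> l2 (fun j => a j + b j).
Proof.
move=> [K [K0 hK]] [K' [K'0 hK']].
exists (2 * (K + K')); split; first by rewrite mulr_ge0// addr_ge0.
move=> N; apply: (@le_trans _ _ (\sum_(j < N) (2 * normc (a j) ^+ 2 + 2 * normc (b j) ^+ 2))).
  apply: ler_sum => j _; have h := normcD (a j) (b j).
  apply: (@le_trans _ _ ((normc (a j) + normc (b j)) ^+ 2)).
    by rewrite ler_pXn2r ?nnegrE ?addr_ge0 ?normc_ge0.
  by have := sqr_ge0 (normc (a j) - normc (b j)); clear; lra.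
rewrite big_split /= -!mulr_sumr; have := hK N; have := hK' N; have := mulr_ge0 K0 K'0.
have := sqr_ge0 K; have := sqr_ge0 K'.
by clear; lra.
Qed.

Lemma l2bdZ a K t : l2bd a K -> l2bd (fun j => t * a j) (normc t * K).
Proof.
move=> [K0 hK]; split; first by rewrite mulr_ge0 ?normc_ge0.
move=> N; under eq_bigr do rewrite normcM exprMn.
by rewrite -mulr_sumr exprMn ler_wpM2l ?sqr_ge0.
Qed.

Lemma l2Z a t : l2 a -> l2 (fun j => t * a j).
Proof. by move=> [K h]; exists (normc t * K); exact: l2bdZ. Qed.

Lemma pairDl a b c : l2 a -> l2 b -> l2 c ->
  pair (fun j => a j + b j) c = pair a c + pair b c.
Proof.
move=> ha hb hc; apply: pair_uniq => //; first exact: l2D.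
have := ccvgD (pairP ha hc) (pairP hb hc); apply: eq_ccvg => N.
by rewrite /psum2 -big_split; apply: eq_bigr => j _; rewrite mulrDl.
Qed.

Lemma pairZl t a c : l2 a -> l2 c -> pair (fun j => t * a j) c = t * pair a c.
Proof.
move=> ha hc; apply: pair_uniq => //; first exact: l2Z.
have := ccvgZ t (pairP ha hc); apply: eq_ccvg => N.
by rewrite /psum2 mulr_sumr; apply: eq_bigr => j _; rewrite mulrA.
Qed.

Lemma pairC a b : l2 a -> l2 b -> pair b a = (pair a b)^*.
Proof.
move=> ha hb; apply: pair_uniq => //.
have := ccvgJ (pairP ha hb); apply: eq_ccvg => N.
rewrite /psum2 [LHS]rmorph_sum; apply: eq_bigr => j _.
by rewrite rmorphM mulrC; congr (_ * _); exact: conjcK.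
Qed.

Lemma pairDr a b c : l2 a -> l2 b -> l2 c ->
  pair c (fun j => a j + b j) = pair c a + pair c b.
Proof.
move=> ha hb hc; rewrite (pairC (l2D ha hb) hc) pairDl// [LHS]rmorphD.
by rewrite (pairC ha hc) (pairC hb hc).
Qed.

Lemma pairZr t a c : l2 a -> l2 c -> pair c (fun j => t * a j) = t^* * pair c a.
Proof.
by move=> ha hc; rewrite (pairC (l2Z t ha) hc) pairZl// [LHS]rmorphM (pairC ha hc).
Qed.

Lemma ReC_ge0 (u : nat -> R[i]) l : ccvg u l -> (forall N, 0 <= complex.Re (u N)) ->
  0 <= complex.Re l.
Proof.
move=> cv h; rewrite leNgt; apply/negP => l0.
have [N hN] := cv (- complex.Re l) ltac:(by rewrite oppr_gt0).
have := hN N (leqnn _); apply/negP; rewrite -leNgt.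
apply: le_trans (normc_Re _); apply: le_trans (ler_norm _).
by rewrite rcE; have := h N; clear; lra.
Qed.

Lemma pair_real a : l2 a -> pair a a = (complex.Re (pair a a))%:C.
Proof.
move=> ha; apply: complex_ext => //=.
by have := congr1 (@complex.Im R) (pairC ha ha); case: (pair a a) => x y /=; clear; lra.
Qed.

Lemma psum2_aa a N : psum2 a a N = (\sum_(j < N) normc (a j) ^+ 2)%:C.
Proof. by rewrite /psum2 rmorph_sum; apply: eq_bigr => j _; rewrite mulcJ. Qed.

(* [pair a a] is the supremum of the partial sums, hence the optimal bound. *)
Lemma l2bd_self a : l2 a -> l2bd a (Num.sqrt (complex.Re (pair a a))).
Proof.
move=> ha; split; first exact: sqrtr_ge0.
have h N : \sum_(j < N) normc (a j) ^+ 2 <= complex.Re (pair a a).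
  apply/ler_addgt0Pl => e e0; have [M hM] := pairP ha ha e0.
  have := hM (maxn N M) (leq_maxr _ _); rewrite psum2_aa => h1.
  have := le_lt_trans (le_trans (ler_norm _) (normc_Re _)) h1; rewrite rcE /=.
  have := sum_tail (fun j => normc (a j) ^+ 2) (leq_maxl N M).
  have : 0 <= \sum_(N <= j < maxn N M) normc (a j) ^+ 2.
    by apply: sumr_ge0 => j _; exact: sqr_ge0.
  by clear; lra.
move=> N; rewrite sqr_sqrtr//; apply: le_trans (h 0%N).
by rewrite big_ord0.
Qed.

Lemma pair_ge0 a : l2 a -> 0 <= complex.Re (pair a a).
Proof.
move=> ha; apply: (ReC_ge0 (pairP ha ha)) => N; rewrite psum2_aa /=.
by apply: sumr_ge0 => j _; exact: sqr_ge0.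
Qed.

End square_summable.

(** * Wirtinger derivatives *)

Section wirtinger_expansion.
Context {R : realType}.
Local Open Scope complex_scope.
Local Notation normc := (@Normc.normc R).
Implicit Types (c d : R[i] -> R[i]) (al be : R[i]).

(** A real-linear expansion at 0: [al] and [be] are the derivatives of [c] in [a] and in the
    conjugate of [a]. Unlike the mere existence of partial derivatives, it is stable under products,
    inverses, conjugation and logarithm. *)
Definition wexp c al be := forall e : R, 0 < e -> exists2 r : R, 0 < r & forall a,
  normc a < r -> normc (c a - c 0 - (al * a + be * a^*)) <= e * normc a.

Lemma wexp_lin_bd al be (a : R[i]) :
  normc (al * a + be * a^*) <= (normc al + normc be) * normc a.
Proof. by apply: le_trans (normcD _ _) _; rewrite !normcM normcJ mulrDl. Qed.

Lemma wexp_near c d al be : (exists2 r : R, 0 < r & forall a, normc a < r -> c a = d a) ->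
  wexp c al be -> wexp d al be.
Proof.
move=> [r r0 cd] h e /h[s s0 hs]; exists (Num.min r s) => [|a]; first by rewrite lt_min r0.
rewrite lt_min => /andP[ar /hs]; rewrite cd// cd//.
by rewrite normc0.
Qed.

Lemma wexp_quad c al be (K r : R) : 0 < r -> (forall a, normc a < r ->
    normc (c a - c 0 - (al * a + be * a^*)) <= K * normc a ^+ 2) -> wexp c al be.
Proof.
move=> r0 h e e0; exists (Num.min r (e / (`|K| + 1))) => [|a].
  by rewrite lt_min r0 divr_gt0// ltr_wpDl.
rewrite lt_min ltr_pdivlMr ?ltr_wpDl// => /andP[/h h1 h2].
apply: le_trans h1 _; rewrite expr2 mulrA ler_wpM2r ?normc_ge0//.
have := ler_norm K; have := normc_ge0 a; move: h2; move: (normc a) (`|K|) => x y.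
by clear; nra.
Qed.

Lemma wexp_lip c al be : wexp c al be -> exists r L : R, [/\ 0 < r, 0 <= L &
  forall a, normc a < r -> normc (c a - c 0) <= L * normc a].
Proof.
move=> /(_ 1 ltr01)[r r0 hr]; exists r, (1 + (normc al + normc be)); split => //.
  by rewrite !addr_ge0 ?normc_ge0.
move=> a /hr h; have h2 := wexp_lin_bd al be a.
have := normcD (c a - c 0 - (al * a + be * a^*)) (al * a + be * a^*).
by rewrite subrK; clear -h h2; lra.
Qed.

Lemma wexp_small c al be : wexp c al be -> forall e : R, 0 < e ->
  exists2 r : R, 0 < r & forall a, normc a < r -> normc (c a - c 0) < e.
Proof.
move=> /wexp_lip[r [L [r0 L0 h]]] e e0; exists (Num.min r (e / (L + 1))) => [|a].
  by rewrite lt_min r0 divr_gt0//; clear -L0; lra.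
rewrite lt_min ltr_pdivlMr; last by clear -L0; lra.
move=> /andP[/h h1 h2]; apply: le_lt_trans h1 _.
by have := normc_ge0 a; clear -h2; lra.
Qed.

Lemma wexpM c d al be al' be' : wexp c al be -> wexp d al' be' ->
  wexp (fun a => c a * d a) (al * d 0 + c 0 * al') (be * d 0 + c 0 * be').
Proof.
move=> hc hd e e0.
pose C := normc (c 0); pose D := normc (d 0); pose L := normc al + normc be.
have C0 : 0 <= C by exact: normc_ge0.
have D0 : 0 <= D by exact: normc_ge0.
have L0 : 0 <= L by rewrite addr_ge0 ?normc_ge0.
pose e1 := e / (3 * (C + D + L + 1)).
have W0 : 0 < 3 * (C + D + L + 1) by clear -C0 D0 L0; lra.
have e10 : 0 < e1 by exact: divr_gt0.
have eE : e1 * (3 * (C + D + L + 1)) = e by rewrite divfK// gt_eqF.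
have [r r0 hr] := hc _ e10; have [r' r'0 hr'] := hd _ e10.
have [s s0 hs] := wexp_small hd e10; have [s' s'0 hs'] := wexp_small hd ltr01.
exists (Num.min (Num.min r r') (Num.min s s')) => [|a]; first by rewrite !lt_min r0 r'0 s0.
rewrite !lt_min => /andP[/andP[/hr h1 /hr' h2] /andP[/hs h3 /hs' h4]].
have -> : c a * d a - c 0 * d 0 - ((al * d 0 + c 0 * al') * a + (be * d 0 + c 0 * be') * a^*) =
  (c a - c 0 - (al * a + be * a^*)) * d a + (al * a + be * a^*) * (d a - d 0) +
  c 0 * (d a - d 0 - (al' * a + be' * a^*)) by ring.
have A0 := normc_ge0 a.
have hl := wexp_lin_bd al be a; rewrite -/L in hl.
have da : normc (d a) <= D + 1.
  by have := normc_lower (d a) (d 0); rewrite -/D; clear -h4; lra.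
have t1 : normc ((c a - c 0 - (al * a + be * a^*)) * d a) <= e1 * normc a * (D + 1).
  by rewrite normcM; apply: ler_pM; rewrite ?normc_ge0.
have t2 : normc ((al * a + be * a^*) * (d a - d 0)) <= L * normc a * e1.
  by rewrite normcM; apply: ler_pM; rewrite ?normc_ge0// ltW.
have t3 : normc (c 0 * (d a - d 0 - (al' * a + be' * a^*))) <= C * (e1 * normc a).
  by rewrite normcM; apply: ler_pM; rewrite ?normc_ge0.
apply: le_trans (normcD _ _) _; apply: le_trans (lerD (normcD _ _) t3) _.
have : 0 <= e1 * normc a by rewrite mulr_ge0// ltW.
move: t1 t2; rewrite -eE; move: (normc (_ * d a)) (normc ((_ + _) * (_ - _))) => x y t1 t2 P.
have PC := mulr_ge0 P C0; have PD := mulr_ge0 P D0; have PL := mulr_ge0 P L0.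
by clear -t1 t2 P PC PD PL; lra.
Qed.

Lemma wexpV c al be : c 0 != 0 -> wexp c al be ->
  wexp (fun a => (c a)^-1) (- al / c 0 ^+ 2) (- be / c 0 ^+ 2).
Proof.
move=> c00 hc e e0; have C0 : 0 < normc (c 0) by rewrite normc_gt0.
set C := normc (c 0) in C0.
pose L := normc al + normc be; have L0 : 0 <= L by rewrite addr_ge0 ?normc_ge0.
(* A lower bound for the modulus of the denominator [c 0 ^+ 2 * c a], valid once [|c a| > C / 2]. *)
pose q := C ^+ 2 * C / 2; have q0 : 0 < q by rewrite divr_gt0// mulr_gt0// exprn_gt0.
pose e1 := e * q / (L + C + 1).
have W0 : 0 < L + C + 1 by clear -C0 L0; lra.
have e10 : 0 < e1 by rewrite divr_gt0// mulr_gt0.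
have eE : e1 * (L + C + 1) = e * q by rewrite divfK// gt_eqF.
have [r r0 hr] := hc _ e10; have [s s0 hs] := wexp_small hc e10.
have C20 : 0 < C / 2 by rewrite divr_gt0.
have [s' s'0 hs'] := wexp_small hc C20.
  exists (Num.min r (Num.min s s')) => [|a]; first by rewrite !lt_min r0 s0.
  rewrite !lt_min => /and3P[/hr h1 /hs h2 /hs' h3].
  have ca : C / 2 < normc (c a).
    by have := normc_lower (c 0) (c a); rewrite normcBC -/C; clear -h3; lra.
  have ca0 : c a != 0 by rewrite -normc_gt0; clear -ca C0; lra.
  have -> : (c a)^-1 - (c 0)^-1 - (- al / c 0 ^+ 2 * a + - be / c 0 ^+ 2 * a^*) =
    ((al * a + be * a^*) * (c a - c 0) - (c a - c 0 - (al * a + be * a^*)) * c 0) / (c 0 ^+ 2 * c a).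
    by field; rewrite c00 ca0.
  have hl := wexp_lin_bd al be a; rewrite -/L in hl; have A0 := normc_ge0 a.
  rewrite normcM normcV ler_pdivrMr; last by rewrite normc_gt0 mulf_neq0 ?expf_neq0.
  apply: (@le_trans _ _ (e1 * (L + C + 1) * normc a)); last first.
    rewrite eE mulrAC ler_wpM2l//; first by rewrite mulr_ge0// ltW.
    rewrite normcM normcX -/C /q -mulrA ler_wpM2l ?sqr_ge0//; exact: ltW.
  have t1 : normc ((al * a + be * a^*) * (c a - c 0)) <= L * normc a * e1.
    by rewrite normcM; apply: ler_pM; rewrite ?normc_ge0// ltW.
  have t2 : normc ((c a - c 0 - (al * a + be * a^*)) * c 0) <= e1 * normc a * C.
    by rewrite normcM -/C ler_wpM2r// ltW.
  apply: le_trans (normcB _ _) _.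
  have : 0 <= e1 * normc a by rewrite mulr_ge0// ltW.
  by move: t1 t2; clear; lra.
Qed.

Lemma ReJ (x : R[i]) : complex.Re x^* = complex.Re x. Proof. by case: x. Qed.
Lemma ImJ (x : R[i]) : complex.Im x^* = - complex.Im x. Proof. by case: x. Qed.

Lemma wexp_conj c al be : wexp c al be -> wexp (fun a => (c a)^*) be^* al^*.
Proof.
move=> h e /h[r r0 hr]; exists r => // a /hr.
have -> : (c a)^* - (c 0)^* - (be^* * a + al^* * a^*) =
    (c a - c 0 - (al * a + be * a^*))^*.
  by apply: complex_ext; rewrite !(rcE, ReJ, ImJ); ring.
by rewrite normcJ.
Qed.

(** The inequality [ln v <= v - 1] at [u] and at [u^-1] encloses [ln u]; the gap is
    [(u - 1) ^+ 2 / u], and [u >= 1 / 2]. *)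
Lemma ln_quad (u : R) : 2^-1 <= u -> `|ln u - (u - 1)| <= 2 * (u - 1) ^+ 2.
Proof.
move=> u2; have u0 : 0 < u by clear -u2; lra.
have le (v : R) : 0 < v -> ln v <= v - 1.
  move=> v0; have := @le_ln1Dx R (v - 1); rewrite (_ : 1 + (v - 1) = v); last by ring.
  by apply; clear -v0; lra.
have h1 := le u u0.
have h2 : 1 - u^-1 <= ln u.
  have := le u^-1; rewrite invr_gt0 lnV ?posrE// => /(_ u0); clear; lra.
rewrite ler_norml; apply/andP; split; last first.
  by have := sqr_ge0 (u - 1); clear -h1; lra.
apply: (@le_trans _ _ (1 - u^-1 - (u - 1))); last by clear -h2; lra.
rewrite -(ler_pM2r u0) [leRHS](_ : _ = - (u - 1) ^+ 2); last by field; rewrite gt_eqF.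
have := sqr_ge0 (u - 1); clear -u2; nra.
Qed.

Lemma wexp_ln (k : R[i] -> R) al be : 0 < k 0 -> wexp (fun a => (k a)%:C) al be ->
  wexp (fun a => (ln (k a))%:C) (al / (k 0)%:C) (be / (k 0)%:C).
Proof.
move=> k0 hk; have [s [L [s0 L0 hL]]] := wexp_lip hk.
move=> e e0; set K := k 0 in k0 *.
have ek0 : 0 < e * K / 2 by rewrite divr_gt0// mulr_gt0.
have [r r0 hr] := hk _ ek0.
have k20 : 0 < K / 2 by rewrite divr_gt0.
have [t t0 ht] := wexp_small hk k20.
pose p := e * K ^+ 2 / (4 * (L ^+ 2 + 1)).
have L2 := sqr_ge0 L.
have p0 : 0 < p by rewrite divr_gt0 ?mulr_gt0 ?exprn_gt0//; clear -L2; lra.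
exists (Num.min (Num.min s r) (Num.min t p)) => [|a]; first by rewrite !lt_min s0 r0 t0.
rewrite !lt_min => /andP[/andP[/hL h1 /hr h2] /andP[/ht h3 h4]].
rewrite -rmorphB normcR in h1; rewrite -rmorphB normcR in h3; rewrite -/K in h1 h2 h3 *.
have ka : K / 2 < k a by move: h3; rewrite ltr_norml; clear; lra.
have ka0 : 0 < k a by clear -ka k0; lra.
have A0 := normc_ge0 a.
pose u := k a / K.
have uK : u * K = k a by rewrite divfK// gt_eqF.
have u2 : 2^-1 <= u by rewrite -(ler_pM2r k0) uK; clear -ka; lra.
have lnE : ln (k a) - ln K = ln u by rewrite /u ln_div ?posrE.
have -> : (ln (k a))%:C - (ln K)%:C - (al / K%:C * a + be / K%:C * a^*) =
    (ln u - (u - 1))%:C + ((k a)%:C - K%:C - (al * a + be * a^*)) / K%:C.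
  have uC : u%:C = (k a)%:C / K%:C by rewrite -fmorphV -rmorphM.
  have lnC : (ln u)%:C = (ln (k a))%:C - (ln K)%:C by rewrite -lnE rmorphB.
  rewrite !rmorphB /= lnC uC; field.
  by apply/eqP => /complexI/eqP; rewrite gt_eqF.
apply: le_trans (normcD _ _) _; rewrite normcR normcM normcV normcR (gtr0_norm k0).
have t2 : normc ((k a)%:C - K%:C - (al * a + be * a^*)) / K <= e / 2 * normc a.
  rewrite ler_pdivrMr//; apply: le_trans h2 _.
  by rewrite le_eqVlt; apply/orP; left; apply/eqP; ring.
have t1 : `|ln u - (u - 1)| <= e / 2 * normc a.
  apply: le_trans (ln_quad u2) _.
  have -> : u - 1 = (k a - K) / K by rewrite mulrBl divff ?gt_eqF.
  rewrite exprMn exprVn mulrA ler_pdivrMr ?exprn_gt0//.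
  have q1 : (k a - K) ^+ 2 <= L ^+ 2 * normc a ^+ 2.
    by rewrite -exprMn -[X in X <= _]real_normK ?num_real// ler_pXn2r ?nnegrE ?mulr_ge0.
  have q2 : normc a * (4 * (L ^+ 2 + 1)) < e * K ^+ 2.
    by rewrite -ltr_pdivlMr//; clear -L2; lra.
  have q3 : normc a * (normc a * (4 * (L ^+ 2 + 1))) <= normc a * (e * K ^+ 2).
    by rewrite ler_wpM2l// ltW.
  have q4 : 0 <= normc a ^+ 2 by exact: sqr_ge0.
  by clear -q1 q3 q4; lra.
by clear -t1 t2; lra.
Qed.

Lemma ccvg_lim (u : nat -> R[i]) l : ccvg u l -> limn u = l.
Proof.
move=> h; apply: cvg_lim; first exact: norm_hausdorff.
apply/cvgrPdist_lt => e /ltcRe[ee e0]; have [N hN] := h _ e0.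
by exists N => // k /= /hN; rewrite normcBC normcE_def ee ltcR.
Qed.

(** [p] stands for the real or the imaginary part; only additivity, real homogeneity and
    [|p x| <= |x|] enter, so both are treated at once. *)
Lemma derive1_wexp c al be (w : R[i]) (f : R -> R) (p : R[i] -> R) :
  (forall x y, p (x + y) = p x + p y) -> (forall x, p (- x) = - p x) ->
  (forall x, `|p x| <= normc x) -> (forall (t : R) x, p (t%:C * x) = t * p x) ->
  wexp c al be -> normc w = 1 -> (forall t, f t = p (c (t%:C * w))) ->
  derive1 f 0 = p (al * w + be * w^*).
Proof.
move=> pD pN pB pZ h w1 fE; rewrite /derive1; apply: cvg_lim; first exact: norm_hausdorff.
apply/cvgrPdist_lt => e e0; have e20 : 0 < e / 2 by clear -e0; lra.
have [r r0 hr] := h _ e20.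
apply/nbhs_ballP; exists r => //= t; rewrite -ball_normE /ball_ /= sub0r normrN => tr t0.
have nt : normc (t%:C * w) = `|t| by rewrite normcM normcR w1 mulr1.
have := hr (t%:C * w); rewrite nt => /(_ tr) h1.
rewrite addr0 !fE mul0r -[X in `|X|]opprK normrN opprB /GRing.scale /=.
have -> : t^-1 * (p (c (t%:C * w)) - p (c 0)) - p (al * w + be * w^*) =
    t^-1 * p (c (t%:C * w) - c 0 - (al * (t%:C * w) + be * (t%:C * w)^*)).
  have -> : al * (t%:C * w) + be * (t%:C * w)^* = t%:C * (al * w + be * w^*).
    by apply: complex_ext; rewrite !(rcE, ReJ, ImJ) /=; ring.
  by rewrite !(pD, pN) pZ !pD; field.
rewrite normrM normfV mulrC ltr_pdivrMr ?normr_gt0//.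
apply: le_lt_trans (pB _) _; apply: le_lt_trans h1 _.
by rewrite ltr_pM2r ?normr_gt0//; clear -e0; lra.
Qed.

(** Applied with [w] equal to 1 and to ['i]. The conjugate is a separate variable [w'] so that it
    can be given as 1 and as [- 'i]. *)
Lemma real_derive_wexp n (g : 'rV[R[i]]_n -> R[i]) (z X : 'rV[R[i]]_n) al be w w' :
  normc w = 1 -> w' = w^* -> wexp (fun a => g (z + a *: X)) al be ->
  real_derive (w *: X) g z = al * w + be * w'.
Proof.
move=> w1 -> h; apply: complex_ext.
  apply: (@derive1_wexp _ al be w _ (@complex.Re R) _ _ _ _ h) => //.
  - exact: ReD. - exact: ReN. - exact: normc_Re.
  - by move=> t x; rewrite rcE /=; ring.
  - by move=> t; rewrite scalerA.
apply: (@derive1_wexp _ al be w _ (@complex.Im R) _ _ _ _ h) => //.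
- exact: ImD. - exact: ImN. - exact: normc_Im.
- by move=> t x; rewrite rcE /=; ring.
- by move=> t; rewrite scalerA.
Qed.

Lemma dz_wexp n (g : 'rV[R[i]]_n -> R[i]) (z : 'rV[R[i]]_n) (j : 'I_n) al be :
  wexp (fun a => g (z + a *: delta_mx 0 j)) al be -> dz j g z = al /\ dzbar j g z = be.
Proof.
move=> h; have h1 := real_derive_wexp normc1 (esym (conjc1 R)) h.
have ci : - 'i%C = ('i%C : R[i])^* by apply: complex_ext; rewrite /= ?oppr0.
have hi := real_derive_wexp normci ci h.
rewrite scale1r in h1; rewrite /dz /dzbar h1 hi.
have ii : 'i%C * 'i%C = -1 :> R[i] by rewrite -expr2 sqr_i.
have e1 : 'i%C * (al * 'i%C + be * - 'i%C) = - al + be :> R[i].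
  rewrite (_ : _ * _ = ('i%C * 'i%C) * (al - be)); last by ring.
  by rewrite ii; ring.
by rewrite e1 !mulr1; split; field.
Qed.

End wirtinger_expansion.

(** * Expansions of scalar products of curves in l2 *)

Section pair_expansion.
Context {R : realType}.
Local Open Scope complex_scope.
Local Notation normc := (@Normc.normc R).
Implicit Types (a b c : nat -> R[i]).

Lemma l2_sum (I : Type) (s : seq I) (x : I -> R[i]) (A : I -> nat -> R[i]) :
  (forall i, l2 (A i)) -> l2 (fun j => \sum_(i <- s) x i * A i j).
Proof.
move=> hA; elim: s => [|i s IH].
  exists 0; split => // N; rewrite expr0n big1// => j _.
  by rewrite big_nil normc0 expr0n.
have -> : (fun j => \sum_(i0 <- i :: s) x i0 * A i0 j) =
    (fun j => x i * A i j + \sum_(i <- s) x i * A i j).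
  by apply/funext => j; rewrite big_cons.
by apply: l2D => //; exact: l2Z.
Qed.

Lemma pair_suml (I : Type) (s : seq I) (x : I -> R[i]) (A : I -> nat -> R[i]) b :
  (forall i, l2 (A i)) -> l2 b ->
  pair (fun j => \sum_(i <- s) x i * A i j) b = \sum_(i <- s) x i * pair (A i) b.
Proof.
move=> hA hb; elim: s => [|i s IH].
  rewrite big_nil -[RHS](mul0r (pair b b)) -(pairZl 0 hb hb).
  by congr pair; apply/funext => j; rewrite big_nil mul0r.
rewrite big_cons -IH -pairZl// -pairDl//; [|exact: l2Z|exact: l2_sum].
by congr pair; apply/funext => j; rewrite big_cons.
Qed.

Lemma pair_sumr (I : Type) (s : seq I) (x : I -> R[i]) (A : I -> nat -> R[i]) b :
  (forall i, l2 (A i)) -> l2 b ->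
  pair b (fun j => \sum_(i <- s) x i * A i j) = \sum_(i <- s) (x i)^* * pair b (A i).
Proof.
move=> hA hb; rewrite (pairC (l2_sum s x hA) hb) pair_suml// [LHS]rmorph_sum.
by apply: eq_bigr => i _; rewrite [LHS]rmorphM (pairC (hA i) hb).
Qed.

Lemma pairBl a b c : l2 a -> l2 b -> l2 c -> pair (fun j => a j - b j) c = pair a c - pair b c.
Proof.
move=> ha hb hc; rewrite -mulN1r -(pairZl (-1) hb hc) -(pairDl ha (l2Z (-1) hb) hc).
by congr pair; apply/funext => j; rewrite mulN1r.
Qed.

Lemma l2B a b : l2 a -> l2 b -> l2 (fun j => a j - b j).
Proof.
move=> ha hb; have := l2D ha (l2Z (-1) hb).
by congr l2; apply/funext => j; rewrite mulN1r.
Qed.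

Lemma pairBr a b c : l2 a -> l2 b -> l2 c -> pair c (fun j => a j - b j) = pair c a - pair c b.
Proof.
move=> ha hb hc; rewrite (pairC (l2B ha hb) hc) pairBl// [LHS]rmorphB.
by rewrite (pairC ha hc) (pairC hb hc).
Qed.

(** Both curves are complex differentiable at 0 with quadratic remainder in l2. As [pair] is
    conjugate-linear on the right, the derivative of [A] goes to the coefficient of [a] and that of
    [B] to the coefficient of its conjugate. The scalar series is never differentiated term by
    term. *)
Lemma wexp_pair (A B : R[i] -> nat -> R[i]) (A1 B1 : nat -> R[i]) (r K : R) :
  0 < r -> 0 <= K -> l2 (A 0) -> l2 (B 0) -> l2 A1 -> l2 B1 ->
  (forall a : R[i], normc a < r -> l2bd (fun j => A a j - A 0 j - a * A1 j) (K * normc a ^+ 2)) ->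
  (forall a : R[i], normc a < r -> l2bd (fun j => B a j - B 0 j - a * B1 j) (K * normc a ^+ 2)) ->
  wexp (fun a : R[i] => pair (A a) (B a)) (pair A1 (B 0)) (pair (A 0) B1).
Proof.
move=> r0 K0 [kA hA] [kB hB] [kA1 hA1] [kB1 hB1] RA RB.
have lA : l2 (A 0) by exists kA. have lB : l2 (B 0) by exists kB.
have lA1 : l2 A1 by exists kA1. have lB1 : l2 B1 by exists kB1.
have [a0 _] := hA; have [b0 _] := hB; have [a10 _] := hA1; have [b10 _] := hB1.
(* One summand for each of the six terms beyond first order; [|a| < 1] absorbs powers higher than
   the second. *)
pose C := kA1 * kB1 + K * kB + K * kB1 + K * K + kA * K + kA1 * K.
apply: (@wexp_quad _ _ _ _ C (Num.min r 1)); first by rewrite lt_min r0 ltr01.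
move=> a; rewrite lt_min => /andP[ar a1].
set x := normc a in a1 *; have x0 : 0 <= x by exact: normc_ge0.
pose rA j := A a j - A 0 j - a * A1 j; pose rB j := B a j - B 0 j - a * B1 j.
have hrA : l2bd rA (K * x ^+ 2) by exact: RA.
have hrB : l2bd rB (K * x ^+ 2) by exact: RB.
have lrA : l2 rA by eexists; exact: hrA.
have lrB : l2 rB by eexists; exact: hrB.
have AE : A a = fun j => (A 0 j + a * A1 j) + rA j by apply/funext => j; rewrite /rA; ring.
have BE : B a = fun j => (B 0 j + a * B1 j) + rB j by apply/funext => j; rewrite /rB; ring.
have laA1 := l2Z a lA1; have laB1 := l2Z a lB1.
have lA' := l2D lA laA1; have lB' := l2D lB laB1; have lBa := l2D lB' lrB.
have -> : pair (A a) (B a) = pair (A 0) (B 0) + a * pair A1 (B 0) + a^* * pair (A 0) B1 +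
    (a * a^* * pair A1 B1 + (pair rA (B 0) + a^* * pair rA B1 + pair rA rB) +
     (pair (A 0) rB + a * pair A1 rB)).
  rewrite AE BE (pairDl lA' lrA lBa) (pairDr lB' lrB lA') (pairDr lB' lrB lrA).
  rewrite (pairDr lB laB1 lrA) (pairDl lA laA1 lB') (pairDr lB laB1 lA) (pairDr lB laB1 laA1).
  rewrite (pairDl lA laA1 lrB) !pairZl// !pairZr//; ring.
rewrite (_ : _ - _ - _ = a * a^* * pair A1 B1 + (pair rA (B 0) + a^* * pair rA B1 + pair rA rB) +
     (pair (A 0) rB + a * pair A1 rB)); last by ring.
have t1 : normc (a * a^* * pair A1 B1) <= x ^+ 2 * (kA1 * kB1).
  rewrite normcM normcM normcJ -/x -expr2 ler_wpM2l ?sqr_ge0//; exact: pair_bd.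
have t2 : normc (pair rA (B 0)) <= K * x ^+ 2 * kB by exact: pair_bd.
have Kx : 0 <= K * x ^+ 2 by rewrite mulr_ge0// sqr_ge0.
have sm y : 0 <= y -> x * y <= y by move=> y0; rewrite ler_piMl// ltW.
have t3 : normc (a^* * pair rA B1) <= K * x ^+ 2 * kB1.
  rewrite normcM normcJ; apply: le_trans (sm _ _); last by rewrite mulr_ge0.
  by rewrite ler_wpM2l//; exact: pair_bd.
have t4 : normc (pair rA rB) <= K * x ^+ 2 * K.
  apply: le_trans (pair_bd hrA hrB) _; rewrite ler_wpM2l// ler_piMr//.
  by rewrite expr_le1// ltW.
have t5 : normc (pair (A 0) rB) <= kA * (K * x ^+ 2) by exact: pair_bd.
have t6 : normc (a * pair A1 rB) <= kA1 * (K * x ^+ 2).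
  rewrite normcM; apply: le_trans (sm _ _); last by rewrite mulr_ge0.
  by rewrite ler_wpM2l//; exact: pair_bd.
have e1 := normcD (a * a^* * pair A1 B1 + (pair rA (B 0) + a^* * pair rA B1 + pair rA rB))
  (pair (A 0) rB + a * pair A1 rB).
have e2 := normcD (a * a^* * pair A1 B1) (pair rA (B 0) + a^* * pair rA B1 + pair rA rB).
have e3 := normcD (pair rA (B 0) + a^* * pair rA B1) (pair rA rB).
have e4 := normcD (pair rA (B 0)) (a^* * pair rA B1).
have e5 := normcD (pair (A 0) rB) (a * pair A1 rB).
rewrite /C; clear -t1 t2 t3 t4 t5 t6 e1 e2 e3 e4 e5; lra.
Qed.

End pair_expansion.

(** * The Bergman metric and the Berezin kernel *)

Section kernel.
Context {R : realType} {n : nat}.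
Local Open Scope complex_scope.
Local Notation normc := (@Normc.normc R).
Local Notation Cn := 'rV[R[i]]_n.+1.
Implicit Types (z w v X : Cn) (f g h : Cn -> R[i]) (L : (Cn -> R[i]) -> R[i]).
Variable Om : set Cn.
Hypothesis bd : bounded_domain Om.
Local Notation A2 := (bergman_space Om).
Local Notation ip := (inner Om).
Local Notation phi := (bergman_basis Om).

Let oOm : open Om. Proof. by case: bd. Qed.

Lemma bergman_basisP : bergman_orthonormal_basis Om phi.
Proof.
have [nO oO _ bO] := bd; have [p hp] := orthonormal_basis_exists oO bO nO.
exact: (@xgetPex _ _ (bergman_orthonormal_basis Om) (ex_intro _ p hp)).
Qed.

Lemma A2_phi j : A2 (phi j). Proof. by have [] := bergman_basisP. Qed.

Lemma on_phi N : orthonormal_upto Om phi N.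
Proof. by move=> j k _ _; have [_ + _] := bergman_basisP. Qed.

(** Bounded linear functionals on [A^2]. They accept arbitrary functions, so linearity and bound are
    required on members of [A^2] only. *)
Definition bdlin L :=
  (forall a f g, A2 f -> A2 g -> L (fun z => a * f z + g z) = a * L f + L g) /\
  exists2 K : R, 0 <= K & forall f, A2 f -> normc (L f) <= K * nrm Om f.

Lemma bdlin_sum L N (c : nat -> R[i]) : bdlin L ->
  L (fun z => \sum_(j < N) c j * phi j z) = \sum_(j < N) c j * L (phi j).
Proof.
move=> [lin _]; elim: N => [|N IH].
  rewrite big_ord0 -[RHS](addNr (L (fun=> 0))) -mulN1r -(lin (-1) _ _ (A20 Om) (A20 Om)).
  by congr L; apply/funext => z; rewrite big_ord0 mulr0 addr0.
rewrite big_ord_recr /= -IH addrC -lin//; [|exact: A2_phi|exact: (A2_sum oOm _ _ A2_phi)].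
by congr L; apply/funext => z; rewrite big_ord_recr /= addrC.
Qed.

Lemma bdlinB L f g : bdlin L -> A2 f -> A2 g -> L (fun z => f z - g z) = L f - L g.
Proof.
move=> [lin _] Af Ag; rewrite -mulN1r addrC -lin//; congr L.
by apply/funext => z; rewrite mulN1r addrC.
Qed.

Lemma bdlin_l2bd L K : bdlin L -> 0 <= K -> (forall f, A2 f -> normc (L f) <= K * nrm Om f) ->
  l2bd (fun j => L (phi j)) K.
Proof.
move=> hL K0 hK; split => // N.
apply: (bessel_functional oOm A2_phi K0 (@on_phi N)) => // c; exact: bdlin_sum.
Qed.

Lemma bdlin_l2 L : bdlin L -> l2 (fun j => L (phi j)).
Proof. by move=> hL; have [_ [K K0 hK]] := hL; exists K; exact: bdlin_l2bd. Qed.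

Lemma residual_small f : A2 f -> forall e : R, 0 < e -> exists N, forall k, (N <= k)%N ->
  nrm Om (fun z => f z - \sum_(j < k) ip f (phi j) * phi j z) < e.
Proof.
move=> Af e e0; have [_ _ /(_ f Af)] := bergman_basisP.
move=> /fine_cvgP[_ /cvgrPdist_lt /(_ (e ^+ 2))]; rewrite exprn_gt0// => /(_ isT)[N _ hN].
exists N => k /hN; rewrite /= sub0r normrN => h.
rewrite -(ltr_pXn2r (ltn0Sn 1)) ?nnegrE ?nrm_ge0 ?(ltW e0)// sqr_nrm.
exact: le_lt_trans (ler_norm _) h.
Qed.

(* Duality: on [A2], the norm of a functional is the l2 norm of its values on
   the basis. *)
Lemma dual_bound L K f : bdlin L -> l2bd (fun j => L (phi j)) K -> A2 f ->
  normc (L f) <= K * nrm Om f.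
Proof.
move=> hL [K0 hK] Af; have [_ [M M0 hM]] := hL.
apply/ler_addgt0Pl => e e0.
have M1 : 0 < M + 1 by clear -bd oOm M0; lra.
have [N hN] := residual_small Af (divr_gt0 e0 M1).
have Ap := A2_sum oOm N (fun j => ip f (phi j)) A2_phi.
have hr := hN N (leqnn N); rewrite ltr_pdivlMr// in hr.
have h1 := hM _ (A2B oOm Af Ap); rewrite bdlinB// (bdlin_sum _ (fun j => ip f (phi j)))// in h1.
have n0 := nrm_ge0 Om (fun z => f z - \sum_(j < N) ip f (phi j) * phi j z).
have h2 : normc (\sum_(j < N) ip f (phi j) * L (phi j)) <= K * nrm Om f.
  rewrite -(ler_pXn2r (ltn0Sn 1)) ?nnegrE ?normc_ge0 ?mulr_ge0 ?nrm_ge0//.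
  rewrite exprMn sqr_nrm mulrC.
  have -> : \sum_(j < N) ip f (phi j) * L (phi j) =
      \sum_(j <- iota 0 N) ip f (phi j) * ((L (phi j))^*)^*.
    rewrite -[N in iota _ N]subn0 big_mkord; apply: eq_bigr => j _.
    by congr (_ * _); rewrite [RHS]conjcK.
  apply: le_trans (normc_sum_pair _ _ (fun j => (L (phi j))^*)) _.
  rewrite -[N in iota _ N]subn0 !big_mkord.
  apply: ler_pM; do ?[by apply: sumr_ge0 => j _; exact: sqr_ge0].
    have := bessel_eq oOm A2_phi Af (@on_phi N).
    have := nrm2_ge0 Om (fun z => f z - \sum_(j < N) ip f (phi j) * phi j z).
    by clear -bd oOm; lra.
  by under eq_bigr do rewrite normcJ.
have := normcD (L f - \sum_(j < N) ip f (phi j) * L (phi j)) (\sum_(j < N) ip f (phi j) * L (phi j)).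
rewrite subrK; clear -bd oOm h1 h2 hr n0 M0 e0; lra.
Qed.

Lemma cdif_lin z v a f g : Om z -> A2 f -> A2 g ->
  cdif (fun z => a * f z + g z) z v = a * cdif f z v + cdif g z v.
Proof.
move=> Oz [hf _] [hg _]; have hF := differentiable_fder (hf z Oz).
have hG := differentiable_fder (hg z Oz).
pose l v := a * cdif f z v + cdif g z v.
suff h : fder (fun z => a * f z + g z) z l.
  have ll : linear l by move=> b u w; rewrite /l !cdif_linear /GRing.scale /=; ring.
  by have [_ ->] := fder_differentiable ll h.
move=> e e0; have a0 := normc_ge0 a.
have W : 0 < normc a + 1 by clear -bd oOm a0; lra.
have [r r0 hr] := hF _ (divr_gt0 e0 (mulr_gt0 (ltr0Sn _ 1) W)).
have e20 : 0 < e / 2 by clear -bd oOm e0; lra.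
have [s s0 hs] := hG _ e20.
exists (Num.min r s) => [|u]; first by rewrite lt_min r0.
rewrite lt_min => /andP[/hr h1 /hs h2].
rewrite /l (_ : _ - _ - _ = a * (f (z + u) - f z - cdif f z u) + (g (z + u) - g z - cdif g z u)); last by ring.
apply: le_trans (normcD _ _) _; rewrite normcM.
have u0 := vn_ge0 u.
have q : normc a * normc (f (z + u) - f z - cdif f z u) <= e / 2 * vn u.
  apply: (@le_trans _ _ ((normc a + 1) * (e / (2 * (normc a + 1)) * vn u))).
    by apply: ler_pM; rewrite ?normc_ge0//; clear -bd oOm; lra.
  rewrite le_eqVlt; apply/orP; left; apply/eqP; field.
  by rewrite gt_eqF.
by move: h2 q; clear -bd oOm; lra.
Qed.

Definition kE z : nat -> R[i] := fun j => phi j z.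
Definition kD z v : nat -> R[i] := fun j => cdif (phi j) z v.

Lemma bdlin_comb L L' a : bdlin L -> bdlin L' -> bdlin (fun f => L f - a * L' f).
Proof.
move=> [l1 [K K0 hK]] [l2 [K' K'0 hK']]; split.
  by move=> b f g Af Ag; rewrite l1// l2//; ring.
exists (K + normc a * K'); first by rewrite addr_ge0// mulr_ge0 ?normc_ge0.
move=> f Af; apply: le_trans (normcB _ _) _; rewrite normcM mulrDl.
by apply: lerD; [exact: hK|rewrite -mulrA ler_wpM2l ?normc_ge0 ?hK'].
Qed.

(** The transfer of [local_bounds] to l2: its constants hold for every [f] in [A^2], so they bound
    the norms of evaluation, differential and Taylor remainder as functionals, and Bessel turns
    these into bounds for the sequences of values on the basis. *)
Lemma local_family z : Om z -> exists r c : R, [/\ 0 < r, 0 < c &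
  forall w, vn (w - z) < r -> [/\ Om w,
   bdlin (fun f => f w) /\ l2bd (kE w) c,
   forall v, bdlin (fun f => cdif f w v) /\ l2bd (kD w v) (c * vn v) &
   forall v, vn v < r -> l2bd (fun j => kE (w + v) j - kE w j - kD w v j) (c * vn v ^+ 2)]].
Proof.
move=> Oz; have [r [c [r0 c0 hO hb]]] := local_bounds oOm Oz.
exists (r / 2), c; split => //; first by clear -bd oOm r0; lra.
move=> w wz; have wr : vn (w - z) < r by clear -bd oOm wz r0; lra.
have Ow := hO w wr.
have hb' f : A2 f -> [/\ normc (f w) <= c * nrm Om f,
      forall v, normc (cdif f w v) <= c * nrm Om f * vn v &
      forall v, vn v < r -> normc (f (w + v) - f w - cdif f w v) <= c * nrm Om f * vn v ^+ 2].
  by move=> Af; apply: hb => //; [case: Af|exact: nrm_ge0|exact: L2_nrm].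
have bE : bdlin (fun f => f w).
  by split => //; exists c; [exact: ltW|move=> f /hb'[]].
have bD v : bdlin (fun f => cdif f w v).
  split; first by move=> a f g Af Ag; exact: cdif_lin.
  exists (c * vn v); first by rewrite mulr_ge0 ?vn_ge0// ltW.
  by move=> f /hb'[_ + _] => /(_ v); rewrite mulrAC.
split => //.
- split => //; apply: (bdlin_l2bd bE); first exact: ltW.
  by move=> f /hb'[].
- move=> v; split => //; apply: (bdlin_l2bd (bD v)).
    by rewrite mulr_ge0 ?vn_ge0// ltW.
  by move=> f /hb'[_ + _] => /(_ v); rewrite mulrAC.
- move=> v vr; have vr' : vn v < r by clear -bd oOm vr r0; lra.
  have h f : A2 f -> normc (f (w + v) - f w - cdif f w v) <= c * vn v ^+ 2 * nrm Om f.
    by move=> /hb'[_ _ /(_ v vr')]; rewrite mulrAC.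
  apply: (@bdlin_l2bd (fun f => f (w + v) - f w - cdif f w v)) => //.
    split; last by exists (c * vn v ^+ 2) => //; rewrite mulr_ge0 ?sqr_ge0// ltW.
    by move=> a f g Af Ag; rewrite cdif_lin//; ring.
  by rewrite mulr_ge0 ?sqr_ge0// ltW.
Qed.

Lemma vn00 z : vn (z - z) = 0. Proof. by rewrite subrr vn0. Qed.

Lemma bdlin_eval z : Om z -> bdlin (fun f => f z).
Proof.
move=> /local_family[r [c [r0 _ /(_ z)]]]; rewrite vn00 => /(_ r0)[_ [] //].
Qed.

Lemma bdlin_cdif z v : Om z -> bdlin (fun f => cdif f z v).
Proof.
by move=> /local_family[r [c [r0 _ /(_ z)]]]; rewrite vn00 => /(_ r0)[_ _ /(_ v)[]].
Qed.

Lemma l2E z : Om z -> l2 (kE z).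
Proof. by move=> /bdlin_eval/bdlin_l2. Qed.

Lemma l2D' z v : Om z -> l2 (kD z v).
Proof. by move=> /(bdlin_cdif v)/bdlin_l2. Qed.

Lemma kernelE z w : Om z -> Om w -> bergman_kernel Om z w = pair (kE z) (kE w).
Proof. by move=> Oz Ow; apply: ccvg_lim; apply: pairP; exact: l2E. Qed.

(** The constant 1 lies in [A^2], so [1 <= B(z, z) * |1|^2] by duality. A bound uniform in [z] is
    needed for the local growth estimate. *)
Lemma kappa_ge : exists2 k0 : R, 0 < k0 &
  forall z, Om z -> k0 <= complex.Re (pair (kE z) (kE z)).
Proof.
have [_ _ _ bO] := bd; have A1 := A2_cst oOm bO.
pose N := nrm2 Om (fun=> 1) + 1.
have N0 : 0 < N by rewrite /N; have := nrm2_ge0 Om (fun=> 1); clear -bd oOm; lra.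
exists N^-1; first by rewrite invr_gt0.
move=> z Oz; have lz := l2E Oz.
have := dual_bound (bdlin_eval Oz) (l2bd_self lz) A1; rewrite normc1 => h.
have : 1 ^+ 2 <= (Num.sqrt (complex.Re (pair (kE z) (kE z))) * nrm Om (fun=> 1)) ^+ 2.
  by rewrite ler_pXn2r ?nnegrE// (le_trans _ h).
rewrite expr1n exprMn sqr_sqrtr ?pair_ge0// sqr_nrm => h2.
rewrite -[N^-1]mul1r ler_pdivrMr//; apply: le_trans h2 _.
by rewrite ler_wpM2l ?pair_ge0// /N; clear -bd oOm; lra.
Qed.

Lemma kappa_gt0 z : Om z -> 0 < complex.Re (pair (kE z) (kE z)).
Proof. by have [k0 k00 h] := kappa_ge => /h; exact: lt_le_trans. Qed.

Lemma inner_le f k : A2 f -> normc (ip f (phi k)) ^+ 2 <= nrm2 Om f.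
Proof.
move=> Af; have := bessel_eq oOm A2_phi Af (@on_phi k.+1); rewrite big_ord_recr /=.
have := nrm2_ge0 Om (fun z => f z - \sum_(j < k.+1) ip f (phi j) * phi j z).
have : 0 <= \sum_(j < k) normc (ip f (phi j)) ^+ 2 by apply: sumr_ge0 => j _; exact: sqr_ge0.
by clear -bd oOm; lra.
Qed.

(** Riesz-Fischer: [F] is the sum of the [(a j)^* * phi j], the conjugate matching the second
    argument of [pair]. It turns the l2 vectors [kM w Y], [kE w] and [kE z] into the holomorphic
    functions of the final estimate. *)
Lemma kernel_function (a : nat -> R[i]) : l2 a -> exists F, [/\ A2 F,
  nrm2 Om F <= complex.Re (pair a a),
  forall z, Om z -> F z = pair (kE z) a &
  forall z v, Om z -> cdif F z v = pair (kD z v) a].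
Proof.
move=> la; have [K hK] := la; pose u N z := \sum_(j < N) (a j)^* * phi j z.
have Au N : A2 (u N) by exact: (A2_sum oOm N (fun j => (a j)^*) A2_phi).
have tail N M : (N <= M)%N -> nrm2 Om (fun z => u M z - u N z) = \sum_(N <= j < M) normc (a j) ^+ 2.
  move=> NM; pose c j := if (N <= j)%N then (a j)^* else 0.
  have -> : (fun z => u M z - u N z) = (fun z => \sum_(j < M) c j * phi j z).
    apply/funext => z; rewrite /u (sum_tail (fun j => (a j)^* * phi j z))//.
    rewrite -(big_mkord xpredT (fun j => c j * phi j z)) (@big_cat_nat _ _ _ N 0%N M)//=.
    rewrite [X in _ = X + _]big_nat_cond [X in _ = X + _]big1 ?add0r; last first.
      by move=> j /andP[/andP[_ jN] _]; rewrite /c ifF ?mul0r// leqNgt jN.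
    by rewrite big_nat_cond [RHS]big_nat_cond; apply: eq_bigr => j /andP[/andP[h _] _]; rewrite /c h.
  rewrite (nrm2_psum oOm A2_phi c (@on_phi M)).
  rewrite -(big_mkord xpredT (fun j => normc (c j) ^+ 2)) (big_cat_nat (n := N))//=.
  rewrite [X in X + _]big_nat_cond [X in X + _]big1 ?add0r; last first.
    by move=> j /andP[/andP[_ jN] _]; rewrite /c ifF ?normc0 ?expr0n//; rewrite leqNgt jN.
  rewrite big_nat_cond [RHS]big_nat_cond; apply: eq_bigr => j /andP[/andP[h _] _].
  by rewrite /c h normcJ.
have cau e : 0 < e -> exists N, forall k l, (N <= k)%N -> (N <= l)%N ->
     (L2normsq Om (fun z => u k z - u l z)%R <= (e ^+ 2)%:E)%E.
  move=> e0; have e20 : 0 < e ^+ 2 by rewrite exprn_gt0.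
  have [N hN] := tail_small hK e20; exists N => k l Nk Nl.
  wlog kl : k l Nk Nl / (l <= k)%N.
    move=> W; have [kl|/ltnW lk] := leqP l k; first exact: W.
    rewrite (_ : L2normsq _ _ = L2normsq Om (fun z => u l z - u k z)); first exact: W.
    by apply: eq_integral => t _; rewrite normcBC.
  rewrite L2_nrm2; last exact: A2B.
  by rewrite lee_fin tail// ltW// hN.
have [F [AF lim cv cvD]] := bergman_complete oOm Au cau.
exists F; split => //; first last.
- move=> z v Oz; apply/esym/pair_uniq => //; first exact: l2D'.
  move: (cvD z v Oz); apply: eq_ccvg => N.
  rewrite (bdlin_sum N (fun j => (a j)^*) (bdlin_cdif v Oz)).
  by apply: eq_bigr => j _; rewrite mulrC.
- move=> z Oz; apply/esym/pair_uniq => //; first exact: l2E.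
  by move: (cv z Oz); apply: eq_ccvg => N; apply: eq_bigr => j _; rewrite mulrC.
(* Knowing the coefficients of [F], the norm bound follows from [bessel_eq] and the smallness of the
   residual. *)
have ipF k : ip F (phi k) = (a k)^*.
  apply/eqP; rewrite -subr_eq0 -normc_eq0 eq_le normc_ge0 andbT.
  apply/ler_addgt0Pl => e e0; rewrite addr0.
  have [N hN] := lim e e0; pose M := maxn N k.+1.
  have Ad : A2 (fun z => u M z - F z) by exact: A2B.
  have h1 : nrm2 Om (fun z => u M z - F z) <= e ^+ 2.
    by have := hN M (leq_maxl _ _); rewrite L2_nrm2.
  have h2 : ip (u M) (phi k) = (a k)^*.
    by apply: (inner_psum oOm A2_phi (fun j => (a j)^*) (@on_phi M)); exact: leq_maxr.
  have := le_trans (inner_le k Ad) h1.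
  rewrite innerB//; last exact: A2_phi.
  by rewrite h2 normcBC ler_pXn2r ?nnegrE ?normc_ge0 ?(ltW e0).
apply/ler_addgt0Pl => e e0.
have se0 : 0 < Num.sqrt e by rewrite sqrtr_gt0.
have [N hN] := residual_small AF se0.
have := hN N (leqnn N); rewrite -(ltr_pXn2r (ltn0Sn 1)) ?nnegrE ?nrm_ge0 ?sqrtr_ge0//.
rewrite sqr_nrm sqr_sqrtr ?(ltW e0)// (bessel_eq oOm A2_phi AF (@on_phi N)).
have [_ /(_ N)] := l2bd_self la; rewrite sqr_sqrtr ?pair_ge0//.
under [X in _ - X < _]eq_bigr do rewrite ipF normcJ.
by clear -bd oOm; lra.
Qed.

End kernel.

(** * Differentiable curves in l2 *)

Section curves_in_l2.
Context {R : realType}.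
Local Open Scope complex_scope.
Local Notation normc := (@Normc.normc R).
Implicit Types (F G : R[i] -> nat -> R[i]) (A B : nat -> R[i]).

(** Complex differentiability at 0 of a curve in l2 with value [A0], derivative [A1] and a quadratic
    remainder measured in the l2 norm. *)
Definition lexp F A0 A1 := F 0 = A0 /\ exists r c : R, [/\ 0 < r, 0 <= c &
  forall a, normc a < r -> l2bd (fun j => F a j - A0 j - a * A1 j) (c * normc a ^+ 2)].

Lemma l2bd_le (a : nat -> R[i]) (K K' : R) : K <= K' -> l2bd a K -> l2bd a K'.
Proof.
move=> KK [K0 h]; have K'0 := le_trans K0 KK; split => // N.
by apply: le_trans (h N) _; rewrite ler_pXn2r ?nnegrE.
Qed.

Lemma l2_0 : l2 (fun=> 0 : R[i]).
Proof.
by exists 0; split => // N; rewrite big1 ?expr0n// => j _; rewrite normc0 expr0n.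
Qed.

Lemma lexp_cst A0 : lexp (fun=> A0) A0 (fun=> 0).
Proof.
split=> //; exists 1, 0; split => // a _; rewrite mul0r; split => // N.
by rewrite big1 ?expr0n// => j _; rewrite mulr0 subr0 subrr normc0 expr0n.
Qed.

Lemma wexp_lexp F A0 A1 G B0 B1 : l2 A0 -> l2 B0 -> l2 A1 -> l2 B1 ->
  lexp F A0 A1 -> lexp G B0 B1 ->
  wexp (fun a => pair (F a) (G a)) (pair A1 B0) (pair A0 B1).
Proof.
move=> lA lB lA1 lB1 [Ae [r [c [r0 c0 h]]]] [Be [s [d [s0 d0 h']]]].
rewrite -Ae in lA h *; rewrite -Be in lB h' *.
apply: (@wexp_pair _ F G A1 B1 (Num.min r s) (Num.max c d)) => //.
- by rewrite lt_min r0.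
- by rewrite le_max c0.
- move=> a; rewrite lt_min => /andP[/h ha _]; apply: l2bd_le ha.
  by rewrite ler_wpM2r ?sqr_ge0// le_max lexx.
- move=> a; rewrite lt_min => /andP[_ /h' ha]; apply: l2bd_le ha.
  by rewrite ler_wpM2r ?sqr_ge0// le_max lexx orbT.
Qed.

Lemma small_line n (v : 'rV[R[i]]_n.+1) (r : R) : 0 < r ->
  exists2 s : R, 0 < s & forall a, normc a < s -> vn (a *: v) < r.
Proof.
move=> r0; have v0 := vn_ge0 v; have W : 0 < vn v + 1 by rewrite ltr_wpDl.
exists (r / (vn v + 1)); first exact: divr_gt0.
move=> a; rewrite vnZ ltr_pdivlMr// => h; apply: le_lt_trans h.
by rewrite ler_wpM2l ?normc_ge0// lerDl.
Qed.

End curves_in_l2.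

(** * The metric and the logarithmic derivative in terms of l2 vectors *)

Section metric.
Context {R : realType} {n : nat}.
Local Open Scope complex_scope.
Local Notation normc := (@Normc.normc R).
Local Notation Cn := 'rV[R[i]]_n.+1.
Implicit Types (z w v X Y zeta : Cn) (f g h : Cn -> R[i]).
Variable Om : set Cn.
Hypothesis bd : bounded_domain Om.
Local Notation A2 := (bergman_space Om).
Local Notation E := (kE Om).
Local Notation D := (kD Om).
Local Notation kap z := (pair (E z) (E z)).

Let oOm : open Om. Proof. by case: bd. Qed.

Lemma line_in z v : Om z -> exists2 r : R, 0 < r & forall a, normc a < r -> Om (z + a *: v).
Proof.
move=> Oz; have [r r0 hr] := open_vn oOm Oz; have [s s0 hs] := small_line v r0.
by exists s => // a /hs h; apply: hr; rewrite addrAC subrr add0r.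
Qed.

Lemma lexp_kE z v : Om z -> lexp (fun a => E (z + a *: v)) (E z) (D z v).
Proof.
move=> Oz; split; first by rewrite scale0r addr0.
have [r [c [r0 c0 /(_ z)]]] := local_family bd Oz; rewrite vn00 => /(_ r0)[_ _ _ h].
have [s s0 hs] := small_line v r0.
exists s, (c * vn v ^+ 2); split => // [|a /hs/h].
  by rewrite mulr_ge0 ?sqr_ge0// ltW.
rewrite vnZ exprMn mulrA mulrAC; congr l2bd; apply/funext => j.
by rewrite /kD cdifZv.
Qed.

(** [S] is the sequence of second derivatives of the basis. In the expansion of [<E, D>] it occurs
    only in the coefficient of the conjugate variable, so its existence is all that is asserted. *)
Lemma lexp_kD z X v : Om z ->
  exists2 S, l2 S & lexp (fun a => D (z + a *: X) v) (D z v) S.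
Proof.
move=> Oz; have [r [c [r0 c0 h]]] := second_bounds X v oOm Oz.
have [s s0 hs] := line_in X Oz.
(* [second_bounds] gives a number for each [f] separately; characterising it as a derivative makes
   it unique, and hence linear in [f]. *)
pose D2 f := xget 0 [set d | cder (fun a => cdif f (z + a *: X) v) 0 d].
have hD f : A2 f -> [/\ cder (fun a => cdif f (z + a *: X) v) 0 (D2 f),
    normc (D2 f) <= c * nrm Om f &
    forall a, normc a < r ->
      normc (cdif f (z + a *: X) v - cdif f z v - a * D2 f) <= c * normc a ^+ 2 * nrm Om f].
  move=> Af; have N0 := nrm_ge0 Om f.
  have [|d2 d2c hd2] := h f (nrm Om f) (proj1 Af) N0; first by rewrite L2_nrm.
  have cd : cder (fun a => cdif f (z + a *: X) v) 0 d2.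
    move=> e e0; pose K := c * nrm Om f; have K0 : 0 <= K by exact: mulr_ge0.
    have W : 0 < K + 1 by rewrite ltr_wpDl.
    exists (Num.min r (e / (K + 1))) => [|a]; first by rewrite lt_min r0 divr_gt0.
    rewrite subr0 lt_min ltr_pdivlMr// => /andP[/hd2 h1 h2].
    rewrite scale0r addr0; apply: le_trans h1 _; rewrite expr2 mulrA -/K.
    rewrite ler_wpM2r ?normc_ge0//; have := normc_ge0 a.
    by move: h2; clear -bd oOm; lra.
  have E2 : D2 f = d2 by apply: (cder_uniq _ cd); apply: (xgetPex 0 (ex_intro _ d2 cd)).
  rewrite E2; split => // a /hd2.
  by rewrite [d2 * a]mulrC mulrAC.
have bl : bdlin Om D2.
  split; last by exists c => // f /hD[].
  move=> a f g Af Ag; have [cf _ _] := hD f Af; have [cg _ _] := hD g Ag.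
  have [|cfg _ _] := hD (fun z => a * f z + g z).
    exact: (A2D oOm (A2Z oOm a Af) Ag).
  apply: (cder_uniq cfg).
  have := cderD (cderM (cder_cst a 0) cf) cg; rewrite mul0r add0r.
  apply: cder_near; exists s => // t; rewrite subr0 => /hs Ot.
  by rewrite (cdif_lin _ _ Ot).
exists (fun j => D2 (bergman_basis Om j)); first exact: bdlin_l2.
split; first by rewrite scale0r addr0.
exists (Num.min r s), c; split => // [|a]; first by rewrite lt_min r0.
rewrite lt_min => /andP[ar /hs Oa].
apply: (@bdlin_l2bd _ _ _ bd (fun f => cdif f (z + a *: X) v - cdif f z v - a * D2 f)).
- have := bdlin_comb a (bdlin_comb 1 (bdlin_cdif bd v Oa) (bdlin_cdif bd v Oz)) bl.
  by congr bdlin; apply/funext => f; rewrite mul1r.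
- by rewrite mulr_ge0 ?sqr_ge0.
- by move=> f /hD[_ _ /(_ a ar)].
Qed.

Lemma kap_real z : Om z -> kap z = (complex.Re (kap z))%:C.
Proof. by move=> Oz; exact: pair_real (l2E bd Oz). Qed.

Lemma kap_neq0 z : Om z -> kap z != 0.
Proof.
move=> Oz; rewrite kap_real//; apply/eqP => /complexI/eqP.
by rewrite gt_eqF// kappa_gt0.
Qed.

Lemma wexp_kap z v : Om z ->
  wexp (fun a => kap (z + a *: v)) (pair (D z v) (E z)) (pair (E z) (D z v)).
Proof.
move=> Oz; have lE := l2E bd Oz; have lD := l2D' bd v Oz.
by apply: wexp_lexp => //; exact: lexp_kE.
Qed.

Lemma wexp_log_diag z v : Om z ->
  wexp (fun a => log_bergman_diag Om (z + a *: v))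
    (pair (D z v) (E z) / kap z) (pair (E z) (D z v) / kap z).
Proof.
move=> Oz; have [r r0 hr] := line_in v Oz.
pose k a := complex.Re (kap (z + a *: v)).
have z0 : z + 0 *: v = z by rewrite scale0r addr0.
have k0 : 0 < k 0 by rewrite /k z0; exact: kappa_gt0.
have w : wexp (fun a => (k a)%:C) (pair (D z v) (E z)) (pair (E z) (D z v)).
  apply: (wexp_near _ (wexp_kap v Oz)).
  by exists r => // a /hr Oa; rewrite /k -kap_real.
have := wexp_ln k0 w; rewrite [k 0]/k z0 -kap_real//; apply: wexp_near.
by exists r => // a /hr Oa; rewrite /log_bergman_diag kernelE.
Qed.

Local Notation e_ k := (delta_mx 0 k : Cn).

Lemma dzbar_log_diag z k : Om z ->
  dzbar k (log_bergman_diag Om) z = pair (E z) (D z (e_ k)) / kap z.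
Proof. by move=> Oz; have [] := dz_wexp (wexp_log_diag (e_ k) Oz). Qed.

(** The inner derivative is the quotient [<E, D e_k> / <E, E>] along the whole line near [z]; the
    product and inverse rules for [wexp] differentiate it once more. *)
Lemma dz_dzbar_log_diag z j k : Om z ->
  dz j (dzbar k (log_bergman_diag Om)) z = pair (D z (e_ j)) (D z (e_ k)) / kap z -
    pair (E z) (D z (e_ k)) * pair (D z (e_ j)) (E z) / kap z ^+ 2.
Proof.
move=> Oz; have [r r0 hr] := line_in (e_ j) Oz.
have z0 : z + 0 *: e_ j = z by rewrite scale0r addr0.
have [S lS hS] := lexp_kD (e_ j) (e_ k) Oz.
have w1 := wexp_lexp (l2E bd Oz) (l2D' bd (e_ k) Oz) (l2D' bd (e_ j) Oz) lS (lexp_kE (e_ j) Oz) hS.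
have w2 := wexp_kap (e_ j) Oz.
have k'0 : kap (z + 0 *: e_ j) != 0 by rewrite z0 kap_neq0.
have w3 := @wexpV _ (fun a => kap (z + a *: e_ j)) _ _ k'0 w2.
have w4 := wexpM w1 w3.
have [|-> _] := @dz_wexp _ _ (dzbar k (log_bergman_diag Om)) z j _ _ (wexp_near _ w4).
  by exists r => // a /hr Oa; rewrite dzbar_log_diag.
by rewrite z0; field; exact: kap_neq0.
Qed.

Definition lam z X := pair (D z X) (E z) / kap z.

(* The representer of [f |-> 'd f z X], projected orthogonally to that of the
   evaluation at [z]. *)
Definition kM z X : nat -> R[i] := fun j => D z X j - lam z X * E z j.

Lemma l2M z X : Om z -> l2 (kM z X).
Proof.
by move=> Oz; apply: l2B; [exact: l2D'|apply: l2Z; exact: l2E].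
Qed.

Lemma pair_kM z X b : Om z -> l2 b ->
  pair (kM z X) b = pair (D z X) b - lam z X * pair (E z) b.
Proof.
move=> Oz lb; have lE := l2E bd Oz; have lD := l2D' bd X Oz.
by rewrite pairBl ?pairZl//; exact: l2Z.
Qed.

Lemma pair_kM_E z X : Om z -> pair (kM z X) (E z) = 0.
Proof.
move=> Oz; rewrite pair_kM//; last exact: l2E.
by rewrite /lam divfK ?subrr// kap_neq0.
Qed.

Lemma pair_kM_kM z X : Om z -> pair (kM z X) (kM z X) = pair (kM z X) (D z X).
Proof.
move=> Oz; have lE := l2E bd Oz; have lD := l2D' bd X Oz; have lM := l2M X Oz.
rewrite {2}/kM pairBr//; last exact: l2Z.
by rewrite pairZr// pair_kM_E// mulr0 subr0.
Qed.

Lemma kD_sum z X : D z X = (fun i => \sum_j X 0 j * D z (e_ j) i).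
Proof. by apply/funext => i; rewrite /kD cdif_sumv. Qed.

(** [|M|^2 = <M, D> = <D, D> - <D, E> <E, D> / <E, E>], which after expansion over the coordinate
    vectors is the quotient rule of [dz_dzbar_log_diag]. *)
Lemma metric_form z X : Om z ->
  bergman_metric Om z X X = pair (kM z X) (kM z X) / kap z.
Proof.
move=> Oz; have lE := l2E bd Oz; have lD v := l2D' bd v Oz.
rewrite pair_kM_kM// pair_kM// /lam.
have -> : pair (D z X) (D z X) =
    \sum_j \sum_k pair (D z (e_ j)) (D z (e_ k)) * X 0 j * (X 0 k)^*.
  rewrite {1}kD_sum pair_suml//; apply: eq_bigr => j _.
  rewrite (kD_sum z X) pair_sumr// mulr_sumr; apply: eq_bigr => k _; ring.
have -> : pair (D z X) (E z) = \sum_j X 0 j * pair (D z (e_ j)) (E z).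
  by rewrite kD_sum pair_suml.
have -> : pair (E z) (D z X) = \sum_k (X 0 k)^* * pair (E z) (D z (e_ k)).
  by rewrite kD_sum pair_sumr.
rewrite mulr_suml mulr_suml -sumrB mulr_suml; apply: eq_bigr => j _.
rewrite mulr_sumr -sumrB mulr_suml; apply: eq_bigr => k _.
rewrite dz_dzbar_log_diag//; field; exact: kap_neq0.
Qed.

Lemma metric_Re z X : Om z -> complex.Re (bergman_metric Om z X X) =
  complex.Re (pair (kM z X) (kM z X)) / complex.Re (kap z).
Proof.
move=> Oz; rewrite metric_form// (pair_real (l2M X Oz)) (kap_real Oz).
by rewrite -fmorphV -rmorphM.
Qed.

Lemma metric_Re_ge0 z X : Om z -> 0 <= complex.Re (bergman_metric Om z X X).
Proof.
move=> Oz; rewrite metric_Re// divr_ge0//; last exact: ltW (kappa_gt0 bd Oz).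
exact: pair_ge0 (l2M X Oz).
Qed.

Lemma berezinE z zeta : Om z -> Om zeta -> (berezin_kernel Om z zeta)%:C =
  pair (E z) (E zeta) * (pair (E z) (E zeta))^* / kap z.
Proof.
move=> Oz Oze; rewrite /berezin_kernel !kernelE// mulcJ [in RHS]kap_real//.
by rewrite -fmorphV -rmorphM.
Qed.

Lemma berezin_gt0 z zeta : Om z -> Om zeta -> pair (E z) (E zeta) != 0 ->
  0 < berezin_kernel Om z zeta.
Proof.
move=> Oz Oze b0; rewrite /berezin_kernel !kernelE// divr_gt0 ?kappa_gt0//.
by rewrite exprn_gt0// normc_gt0.
Qed.

(** [P = b * b^* / <E, E>] with [b = <E w, E zeta>] holomorphic in [w], so [b^*] does not
    contribute. The term [<D, E> / <E, E>] from the denominator is precisely what replaces [D] by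
    its projection [M]. *)
Lemma d_log_form w zeta Y : Om w -> Om zeta -> pair (E w) (E zeta) != 0 ->
  d_log_berezin Om zeta Y w = pair (kM w Y) (E zeta) / pair (E w) (E zeta).
Proof.
move=> Ow Oze b0; have lE := l2E bd Ow; have lD v := l2D' bd v Ow.
have lZ := l2E bd Oze.
have k0 := kap_neq0 Ow.
have dzE j : dz j (fun w => (ln (berezin_kernel Om w zeta))%:C) w =
    pair (D w (e_ j)) (E zeta) / pair (E w) (E zeta) - pair (D w (e_ j)) (E w) / kap w.
  have [r r0 hr] := line_in (e_ j) Ow.
  have z0 : w + 0 *: e_ j = w by rewrite scale0r addr0.
  (* The point [zeta] is a constant curve with derivative 0, so the coefficient of the conjugate
     variable vanishes. *)
  have w1 := wexp_lexp lE lZ (lD (e_ j)) l2_0 (lexp_kE (e_ j) Ow) (lexp_cst _).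
  have c0 : (0 : R[i])^* = 0 by apply: complex_ext; rewrite /= ?oppr0.
  have p0 : pair (E w) (fun=> 0) = 0.
    apply/eqP; rewrite -normc_eq0 eq_le normc_ge0 andbT.
    have [K hK] := lE; rewrite -(mulr0 K); apply: pair_bd hK _.
    by split => // N; rewrite big1 ?expr0n// => i _; rewrite normc0 expr0n.
  rewrite p0 in w1.
  have w2 := wexp_kap (e_ j) Ow.
  have k'0 : kap (w + 0 *: e_ j) != 0 by rewrite z0 kap_neq0.
  have w3 := @wexpV _ (fun a => kap (w + a *: e_ j)) _ _ k'0 w2.
  have w4 := wexpM (wexpM w1 (wexp_conj w1)) w3.
  pose k a := berezin_kernel Om (w + a *: e_ j) zeta.
  have k00 : 0 < k 0 by rewrite /k z0; exact: berezin_gt0.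
  have w5 := @wexp_near _ _ (fun a => (k a)%:C) _ _
    (ex_intro2 _ _ r r0 (fun a ar => esym (berezinE (hr a ar) Oze))) w4.
  have [-> _] := @dz_wexp _ _ (fun w => (ln (berezin_kernel Om w zeta))%:C) w j _ _
    (wexp_ln k00 w5).
  rewrite /k z0 berezinE// c0 mulr0 addr0; field.
  rewrite k0 b0 /=; have := b0; rewrite -normc_eq0 -normcJ normc_eq0 => ->.
  by [].
rewrite /d_log_berezin pair_kM// /lam.
under eq_bigr do rewrite dzE.
have -> : pair (D w Y) (E w) = \sum_j Y 0 j * pair (D w (e_ j)) (E w).
  by rewrite kD_sum pair_suml.
have -> : pair (D w Y) (E zeta) = \sum_j Y 0 j * pair (D w (e_ j)) (E zeta).
  by rewrite kD_sum pair_suml.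
rewrite mulr_suml mulr_suml -sumrB mulr_suml; apply: eq_bigr => j _.
by field; rewrite k0 b0.
Qed.

End metric.

(** * The pullback inequality *)

Section nonvanishing.
Context {R : realType} {n : nat}.
Local Open Scope complex_scope.
Local Notation normc := (@Normc.normc R).
Local Notation Cn := 'rV[R[i]]_n.+1.
Implicit Types (z w v X Y zeta : Cn) (Om : set Cn) (C : R).

(* The bound [|d_w log P(w, zeta)|^2 <= C] with its denominators cleared. *)
Definition berezin_bounded Om C := forall w zeta, Om w -> Om zeta ->
  pair (kE Om w) (kE Om zeta) != 0 -> forall Y,
  normc (pair (kM Om w Y) (kE Om zeta)) ^+ 2 <=
    C * complex.Re (bergman_metric Om w Y Y) * normc (pair (kE Om w) (kE Om zeta)) ^+ 2.

(** Two cases fall outside the quotient in the supremum: [Y = 0], where the logarithmic derivative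
    is 0, and a vanishing metric value. *)
Lemma berezin_bound Om C : bounded_domain Om -> 0 < C ->
  (ereal_sup [set d_log_berezin_normsq Om p.1 p.2 |
       p in [set p : Cn * Cn |
              [/\ Om p.1, Om p.2 & berezin_kernel Om p.1 p.2 <> 0%R]]]
    <= C%:E)%E -> berezin_bounded Om C.
Proof.
move=> bd C0 hC w zeta Ow Oz b0 Y.
set b := pair (kE Om w) _ in b0 *; set p := pair (kM Om w Y) _.
set g := complex.Re _; have g0 : 0 <= g by exact: metric_Re_ge0.
have rhs : 0 <= C * g * normc b ^+ 2 by rewrite mulr_ge0 ?sqr_ge0// mulr_ge0// ltW.
have d := d_log_form bd Y Ow Oz b0; rewrite -/p -/b in d.
have [Y0|Y0] := eqVneq Y 0.
  have : d_log_berezin Om zeta Y w = 0.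
    by rewrite /d_log_berezin big1// => j _; rewrite Y0 mxE mul0r.
  move/eqP; rewrite d mulf_eq0 invr_eq0 (negPf b0) orbF => /eqP ->.
  by rewrite normc0 expr0n.
have s : ((normc (p / b) ^+ 2 / g)%:E <= C%:E)%E.
  apply: le_trans hC; apply: le_trans (ereal_sup_ubound _); last first.
    exists (w, zeta) => //=; split => //; apply/eqP; rewrite gt_eqF//.
    exact: berezin_gt0.
  by apply: ereal_sup_ubound; exists Y => //=; rewrite d.
(* Division by 0 yields 0, so the hypothesis gives no information here; but then [kM w Y] has norm
   0, and Cauchy-Schwarz gives [p = 0]. *)
have [g00|gn0] := eqVneq g 0.
  have lM := l2M bd Y Ow; have lE := l2E bd Oz.
  have : complex.Re (pair (kM Om w Y) (kM Om w Y)) = 0.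
    move/eqP: g00; rewrite /g metric_Re// mulf_eq0 invr_eq0.
    by rewrite [X in _ || X]gt_eqF ?orbF ?kappa_gt0// => /eqP.
  have := pair_bd (l2bd_self lM) (l2bd_self lE) => + h; rewrite h sqrtr0 mul0r -/p => p0.
  by rewrite (_ : p = 0) ?normc0 ?expr0n//; apply/eqP; rewrite -normc_eq0 eq_le p0 normc_ge0.
have gp : 0 < g by rewrite lt_neqAle eq_sym gn0.
move: s; rewrite lee_fin ler_pdivrMr// normcM normcV exprMn exprVn ler_pdivrMr//.
by rewrite exprn_gt0// normc_gt0.
Qed.

(** [D = M + lam E]: the projection is bounded through [|lam| <= |D| |E| / k0], and the part along
    [M] through the hypothesis, where the metric is at most [(c * vn v) ^+ 2 / k0]. These are the
    two summands of [c']. *)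
Lemma local_growth Om C z0 zeta : bounded_domain Om -> 0 < C -> berezin_bounded Om C ->
  Om z0 -> Om zeta -> exists r c K : R, [/\ 0 < r, 0 <= c, 0 <= K &
  forall w, vn (w - z0) < r -> [/\ Om w,
    pair (kE Om w) (kE Om zeta) != 0 -> forall v,
      normc (pair (kD Om w v) (kE Om zeta)) <= c * vn v * normc (pair (kE Om w) (kE Om zeta)) &
    forall v, vn (w + v - z0) < r -> vn v < r ->
      normc (pair (kE Om (w + v)) (kE Om zeta) - pair (kE Om w) (kE Om zeta) -
             pair (kD Om w v) (kE Om zeta)) <= K * vn v ^+ 2]].
Proof.
move=> bd C0 hB Oz0 Oze; have [r [c [r0 c0 h]]] := local_family bd Oz0.
have [k0 k00 hk] := kappa_ge bd.
have lZ := l2E bd Oze; have [kz hz] := lZ; have [kz0 _] := hz.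
pose c' := c ^+ 2 / k0 + Num.sqrt (C / k0) * c.
have q0 : 0 <= C / k0 by rewrite divr_ge0// ltW.
have c'0 : 0 <= c' by rewrite addr_ge0 ?mulr_ge0 ?sqrtr_ge0 ?sqr_ge0 ?invr_ge0// ltW.
exists r, c', (c * kz); split => //; first by rewrite mulr_ge0// ltW.
move=> w wz; have [Ow [_ hE] hD hR] := h w wz.
have lE := l2E bd Ow; have lD v := l2D' bd v Ow; have kp := kappa_gt0 bd Ow.
have kw := hk w Ow.
split => //; last first.
  move=> v wv vr; have [Owv _ _ _] := h _ wv; have lEv := l2E bd Owv.
  rewrite -!pairBl//; last exact: l2B.
  have [_ _ _ /(_ v vr) hv] := h w wz.
  by rewrite mulrAC; exact: pair_bd hv hz.
move=> b0 v; have [_ hDv] := hD v; have v0 := vn_ge0 v.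
set b := pair (kE Om w) _ in b0 *.
have -> : pair (kD Om w v) (kE Om zeta) =
    pair (kM Om w v) (kE Om zeta) + lam Om w v * b.
  by rewrite pair_kM// subrK.
have t1 : normc (lam Om w v) <= c ^+ 2 / k0 * vn v.
  rewrite /lam normcM normcV (kap_real bd Ow) normcR (gtr0_norm kp) mulrAC.
  apply: ler_pM; rewrite ?normc_ge0 ?invr_ge0 ?(ltW kp)//.
    by apply: le_trans (pair_bd hDv hE) _; rewrite expr2 mulrAC.
  by rewrite lef_pV2 ?posrE.
have lM := l2M bd v Ow.
(* The projection does not increase the norm: [|M|^2 = <M, D> <= |M| |D|]. *)
have mm : complex.Re (pair (kM Om w v) (kM Om w v)) <= (c * vn v) ^+ 2.
  set x := complex.Re _; have x0 : 0 <= x by exact: pair_ge0.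
  have hx : x <= Num.sqrt x * (c * vn v).
    have := pair_bd (l2bd_self lM) hDv; rewrite -pair_kM_kM// -/x.
    by apply: le_trans; apply: le_trans (normc_Re _); exact: ler_norm.
  have cv0 : 0 <= c * vn v by rewrite mulr_ge0// ltW.
  have s0 := sqrtr_ge0 x; rewrite -(sqr_sqrtr x0) ler_pXn2r ?nnegrE//.
  have [-> //|sn] := eqVneq (Num.sqrt x) 0.
  have sp : 0 < Num.sqrt x by rewrite lt_neqAle eq_sym sn.
  by rewrite -(ler_pM2l sp) -expr2 sqr_sqrtr.
have t2 : normc (pair (kM Om w v) (kE Om zeta)) <= Num.sqrt (C / k0) * c * vn v * normc b.
  have cv0 : 0 <= c * vn v by rewrite mulr_ge0// ltW.
  rewrite -(ler_pXn2r (ltn0Sn 1)) ?nnegrE ?normc_ge0//; last first.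
    by rewrite -[Num.sqrt _ * c * _]mulrA !mulr_ge0 ?normc_ge0 ?sqrtr_ge0// ltW.
  apply: le_trans (hB w zeta Ow Oze b0 v) _; rewrite -/b.
  rewrite -[Num.sqrt _ * c * _]mulrA [leRHS]exprMn ler_wpM2r ?sqr_ge0// [leRHS]exprMn sqr_sqrtr//.
  rewrite metric_Re// mulrA [leRHS]mulrAC.
  apply: ler_pM; rewrite ?invr_ge0 ?(ltW kp)//; last by rewrite lef_pV2 ?posrE.
    by rewrite mulr_ge0 ?(ltW C0)//; exact: pair_ge0.
  by rewrite ler_wpM2l// ltW.
apply: le_trans (normcD _ _) _; rewrite normcM /c'.
have t3 := ler_wpM2r (normc_ge0 b) t1.
by move: t2 t3; clear -R; lra.
Qed.

(** With the linear lower bound as induction hypothesis, a step loses at most [B * h / 4] to the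
    relative drift and [B * h / 4] to the quadratic error, together the slope [h / 2]. At time 1 at
    least [B / 2] remains. *)
Lemma discrete_gronwall (x : nat -> R) (B M h : R) : 0 < B -> 0 < h -> M * h <= B / 4 ->
  B <= x 0%N ->
  (forall k, k.+1%:R * h <= 1 -> 0 < x k -> x k * (1 - h / 4) - M * h ^+ 2 <= x k.+1) ->
  forall k, k%:R * h <= 1 -> B * (1 - k%:R * h / 2) <= x k.
Proof.
move=> B0 h0 Mh x0 step; elim=> [|k IH] kh; first by rewrite !mul0r subr0 mulr1.
have kh' : k%:R * h <= 1 by apply: le_trans kh; rewrite ler_wpM2r ?(ltW h0)// ler_nat.
have xk := IH kh'; have t0 : 0 <= k%:R * h by rewrite mulr_ge0// ltW.
have xp : 0 < x k.
  by apply: lt_le_trans xk; rewrite mulr_gt0//; move: kh'; clear -R; lra.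
apply: le_trans (step k kh xp).
have h1 : h <= 1.
  have : (k.+1%:R - 1) * h >= 0 by rewrite mulr_ge0 ?(ltW h0)// subr_ge0 ler1n.
  by move: kh; clear -R; lra.
have s1 : B * (1 - k%:R * h / 2) * (1 - h / 4) <= x k * (1 - h / 4).
  by rewrite ler_wpM2r//; move: h1; clear -R; lra.
have s2 : M * h * h <= B / 4 * h by rewrite ler_wpM2r// ltW.
have s3 : 0 <= B * (k%:R * h) * h by rewrite !mulr_ge0// ltW.
rewrite -natr1 expr2; move: s1 s2 s3; move: (k%:R) => q.
by clear -R; lra.
Qed.

(* A function whose logarithmic derivative is bounded cannot drop to 0 along a
   short segment; this is Gronwall's lemma on a subdivision. *)
Lemma growth_nonzero (b : Cn -> R[i]) (db : Cn -> Cn -> R[i]) z0 (r c K : R) :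
  0 < r -> 0 <= c -> 0 <= K ->
  (forall w, vn (w - z0) < r -> b w != 0 -> forall v, normc (db w v) <= c * vn v * normc (b w)) ->
  (forall w v, vn (w - z0) < r -> vn (w + v - z0) < r -> vn v < r ->
    normc (b (w + v) - b w - db w v) <= K * vn v ^+ 2) ->
  exists2 rho : R, 0 < rho <= r & forall w w', vn (w - z0) < rho -> vn (w' - z0) < rho ->
    b w != 0 -> b w' != 0.
Proof.
move=> r0 c0 K0 Hg Hr.
(* Then [c * vn v <= 1 / 4] for the whole displacement, which is the drift allowed in
   [discrete_gronwall], and the segment stays in the ball of radius [r]. *)
pose rho := Num.min (r / 4) (8 * (c + 1))^-1.
have W : 0 < 8 * (c + 1) by rewrite mulr_gt0// ltr_wpDl.
have rho0 : 0 < rho by rewrite lt_min divr_gt0// invr_gt0.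
have rho1 : 4 * rho <= r.
  by have : rho <= r / 4 by [rewrite ge_min lexx]; clear -R; lra.
have rho2 : c * (2 * rho) <= 4^-1.
  have : rho <= (8 * (c + 1))^-1 by rewrite ge_min lexx orbT.
  rewrite -(ler_pM2l W) divff ?gt_eqF//.
  by move: rho0; clear -R; lra.
exists rho => [|w w' hw hw' b0].
  by rewrite rho0 /=; move: rho0 rho1; clear -R; lra.
pose v := w' - w.
have v2 : vn v < 2 * rho.
  have := vnD (w' - z0) (z0 - w); rewrite addrA subrK -/v [vn (z0 - w)]vnB.
  by move: hw hw'; clear -R; lra.
pose B := normc (b w); have B0 : 0 < B by rewrite normc_gt0.
pose M := K * vn v ^+ 2; have M0 : 0 <= M by rewrite mulr_ge0 ?sqr_ge0.
(* The subdivision is so fine that [M * h <= B / 4]; it may depend on [b w], while [rho] may not. *)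
pose N := Num.bound (M / (B / 4)).
have B4 : 0 < B / 4 by rewrite divr_gt0.
have hN : M / (B / 4) < N%:R by apply: archi_boundP; rewrite divr_ge0// ltW.
pose h : R := N.+1%:R^-1; have h0 : 0 < h by rewrite invr_gt0.
have Nh : N.+1%:R * h = 1 by rewrite divff ?gt_eqF.
have Mh : M * h <= B / 4.
  rewrite ler_pdivrMr// -ler_pdivrMl// mulrC; apply/ltW/(lt_trans hN).
  by rewrite ltr_nat.
pose wk (k : nat) := w + (k%:R * h)%:C *: v.
have v0 := vn_ge0 v.
have wk_near k : k%:R * h <= 1 -> vn (wk k - z0) < r.
  move=> kh; have kh0 : 0 <= k%:R * h by rewrite mulr_ge0// ltW.
  have := vnD (w - z0) ((k%:R * h)%:C *: v); rewrite vnZ normcR ger0_norm// addrAC -/(wk k).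
  have : k%:R * h * vn v <= 1 * vn v by rewrite ler_wpM2r.
  by move: hw v2 rho0 rho1; clear -R; lra.
have := @discrete_gronwall (fun k => normc (b (wk k))) B M h B0 h0 Mh.
rewrite {1}/wk mul0r scale0r addr0 => /(_ (lexx _)) G.
have /G : forall k, k.+1%:R * h <= 1 -> 0 < normc (b (wk k)) ->
    normc (b (wk k)) * (1 - h / 4) - M * h ^+ 2 <= normc (b (wk k.+1)).
  move=> k kh1 xk.
  have kh : k%:R * h <= 1 by apply: le_trans kh1; rewrite ler_wpM2r ?(ltW h0)// ler_nat.
  have bk : b (wk k) != 0 by rewrite -normc_gt0.
  have wS : wk k + h%:C *: v = wk k.+1.
    by rewrite /wk -addrA -scalerDl -rmorphD -natr1 mulrDl mul1r.
  have vh : vn (h%:C *: v) = h * vn v by rewrite vnZ normcR gtr0_norm.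
  have h1 : h <= 1 by rewrite invf_le1// ler1n.
  have hv : h * vn v <= vn v by rewrite ler_piMl.
  have := Hr (wk k) (h%:C *: v) (wk_near k kh); rewrite wS vh => /(_ (wk_near _ kh1)) R1.
  have {}R1 := R1 ltac:(move: hv v2 rho0 rho1; clear -R; lra).
  have := Hg (wk k) (wk_near k kh) bk (h%:C *: v); rewrite vh => R2.
  have e1 := normc_lower (b (wk k)) (b (wk k.+1)).
  have e2 := normcD (b (wk k.+1) - b (wk k) - db (wk k) (h%:C *: v))
    (db (wk k) (h%:C *: v)).
  rewrite subrK normcBC in e2.
  have e3 : c * (h * vn v) * normc (b (wk k)) <= h / 4 * normc (b (wk k)).
    rewrite ler_wpM2r ?normc_ge0// mulrCA ler_wpM2l ?(ltW h0)//.
    apply: le_trans rho2; rewrite ler_wpM2l//; exact: ltW.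
  rewrite exprMn mulrCA in R1.
  rewrite [M * _]mulrC /M.
  by move: e1 e2 e3 R1 R2; clear -R; lra.
move=> /(_ N.+1); rewrite Nh => /(_ (lexx _)) hfin.
have wN : wk N.+1 = w' by rewrite /wk Nh scale1r /v addrC subrK.
rewrite wN in hfin; rewrite -normc_gt0; apply: lt_le_trans hfin.
by move: B0; clear -R; lra.
Qed.

(** One radius serves all pairs [w], [w'], in either order. Hence the nonvanishing set and the zero
    set are both open. *)
Lemma nonzero_nearby Om C z0 zeta : bounded_domain Om -> 0 < C -> berezin_bounded Om C ->
  Om z0 -> Om zeta -> exists2 r : R, 0 < r & forall w w', vn (w - z0) < r -> vn (w' - z0) < r ->
  [/\ Om w, Om w' & pair (kE Om w) (kE Om zeta) != 0 -> pair (kE Om w') (kE Om zeta) != 0].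
Proof.
move=> bd C0 hB Oz0 Oze.
have [r [c [K [r0 c0 K0 H]]]] := local_growth bd C0 hB Oz0 Oze.
have [|w v wr|rho /andP[rho0 rr] h] := @growth_nonzero (fun w => pair (kE Om w) (kE Om zeta))
    (fun w v => pair (kD Om w v) (kE Om zeta)) z0 r c K r0 c0 K0.
- by move=> w /H[].
- by have [_ _] := H w wr; exact.
exists rho => // w w' hw hw'; split; last exact: h.
- by have [] := H w (lt_le_trans hw rr).
- by have [] := H w' (lt_le_trans hw' rr).
Qed.

(** The nonvanishing set of [B(., zeta)] contains [zeta] and is open and closed in the connected set
    [Om]. *)
Lemma kernel_neq0 Om C w zeta : bounded_domain Om -> 0 < C -> berezin_bounded Om C ->
  Om w -> Om zeta -> pair (kE Om w) (kE Om zeta) != 0.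
Proof.
move=> bd C0 hB Ow Oze; have [_ oOm cO _] := bd.
pose b x := pair (kE Om x) (kE Om zeta).
suff : Om `&` [set x | b x != 0] = Om by move=> S; have : Om w by []; rewrite -{1}S => -[].
apply: cO.
- by exists zeta; split => //=; exact: kap_neq0.
- exists (Om `&` [set x | b x != 0]); last by rewrite setIA setIid.
  apply: vn_open => z [Oz bz]; have [r r0 hr] := nonzero_nearby bd C0 hB Oz Oze.
  exists r => // x xz; have zz : vn (z - z) < r by rewrite subrr vn0.
  have [_ Ox h] := hr z x zz xz.
  by split => //=; exact: h.
- exists (~` (Om `&` [set x | b x = 0])); last first.
    apply/seteqP; split => x [Ox /= h]; split => //; first by move=> [_ /eqP]; apply/negP.
    by apply/negP => /eqP b0; apply: h.
  rewrite closedC; apply: vn_open => z [Oz bz]; have [r r0 hr] := nonzero_nearby bd C0 hB Oz Oze.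
  exists r => // x xz; have zz : vn (z - z) < r by rewrite subrr vn0.
  have [Ox _ h] := hr x z xz zz.
  by split => //=; apply/eqP; apply: contraTT isT => /h; rewrite -/(b z) bz eqxx.
Qed.

End nonvanishing.

(** * The test function and the final estimate *)

Section contraction.
Context {R : realType}.
Local Open Scope complex_scope.
Local Notation normc := (@Normc.normc R).

Lemma differentiable_mulc n (f g : 'rV[R[i]]_n -> R[i]) z :
  differentiable f z -> differentiable g z -> differentiable (fun z => f z * g z) z.
Proof. move=> hf hg. exact: (differentiableM hf hg). Qed.

Lemma differentiable_invc n (f : 'rV[R[i]]_n -> R[i]) z : f z != 0 ->
  differentiable f z -> differentiable (fun z => (f z)^-1) z.
Proof. move=> f0 hf. exact: (differentiableV hf f0). Qed.

Lemma cdif_comp n m (f : 'rV[R[i]]_n -> 'rV[R[i]]_m) (g : 'rV[R[i]]_m -> R[i]) z X :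
  differentiable f z -> differentiable g (f z) ->
  differentiable (fun z => g (f z)) z /\ cdif (fun z => g (f z)) z X = cdif g (f z) ('d f z X).
Proof.
move=> df dg; split; first exact: (differentiable_comp df dg).
rewrite !cdifE. by rewrite (diff_comp df dg).
Qed.

Lemma cder_line0 n (f : 'rV[R[i]]_n -> R[i]) z X : differentiable f z ->
  cder (fun a => f (z + a *: X)) 0 (cdif f z X).
Proof.
move=> df; have := @differentiable_line R n f z X 0.
by rewrite scale0r addr0; apply.
Qed.

Lemma pullback_bound n m (Om1 : set 'rV[R[i]]_n.+1) (Om2 : set 'rV[R[i]]_m.+1) (C : R) :
  bounded_domain Om1 -> bounded_domain Om2 -> 0 < C -> berezin_bounded Om2 C ->
  forall f : 'rV[R[i]]_n.+1 -> 'rV[R[i]]_m.+1,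
  holomorphic_on Om1 f -> (forall z, Om1 z -> Om2 (f z)) ->
  forall z X : 'rV[R[i]]_n.+1, Om1 z ->
  complex.Re (pullback_metric Om2 f z X X) <= C * complex.Re (bergman_metric Om1 z X X).
Proof.
move=> bd1 bd2 C0 hB f hf fO z X Oz; rewrite /pullback_metric.
set w := f z; set Y := 'd f z X.
have Ow : Om2 w by exact: fO.
set G := complex.Re _.
have g1 := metric_Re_ge0 bd1 X Oz.
have [G0|Gp] := leP G 0; first by apply: le_trans G0 _; rewrite mulr_ge0// ltW.
have lM := l2M bd2 Y Ow; have lE := l2E bd2 Ow; have lE1 := l2E bd1 Oz.
(* [Mf] is [zeta |-> <E zeta, M w Y>]; [Kw] and [K1] are [B2(., w)] and [B1(., z)]. The quotient
   [Mf / Kw] is the conjugate of the logarithmic derivative, written so as to be holomorphic in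
   [zeta]. *)
have [Mf [[hM _] _ Me Md]] := kernel_function bd2 lM.
have [Kw [[hK _] _ Ke _]] := kernel_function bd2 lE.
have [K1 [A1 N1 K1e _]] := kernel_function bd1 lE1.
have nz zeta : Om2 zeta -> pair (kE Om2 w) (kE Om2 zeta) != 0.
  exact: kernel_neq0 bd2 C0 hB Ow.
have Kn0 zeta : Om2 zeta -> Kw zeta != 0.
  move=> Oze; rewrite Ke// -normc_eq0 (pairC lE (l2E bd2 Oze)) normcJ normc_eq0.
  exact: nz.
pose u x := Mf (f x) / Kw (f x) * K1 x.
have hfM x (Ox : Om1 x) := cdif_comp X (hf x Ox) (hM _ (fO x Ox)).
have hfK x (Ox : Om1 x) := cdif_comp X (hf x Ox) (hK _ (fO x Ox)).
have hu : holomorphic_fun_on Om1 u.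
  move=> x Ox; have [hM1 _] := hfM x Ox; have [hK1 _] := hfK x Ox.
  apply: differentiable_mulc; last exact: A1.1.
  by apply: differentiable_mulc => //; apply: differentiable_invc => //; exact: Kn0 (fO x Ox).
have CG : 0 <= C * G by rewrite mulr_ge0// ltW.
have ub x : Om1 x -> normc (u x) <= Num.sqrt (C * G) * normc (K1 x).
  move=> Ox; rewrite /u normcM ler_wpM2r ?normc_ge0// normcM normcV.
  have Of := fO x Ox; have K0 := Kn0 _ Of.
  rewrite ler_pdivrMr ?normc_gt0// -(ler_pXn2r (ltn0Sn 1)) ?nnegrE ?mulr_ge0 ?sqrtr_ge0 ?normc_ge0//.
  rewrite exprMn sqr_sqrtr// Me// Ke// (pairC lM (l2E bd2 Of)) (pairC lE (l2E bd2 Of)) !normcJ.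
  exact: (hB w (f x) Ow Of (nz _ Of) Y).
have oOm1 : open Om1 by case: bd1.
have [Au Nu] := A2_dominated oOm1 (sqrtr_ge0 (C * G)) hu A1 ub.
rewrite sqr_sqrtr// in Nu.
have Mw : Mf w = 0 by rewrite Me// (pairC lM lE) pair_kM_E// rmorph0.
have uz : u z = 0 by rewrite /u Mw !mul0r.
have dMw : cdif Mf w Y = pair (kM Om2 w Y) (kM Om2 w Y).
  have lD := l2D' bd2 Y Ow.
  by rewrite Md// (pairC lM lD) -pair_kM_kM// -(pairC lM lM).
(* As [Mf w = 0], the product and quotient rules leave only the derivative of [Mf], which is
   [|M w Y|^2]; divided by [B2(w, w)] it is [G]. *)
have du : cdif u z X = G%:C * pair (kE Om1 z) (kE Om1 z).
  have [dM eM] := hfM z Oz; have [dK _] := hfK z Oz.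
  have z0 : z + 0 *: X = z by rewrite scale0r addr0.
  have c1 := cder_line0 X dM; have c2 := cder_line0 X dK.
  have c3 := cder_line0 X (A1.1 z Oz).
  have k0 : Kw (f (z + 0 *: X)) != 0 by rewrite z0; exact: Kn0.
  have := cderM (cderM c1 (cderV k0 c2)) c3.
  rewrite z0 -/w Mw !mul0r addr0 addr0 => c4.
  rewrite (cder_uniq (cder_line0 X (hu z Oz)) c4) eM dMw Ke// K1e//; congr (_ * _).
  by rewrite /G metric_Re// (pair_real lM) (kap_real bd2 Ow) -fmorphV -rmorphM.
(* Since [u z = 0], subtracting the multiple of the evaluation does not change the value at [u], but
   lowers the norm of the functional from [|D z X|] to [|M z X|], the quantity in the metric of
   [Om1]. *)
have L1 : bdlin Om1 (fun g => cdif g z X - lam Om1 z X * g z).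
  exact: (bdlin_comb _ (bdlin_cdif bd1 X Oz) (bdlin_eval bd1 Oz)).
have lM1 := l2M bd1 X Oz.
have := dual_bound bd1 L1 (l2bd_self lM1) Au.
have kp := kappa_gt0 bd1 Oz.
rewrite uz mulr0 subr0 du (kap_real bd1 Oz) -rmorphM normcR.
set k := complex.Re (pair (kE Om1 z) _) in kp N1 *.
have Gk : 0 < G * k by rewrite mulr_gt0.
rewrite gtr0_norm// => h.
have h2 : (G * k) ^+ 2 <= complex.Re (pair (kM Om1 z X) (kM Om1 z X)) * (C * G * k).
  apply: (@le_trans _ _ (complex.Re (pair (kM Om1 z X) (kM Om1 z X)) * nrm2 Om1 u)).
    rewrite -[nrm2 _ _]sqr_nrm -[complex.Re _]sqr_sqrtr ?pair_ge0// -exprMn.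
    by rewrite ler_pXn2r ?nnegrE ?mulr_ge0 ?sqrtr_ge0 ?nrm_ge0// ltW.
  rewrite ler_wpM2l ?pair_ge0//; apply: le_trans Nu _.
  by rewrite ler_wpM2l.
rewrite metric_Re// -/k mulrA ler_pdivlMr// -(ler_pM2r Gk).
apply: le_trans (_ : _ <= (G * k) ^+ 2) _; first by rewrite expr2.
by apply: le_trans h2 _; rewrite le_eqVlt; apply/orP; left; apply/eqP; ring.
Qed.

End contraction.

Unset Implicit Arguments.

Theorem theorem1 (R : realType) (n m : nat)
    (Om1 : set 'rV[R[i]]_n.+1) (Om2 : set 'rV[R[i]]_m.+1) (C : R) :
  bounded_domain Om1 -> bounded_domain Om2 -> 0 < C ->
  (ereal_sup [set d_log_berezin_normsq Om2 p.1 p.2 |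
       p in [set p : 'rV[R[i]]_m.+1 * 'rV[R[i]]_m.+1 |
              [/\ Om2 p.1, Om2 p.2 & berezin_kernel Om2 p.1 p.2 <> 0%R]]]
    <= C%:E)%E ->
  forall f : 'rV[R[i]]_n.+1 -> 'rV[R[i]]_m.+1,
  holomorphic_on Om1 f -> (forall z, Om1 z -> Om2 (f z)) ->
  forall z X : 'rV[R[i]]_n.+1, Om1 z ->
  complex.Re (pullback_metric Om2 f z X X) <= C * complex.Re (bergman_metric Om1 z X X).
Proof.
move=> bd1 bd2 C0 hC f hf fO z X Oz.
exact: (pullback_bound bd1 bd2 C0 (berezin_bound bd2 C0 hC) hf fO X Oz).
Qed.
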